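(* Let $M$ be a complex manifold (compact or noncompact) with $\dim M\geq 2$, and let $z_{0}\in M$. Then there exists a quasi-plurisubharmonic function $\varphi$ on $M$ such that for every plurisubharmonic function $\varphi_{A}$ defined near $z_{0}$, with logarithmic poles and with $\varphi_{A}\geq\varphi$ near $z_{0}$, one has $$c_{z_{0}}(\varphi)<c_{z_{0}}(\varphi_{A}).$$
   Context: Plurisubharmonic functions take values in $[-\infty,+\infty)$ and are not identically $-\infty$ on any connected component. A function on a complex manifold is quasi-plurisubharmonic if locally it can be written as $\psi+v$ with $\psi$ plurisubharmonic and $v$ smooth. For a (quasi-)plurisubharmonic function $\varphi$, the multiplier ideal sheaf $\mathcal{I}(\varphi)$ is the sheaf of germs of holomorphic functions $f$ such that $|f|^{2}e^{-2\varphi}$ is locally integrable. The complex singularity exponent of $\varphi$ at $z_{0}$ is $$c_{z_{0}}(\varphi):=\sup\{c \mid \mathcal{I}(c\varphi)_{z_{0}}=\mathcal{O}_{z_{0}}\}\in(0,+\infty],$$ where $\mathcal{O}_{z_0}$ is the ring of germs of holomorphic functions at $z_0$; equivalently, it is the supremum of $c\ge 0$ such that $e^{-2c\varphi}$ is integrable near $z_{0}$. A (quasi-)plurisubharmonic function $\varphi_{A}$ defined near $z_{0}$ has logarithmic poles if there exist a real number $c\in\mathbb{R}$ and finitely many holomorphic functions $g_{1},\dots,g_{N}$ near $z_{0}$ such that $\varphi_{A}=c\log\sum_{k=1}^{N}|g_{k}|^{2}+O(1)$ near $z_{0}$, where $O(1)$ denotes a bounded function. *)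

(* Defs.v *)
From HB Require Import structures.
From mathcomp Require Import all_boot all_order all_algebra.
From mathcomp.real_closed Require Import complex.
From mathcomp Require Import all_classical all_reals all_analysis.
Set Implicit Arguments.
Unset Strict Implicit.
Unset Printing Implicit Defensive.
Import Order.TTheory GRing.Theory Num.Theory.
Import numFieldNormedType.Exports.
Local Open Scope classical_set_scope.
Local Open Scope ring_scope.

(* MathComp-Analysis gives the normed structure of a scalar field only to
   variables of the abstract number-field types and to [K^o]; these instances
   make it available on [R[i]], with the modulus as norm. *)
HB.instance Definition _ (R : rcfType) := PseudoPointedMetric.copy R[i] R[i]^o.
HB.instance Definition _ (R : rcfType) := GRing.ComAlgebra.copy R[i] R[i]^o.
HB.instance Definition _ (R : rcfType) := Vector.copy R[i] R[i]^o.
HB.instance Definition _ (R : rcfType) := NormedModule.copy R[i] R[i]^o.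

(* [`|z|] lives in [R[i]]; this is the modulus as an element of [R]. *)
Definition cmod (R : realType) (z : R[i]) : R := complex.Re `|z|.

Definition cexpi (R : realType) (t : R) : R[i] := Complex (cos t) (sin t).

Section lebesgue_Rn.
Variable R : realType.

Definition tcons m (p : R * m.-tuple R) : m.+1.-tuple R :=
  [the m.+1.-tuple R of p.1 :: p.2].

Lemma measurable_tcons m : measurable_fun setT (@tcons m).
Proof. exact: measurable_cons. Qed.

Section step.
Variables (m : nat) (mu : {sigma_finite_measure set (m.-tuple R) -> \bar R}).

Definition lebesgue_step : set (m.+1.-tuple R) -> \bar R :=
  pushforward (lebesgue_measure \x mu)%E (@tcons m).

Let mpre A : measurable A -> measurable (@tcons m @^-1` A).
Proof.
move=> mA; rewrite -[X in measurable X]setTI.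
exact: (@measurable_tcons m measurableT A mA).
Qed.

Let lebesgue_step0 : lebesgue_step set0 = 0%E.
Proof. by rewrite /lebesgue_step /pushforward preimage_set0 measure0. Qed.

Let lebesgue_step_ge0 A : (0 <= lebesgue_step A)%E.
Proof. exact: (measure_ge0 (lebesgue_measure \x mu)%E). Qed.

Let lebesgue_step_sigma_additive : semi_sigma_additive lebesgue_step.
Proof.
move=> F mF tF mUF; rewrite /lebesgue_step /pushforward preimage_bigcup.
apply: measure_semi_sigma_additive.
- by move=> n; exact: mpre.
- apply/trivIsetP => /= i j _ _ ij; rewrite -preimage_setI.
  by move/trivIsetP : tF => /(_ _ _ _ _ ij) ->//; rewrite preimage_set0.
- by rewrite -preimage_bigcup; exact: mpre.
Qed.

HB.instance Definition _ := isMeasure.Build _ _ _ lebesgue_step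
  lebesgue_step0 lebesgue_step_ge0 lebesgue_step_sigma_additive.

Let lebesgue_step_sigma_finite : sigma_finite setT lebesgue_step.
Proof.
have /sigma_finiteP[F [TF ndF Foo]] := sigma_finiteT (@lebesgue_measure R).
have /sigma_finiteP[G [TG ndG Goo]] := sigma_finiteT mu.
pose h (t : m.+1.-tuple R) := (thead t, [tuple of behead t]).
have mh : measurable_fun setT h.
  apply/measurable_fun_pairP; split.
  - exact: measurable_tnth.
  - exact: measurable_behead.
have tconsK : cancel (@tcons m) h.
  move=> [x t]; rewrite /h /tcons /=; congr pair; exact: val_inj.
exists (fun n => h @^-1` (F n `*` G n)).
  rewrite -preimage_bigcup (_ : \bigcup_i _ = setT) ?preimage_setT//.
  apply/seteqP; split => // -[x y] _.
  have [n _ Fnx] : (\bigcup_i F i) x by rewrite -TF.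
  have [k _ Gky] : (\bigcup_i G i) y by rewrite -TG.
  exists (maxn n k) => //; split => /=.
  - by move: Fnx; exact/subsetPset/ndF/leq_maxl.
  - by move: Gky; exact/subsetPset/ndG/leq_maxr.
move=> k; have [mF Fk] := Foo k; have [mG Gk] := Goo k; split.
  by rewrite -[X in measurable X]setTI; apply: mh => //; exact: measurableX.
rewrite /lebesgue_step /pushforward -comp_preimage.
rewrite (_ : h \o @tcons m = id) ?preimage_id; last first.
  by apply/funext => x; exact: tconsK.
by rewrite product_measure1E// lte_mul_pinfty// ge0_fin_numE.
Qed.

HB.instance Definition _ := Measure_isSigmaFinite.Build _ _ _ lebesgue_step
  lebesgue_step_sigma_finite.
End step.

Fixpoint lebesgue_tuple m : {sigma_finite_measure set (m.-tuple R) -> \bar R} :=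
  match m with
  | 0 => \d_([tuple] : 0.-tuple R)
  | m'.+1 => lebesgue_step (lebesgue_tuple m')
  end.

End lebesgue_Rn.

Section local_notions.
Variables (R : realType) (n : nat).
Local Notation Cn := 'rV[R[i]]_n.

Definition cvec (t : (n + n).-tuple R) : Cn :=
  \row_(j < n) Complex (tnth t (lshift n j)) (tnth t (rshift n j)).

(* [w] satisfies the sub-mean value inequality on every closed complex disc
   [{a + zeta b : |zeta| <= 1}] contained in [W]. *)
Definition submean_on (W : set Cn) (w : Cn -> \bar R) : Prop :=
  forall a b : Cn,
    (forall zeta : R[i], `|zeta| <= 1 -> W (a + zeta *: b)) ->
    (w a <= ((2 * pi)^-1)%:E *
       \int[lebesgue_measure]_(t in `[0%R, (2 * pi)%R]) w (a + cexpi t *: b)%R)%E.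

(* Smoothness is in the real sense, so the derivatives are taken along real
   parameters: the real directional derivatives of [v], in all directions and
   up to order [k], exist and are continuous on [W]. *)
Fixpoint differentiable_class (k : nat) (W : set Cn) (v : Cn -> R) : Prop :=
  (forall z, W z -> {for z, continuous v}) /\
  match k with
  | 0 => True
  | k'.+1 => forall h : Cn,
      let vzh (z : Cn) := fun t : R => v (z + (t%:C)%C *: h) in
      (forall z, W z -> derivable (vzh z) 0 1) /\
      differentiable_class k' W (fun z => derive1 (vzh z) 0)
  end.

(* [icoord] is the inverse of the homeomorphism [coord] from [dom] onto the
   open set [coord @` dom]; values outside these sets are irrelevant. *)
Record chart (T : topologicalType) := Chart {
  dom : set T;
  coord : T -> Cn;
  icoord : Cn -> T;
  chart_open_dom : open dom;
  chart_open_img : open (coord @` dom);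
  chartK : forall x, dom x -> icoord (coord x) = x;
  chart_continuous : forall x, dom x -> {for x, continuous coord};
  chart_icontinuous : forall y, (coord @` dom) y -> {for y, continuous icoord}
}.

(* Complex Fréchet differentiability on an open set is holomorphy, so [atlas]
   is a holomorphic atlas of a manifold of pure dimension [n]. *)
Record complexManifold := ComplexManifold {
  cm_space :> topologicalType;
  cm_hausdorff : hausdorff_space cm_space;
  cm_second_countable : @second_countable cm_space;
  atlas : set (chart cm_space);
  cm_cover : forall x : cm_space, exists2 e, atlas e & dom e x;
  cm_holomorphic : forall e e', atlas e -> atlas e' ->
    forall y, (coord e @` (dom e `&` dom e')) y ->
      differentiable (coord e' \o icoord e) y
}.

End local_notions.

Section manifold_notions.
Variables (R : realType) (n : nat) (M : complexManifold R n).

Definition holomorphic_on (V : set M) (f : M -> R[i]) : Prop :=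
  open V /\ forall e, atlas e -> forall y, (coord e @` (V `&` dom e)) y ->
    differentiable (f \o icoord e) y.

Definition smooth_on (V : set M) (v : M -> R) : Prop :=
  open V /\ forall e, atlas e -> forall k,
    differentiable_class k (coord e @` (V `&` dom e)) (v \o icoord e).

Definition psh_on (V : set M) (u : M -> \bar R) : Prop :=
  [/\ open V,
      forall x, V x -> (u x < +oo)%E,
      forall x, V x -> forall a : R, (u x < a%:E)%E ->
        \forall y \near x, (u y < a%:E)%E,
      forall e, atlas e -> submean_on (coord e @` (V `&` dom e)) (u \o icoord e) &
      forall x, V x -> exists2 y, connected_component V x y & u y <> -oo%E].

Definition quasi_psh (phi : M -> \bar R) : Prop :=
  forall x : M, exists (V : set M) (psi : M -> \bar R) (v : M -> R),
    [/\ V x, psh_on V psi, smooth_on V v &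
        forall y, V y -> phi y = (psi y + (v y)%:E)%E].

(* A germ at [z0] is handled through its representatives, extended arbitrarily
   to [M]; the sets of representatives below are unions of germ classes, so
   they are equal if and only if the corresponding sets of germs are. *)
Definition holomorphic_germs (z0 : M) : set (M -> R[i]) :=
  [set f | exists2 V, V z0 & holomorphic_on V f].

Definition integrable_near (z0 : M) (h : M -> \bar R) : Prop :=
  exists (e : chart R n M) (W : set 'rV[R[i]]_n),
    [/\ atlas e, dom e z0, open W, W (coord e z0) & W `<=` coord e @` dom e] /\
    (lebesgue_tuple R (n + n)).-integrable [set t | W (cvec t)]
      (fun t => h (icoord e (cvec t))).

Definition multiplier_ideal (phi : M -> \bar R) (z0 : M) : set (M -> R[i]) :=
  [set f | holomorphic_germs z0 f /\
     integrable_near z0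
       (fun z => (cmod (f z) ^+ 2)%:E * expeR (- (2%:E * phi z)))%E].

Definition singularity_exponent (phi : M -> \bar R) (z0 : M) : \bar R :=
  ereal_sup [set c%:E | c in [set c : R | 0 <= c /\
    multiplier_ideal (fun z => c%:E * phi z)%E z0 = holomorphic_germs z0]].

Definition log_poles (phi : M -> \bar R) (z0 : M) : Prop :=
  exists (c : R) (N : nat) (g : 'I_N -> M -> R[i]) (b : M -> R) (K : R),
    (forall k, holomorphic_germs z0 (g k)) /\
    \forall z \near z0, `|b z| <= K /\
      phi z = (c%:E * lne (\sum_(k < N) cmod (g k z) ^+ 2)%:E + (b z)%:E)%E.

End manifold_notions.

(* Main.v *)
From HB Require Import structures.
From mathcomp Require Import all_boot all_order all_algebra.
From mathcomp Require Import ring lra.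
From mathcomp.real_closed Require Import complex.
From mathcomp Require Import all_classical all_reals all_analysis measurable_realfun.
(* After [vector], which also exports a [coord]. *)
Require Import Defs.
Set Implicit Arguments.
Unset Strict Implicit.
Unset Printing Implicit Defensive.
Import Order.TTheory GRing.Theory Num.Theory.
Import numFieldNormedType.Exports.
Local Open Scope classical_set_scope.
Local Open Scope ring_scope.

(* Fix coordinates z centred at z0, two indices i0 <> i1, the irrational number tau = sqrt 2 and
   the weights w_(i0) = tau, w_j = 1 otherwise.  Let phi be
   max (tau^-1 log |z_(i0)| - D, log |z|), corrected by a smooth function so as to vanish away
   from z0.  The set {phi < - s} is essentially the polydisc |z_j| < exp (- w_j s), whence
   c(phi) = c0 := \sum_j w_j; only c(phi) <= c0 is needed, and a second order expansion of the
   transition map proves it in an arbitrary chart, because tau <= 2.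
   If phi <= phi_A = kappa log \sum |g_l|^2 + O(1), then on the j-th axis some g_l has order
   m_j <= 1 / (2 kappa w_j) at z0, and equality cannot hold for both i0 and i1 because tau is
   irrational.  Where the inequality is strict, choose sigma > w_j with 2 kappa m_j sigma < 1.
   On {phi_A < -s} the g_l are so small that a line parallel to the j-th axis carries at most m_j
   points that are exp (- sigma s)-separated: the m_j-th divided difference of g_l at m_j + 1 such
   points would be too small to be close to the Taylor coefficient.  Hence {phi_A < -s} has volume
   O(exp (- 2 (c0 + sigma - w_j) s)), and c(phi_A) >= c0 + sigma - w_j > c0. *)

(** * Modulus, continuity and integrals on an interval *)

(** The atlas only provides complex differentiability, so everything about holomorphic functions is
    drawn from Cauchy's formula on the unit disc, applied along complex lines. Volumes are never
    computed by slicing. A lower bound comes from covering a cube by translates of a set, an upper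
    bound from counting how often translates of a set can overlap; translation invariance and the
    volume of boxes are enough for both. The two exponents are not treated alike. Integrability for
    [phi_A] may be shown in the chart where phi is built, but its failure for phi has to be shown in
    whatever chart is offered. There the coordinate of weight tau is a linear form plus an error of
    size exp (- 2 s), which is harmless exactly when it stays below exp (- tau s). Comparing
    sublevel sets of phi and [phi_A] can only give the weak inequality; strictness has to come from
    the arithmetic of the orders [m_j], which are integers, against the weights. The case kappa <= 0
    is separate: [phi_A] is then bounded below near z0. *)

Section cmod_theory.
Variable R : realType.
Implicit Types (z w : R[i]) (x y : R).

Lemma cmodE z : `|z| = (cmod z)%:C%C.
Proof. by rewrite /cmod normc_def. Qed.

Lemma cmod_sqrt z : cmod z = Num.sqrt (complex.Re z ^+ 2 + complex.Im z ^+ 2).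
Proof. by rewrite /cmod normc_def. Qed.

Lemma cmod_ge0 z : 0 <= cmod z.
Proof. by rewrite cmod_sqrt sqrtr_ge0. Qed.

Lemma cmod_sqr z : cmod z ^+ 2 = complex.Re z ^+ 2 + complex.Im z ^+ 2.
Proof. by rewrite cmod_sqrt sqr_sqrtr // addr_ge0 ?sqr_ge0. Qed.

Lemma cmod0 : cmod (0 : R[i]) = 0.
Proof. by rewrite /cmod normr0. Qed.

Lemma cmod1 : cmod (1 : R[i]) = 1.
Proof. by rewrite /cmod normr1. Qed.

Lemma cmodD z w : cmod (z + w) <= cmod z + cmod w.
Proof.
have : `|z + w| <= `|z| + `|w| by exact: ler_normD.
by rewrite !cmodE -rmorphD lecR.
Qed.

Lemma cmodN z : cmod (- z) = cmod z.
Proof. by rewrite /cmod normrN. Qed.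

Lemma cmodC z w : cmod (z - w) = cmod (w - z).
Proof. by rewrite -cmodN opprB. Qed.

Lemma cmodM z w : cmod (z * w) = cmod z * cmod w.
Proof.
have : `|z * w| = `|z| * `|w| by exact: normrM.
by rewrite !cmodE -rmorphM => /complexI.
Qed.

Lemma cmodV z : cmod z^-1 = (cmod z)^-1.
Proof.
have : `|z^-1| = `|z|^-1 by exact: normfV.
by rewrite !cmodE -fmorphV => /complexI.
Qed.

Lemma cmodX z n : cmod (z ^+ n) = cmod z ^+ n.
Proof.
have : `|z ^+ n| = `|z| ^+ n by exact: normrX.
by rewrite !cmodE -rmorphXn => /complexI.
Qed.

Lemma cmod_eq0 z : (cmod z == 0) = (z == 0).
Proof.
have <- : (`|z| == 0) = (z == 0) by exact: normr_eq0.
by rewrite cmodE (inj_eq (@complexI _) _ 0).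
Qed.

Lemma cmod_gt0 z : (0 < cmod z) = (z != 0).
Proof. by rewrite lt_def cmod_eq0 cmod_ge0 andbT. Qed.

Lemma cmodR x : cmod x%:C%C = `|x|.
Proof. by rewrite cmod_sqrt /= expr0n /= addr0 sqrtr_sqr. Qed.

Lemma normc_le1 z : (`|z| <= 1) = (cmod z <= 1).
Proof. by rewrite cmodE -(rmorph1 (@real_complex_def _ (Phant R))) lecR. Qed.

Lemma cmod_ge_Re z : `|complex.Re z| <= cmod z.
Proof. by rewrite -sqrtr_sqr cmod_sqrt ler_sqrt ?lerDl ?sqr_ge0// addr_ge0 ?sqr_ge0. Qed.

Lemma cmod_ge_Im z : `|complex.Im z| <= cmod z.
Proof. by rewrite -sqrtr_sqr cmod_sqrt ler_sqrt ?lerDr ?sqr_ge0// addr_ge0 ?sqr_ge0. Qed.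

Lemma cmod_le_ReIm z : cmod z <= `|complex.Re z| + `|complex.Im z|.
Proof.
rewrite -(@ler_pXn2r _ 2) ?nnegrE ?cmod_ge0 ?addr_ge0 // cmod_sqr.
rewrite sqrrD !real_normK ?num_real //.
by rewrite -addrA lerD2l lerDr mulrn_wge0 // mulr_ge0.
Qed.

Lemma cmodB z w : cmod (z - w) <= cmod z + cmod w.
Proof. by have := cmodD z (- w); rewrite cmodN. Qed.

Lemma cmod_revB z w : cmod z - cmod w <= cmod (z - w).
Proof. by have := cmodD (z - w) w; rewrite subrK; lra. Qed.

Lemma cmod_sum (I : Type) (r : seq I) (P : pred I) (F : I -> R[i]) :
  cmod (\sum_(i <- r | P i) F i) <= \sum_(i <- r | P i) cmod (F i).
Proof.
elim/big_ind2 : _ => //; first by rewrite cmod0.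
by move=> a b c d ab cd; apply: le_trans (cmodD _ _) (lerD ab cd).
Qed.

Lemma cmod_prod (I : Type) (r : seq I) (P : pred I) (F : I -> R[i]) :
  cmod (\prod_(i <- r | P i) F i) = \prod_(i <- r | P i) cmod (F i).
Proof. by elim/big_ind2 : _ => //; [exact: cmod1|move=> a b c d <- <-; exact: cmodM]. Qed.

Lemma cmod_expi x : cmod (cexpi x) = 1.
Proof. by rewrite cmod_sqrt /= cos2Dsin2 sqrtr1. Qed.

Lemma cexpiD x y : cexpi (x + y) = cexpi x * cexpi y.
Proof. by rewrite /cexpi sinD cosD; congr Complex; ring. Qed.

Lemma cexpi_neq0 x : cexpi x != 0.
Proof. by rewrite -cmod_gt0 cmod_expi. Qed.

Lemma cexpi0 : cexpi (0 : R) = 1.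
Proof. by rewrite /cexpi sin0 cos0. Qed.

Lemma cexpi2pi : cexpi (2 * pi) = 1 :> R[i].
Proof. by rewrite /cexpi mulrC -[pi * 2]mulrC mulr_natl cos2pi sin2pi. Qed.

Lemma ReB z w : complex.Re (z - w) = complex.Re z - complex.Re w.
Proof. by case: z; case: w. Qed.
Lemma ImB z w : complex.Im (z - w) = complex.Im z - complex.Im w.
Proof. by case: z; case: w. Qed.
Lemma ReD z w : complex.Re (z + w) = complex.Re z + complex.Re w.
Proof. by case: z; case: w. Qed.
Lemma ImD z w : complex.Im (z + w) = complex.Im z + complex.Im w.
Proof. by case: z; case: w. Qed.

End cmod_theory.

Section ccont.
Variable R : realType.
Implicit Types (f g : R -> R[i]) (a b : R).

(** Only points of the segment are compared, so that the notion applies to functions controlled on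
    the segment alone. *)
Definition ccont a b f := forall x, a <= x <= b -> forall e, 0 < e ->
  exists2 d, 0 < d & forall y, a <= y <= b -> `|y - x| < d -> cmod (f y - f x) < e.

Lemma ccont_cst a b (k : R[i]) : ccont a b (fun=> k).
Proof. by move=> x _ e e0; exists 1 => // y _ _; rewrite subrr cmod0. Qed.

Lemma ccont_add a b f g : ccont a b f -> ccont a b g -> ccont a b (fun x => f x + g x).
Proof.
move=> cf cg x xab e e0.
have e2 : 0 < e / 2 by lra.
have [d d0 fd] := cf x xab _ e2; have [d' d'0 gd] := cg x xab _ e2.
exists (Num.min d d'); first by rewrite lt_min d0.
move=> y yab; rewrite lt_min => /andP[yd yd'].
have := fd y yab yd; have := gd y yab yd'.
have := cmodD (f y - f x) (g y - g x).
by rewrite (_ : f y - f x + _ = f y + g y - (f x + g x)); [lra|ring].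
Qed.

Lemma ccont_bounded_at a b f x : ccont a b f -> a <= x <= b ->
  exists2 d, 0 < d & forall y, a <= y <= b -> `|y - x| < d -> cmod (f y) < cmod (f x) + 1.
Proof.
move=> cf xab; have [d d0 fd] := cf x xab _ ltr01.
exists d => // y yab yx; have := fd y yab yx; have := cmodD (f y - f x) (f x).
rewrite subrK; lra.
Qed.

Lemma ccont_mul a b f g : ccont a b f -> ccont a b g -> ccont a b (fun x => f x * g x).
Proof.
move=> cf cg x xab e e0.
have [d1 d10 fb] := ccont_bounded_at cf xab.
have f0 := cmod_ge0 (f x); have g0 := cmod_ge0 (g x).
have e1 : 0 < e / 2 / (cmod (f x) + 1) by rewrite divr_gt0 //; lra.
have e2 : 0 < e / 2 / (cmod (g x) + 1) by rewrite divr_gt0 //; lra.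
have [d2 d20 gd] := cg x xab _ e1; have [d3 d30 fd] := cf x xab _ e2.
exists (Num.min d1 (Num.min d2 d3)); first by rewrite !lt_min d10 d20.
move=> y yab; rewrite !lt_min => /and3P[y1 y2 y3].
have := fb y yab y1; have := gd y yab y2; have := fd y yab y3.
(rewrite !ltr_pdivlMr; try lra) => k1 k2 k3.
have := cmodD (f y * (g y - g x)) ((f y - f x) * g x).
rewrite !cmodM (_ : f y * (g y - g x) + _ = f y * g y - f x * g x); last by ring.
have := cmod_ge0 (f y); have := cmod_ge0 (g y - g x); have := cmod_ge0 (f y - f x).
nra.
Qed.

Lemma ccont_scale a b f (k : R[i]) : ccont a b f -> ccont a b (fun x => k * f x).
Proof. by move=> cf; apply: ccont_mul => //; exact: ccont_cst. Qed.

Lemma ccont_opp a b f : ccont a b f -> ccont a b (fun x => - f x).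
Proof.
move=> cf x xab e e0; have [d d0 fd] := cf x xab e e0; exists d => // y yab yx.
by have := fd y yab yx; rewrite -cmodN; congr (_ < _); congr cmod; ring.
Qed.

Lemma ccont_subr a b f g : ccont a b f -> ccont a b g -> ccont a b (fun x => f x - g x).
Proof. by move=> cf cg; apply: ccont_add => //; exact: ccont_opp. Qed.

Lemma ccont_inv a b f : (forall x, a <= x <= b -> f x != 0) -> ccont a b f ->
  ccont a b (fun x => (f x)^-1).
Proof.
move=> f0 cf x xab e e0.
have m0 : 0 < cmod (f x) by rewrite cmod_gt0 f0.
have m2 : 0 < cmod (f x) / 2 by lra.
have e1 : 0 < e * (cmod (f x) / 2 * cmod (f x)) by rewrite !mulr_gt0.
have [d d0 fd] := cf x xab _ m2; have [d' d'0 fd'] := cf x xab _ e1.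
exists (Num.min d d'); first by rewrite lt_min d0.
move=> y yab; rewrite lt_min => /andP[y1 y2].
have h1 := fd y yab y1; have h2 := fd' y yab y2.
have h3 : cmod (f x) / 2 < cmod (f y).
  by have := cmod_revB (f x) (f y); rewrite cmodC; lra.
have -> : (f y)^-1 - (f x)^-1 = (f x - f y) / (f y * f x).
  by field; rewrite !f0.
rewrite cmodM cmodV cmodM ltr_pdivrMr; last by rewrite mulr_gt0 //; lra.
rewrite cmodC; apply: lt_le_trans h2 _.
by rewrite ler_pM2l // ler_pM2r // ltW.
Qed.

Lemma ccont_eq a b f g : (forall x, a <= x <= b -> f x = g x) ->
  ccont a b f -> ccont a b g.
Proof.
move=> fg cf x xab e e0; have [d d0 fd] := cf x xab e e0; exists d => // y yab yx.
by rewrite -!fg //; apply: fd.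
Qed.

Definition rcont a b (g : R -> R) := forall x, a <= x <= b -> forall e, 0 < e ->
  exists2 d, 0 < d & forall y, a <= y <= b -> `|y - x| < d -> `|g y - g x| < e.

Lemma rcont_within a b (g : R -> R) : rcont a b g -> {within `[a, b], continuous g}.
Proof.
move=> cg; apply/subspace_continuousP => x; rewrite /= in_itv /= => xab.
apply/cvgrPdist_lt => e e0; have [d d0 gd] := cg x xab e e0.
exists d => //= y; rewrite /= => xy; rewrite in_itv /= => yab.
by rewrite distrC gd // distrC.
Qed.

Lemma rcont_integrable a b (g : R -> R) : rcont a b g ->
  lebesgue_measure.-integrable `[a, b] (EFin \o g).
Proof.
move=> cg; apply: continuous_compact_integrable; first exact: segment_compact.
exact: rcont_within.
Qed.

Lemma ccont_Re a b f : ccont a b f -> rcont a b (fun x => complex.Re (f x)).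
Proof.
move=> cf x xab e e0; have [d d0 fd] := cf x xab e e0; exists d => // y yab yx.
by rewrite -ReB; apply: le_lt_trans (cmod_ge_Re _) (fd _ _ _).
Qed.

Lemma ccont_Im a b f : ccont a b f -> rcont a b (fun x => complex.Im (f x)).
Proof.
move=> cf x xab e e0; have [d d0 fd] := cf x xab e e0; exists d => // y yab yx.
by rewrite -ImB; apply: le_lt_trans (cmod_ge_Im _) (fd _ _ _).
Qed.

Lemma ccont_cmod a b f : ccont a b f -> rcont a b (fun x => cmod (f x)).
Proof.
move=> cf x xab e e0; have [d d0 fd] := cf x xab e e0; exists d => // y yab yx.
have := fd y yab yx; have := cmod_revB (f y) (f x); have := cmod_revB (f x) (f y).
rewrite (cmodC (f x)) ltr_norml; lra.
Qed.

End ccont.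

Section integral.
Variable R : realType.
Implicit Types (a b c x : R).

Definition rint a b (g : R -> R) : R := \int[lebesgue_measure]_(x in `[a, b]) g x.

Lemma measure_itv a b : a <= b -> lebesgue_measure (`[a, b]%classic : set R) = (b - a)%:E.
Proof.
move=> ab; rewrite lebesgue_measure_itv /= lte_fin.
by case: ltgtP ab => // -> _; rewrite subrr.
Qed.

Lemma rint_cst a b k : a <= b -> rint a b (fun=> k) = k * (b - a).
Proof. by move=> ab; rewrite /rint Rintegral_cst //= measure_itv. Qed.

Lemma rint_eq a b f g : (forall x, a <= x <= b -> f x = g x) -> rint a b f = rint a b g.
Proof. by move=> fg; apply: eq_Rintegral => x; rewrite inE /= in_itv /=; exact: fg. Qed.

Lemma rint_add a b f g : rcont a b f -> rcont a b g ->
  rint a b (fun x => f x + g x) = rint a b f + rint a b g.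
Proof. by move=> cf cg; rewrite /rint RintegralD //; exact: rcont_integrable. Qed.

Lemma rint_scale a b f k : rcont a b f -> rint a b (fun x => k * f x) = k * rint a b f.
Proof. by move=> cf; rewrite /rint RintegralZl //; exact: rcont_integrable. Qed.

Lemma rint_le a b f g : rcont a b f -> rcont a b g ->
  (forall x, a <= x <= b -> f x <= g x) -> rint a b f <= rint a b g.
Proof.
move=> cf cg fg; apply: le_Rintegral => //; try exact: rcont_integrable.
Qed.

Lemma rint_split a b c f : a <= b -> b <= c -> rcont a c f ->
  rint a c f = rint a b f + rint b c f.
Proof.
move=> ab bc cf; have cf' := rcont_integrable cf.
have := @Rintegral_itvB R f (BLeft a) (BRight c) b cf'.
rewrite !bnd_simp => /(_ ab bc).
rewrite Rintegral_itv_obnd_cbnd => [h|].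
  by rewrite /rint -h addrC subrK.
apply: integrableS cf' => //.
by apply: subset_itv; rewrite ?bnd_simp.
Qed.

(* Compactness of the interval in the form of Cousin's lemma. *)
Lemma interval_induction (P : R -> R -> Prop) a b : a <= b ->
  (forall u m v, a <= u -> u <= m -> m <= v -> v <= b -> P u m -> P m v -> P u v) ->
  (forall x, a <= x <= b -> exists2 r, 0 < r & forall u v, a <= u -> u <= x -> x <= v ->
     v <= b -> v - u < r -> P u v) ->
  P a b.
Proof.
move=> ab Pm Pl.
pose S := [set x | a <= x <= b /\ P a x].
have Sa : S a.
  split; first by rewrite lexx.
  by have [|r r0 h] := Pl a; [rewrite lexx|apply: h => //; rewrite subrr].
have Sb : has_sup S.
  by split; [exists a|exists b => x [/andP[]]].
pose c := sup S.
have ac : a <= c by apply: ub_le_sup => //; exists b => x [/andP[]].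
have cb : c <= b by apply: ge_sup; [exists a|move=> x [/andP[]]].
have cab : a <= c <= b by rewrite ac.
have [r r0 hr] := Pl c cab.
have r4 : 0 < r / 4 by lra.
have [x [/andP[ax xb] Px] xc] := sup_adherent r4 Sb.
have xlec : x <= c by apply: ub_le_sup; [exists b => y [/andP[]]|split => //; rewrite ax].
pose d := Num.min b (c + r / 4).
have cd : c <= d by rewrite le_min cb; lra.
have db : d <= b by rewrite ge_min lexx.
have dr : d <= c + r / 4 by rewrite ge_min lexx orbT.
have Pd : P a d.
  apply: (Pm a x d) => //; first exact: le_trans cd.
  by apply: hr => //; rewrite -/c in xc; lra.
have dc : d <= c.
  apply: ub_le_sup; first by exists b => y [/andP[]].
  by split => //; rewrite db andbT (le_trans ac).
suff -> : b = d by [].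
by apply/eqP; rewrite eq_le db andbT /d le_min lexx /=; move: dc; rewrite /d ge_min => /orP[|]; lra.
Qed.

Lemma rcont_unif a b f e : 0 < e -> a <= b -> rcont a b f -> exists2 d, 0 < d &
  forall s t, a <= s <= b -> a <= t <= b -> `|s - t| < d -> `|f s - f t| <= e.
Proof.
move=> e0 ab cf.
(* Only [s] is confined to the subinterval while [t] ranges over all of [[a, b]]; a pair on both
   sides of a cut point then needs no special treatment. *)
apply: (@interval_induction (fun u v => exists2 d, 0 < d &
  forall s t, u <= s <= v -> a <= t <= b -> `|s - t| < d -> `|f s - f t| <= e)) => //.
- move=> u m v _ um mv _ [d d0 h1] [d' d'0 h2]; exists (Num.min d d'); first by rewrite lt_min d0.
  move=> s t /andP[us sv] tab; rewrite lt_min => /andP[k1 k2].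
  by case: (leP s m) => sm; [apply: h1|apply: h2] => //; rewrite ?us ?sv ?sm ?(ltW sm).
move=> x xab; have e2 : 0 < e / 2 by lra.
have [d d0 hd] := cf x xab _ e2.
exists (d / 2); first lra.
move=> u v au ux xv vb uv; exists (d / 2); first lra.
move=> s t /andP[us sv] tab st.
have sx : `|s - x| < d / 2 by rewrite ltr_norml; apply/andP; split; lra.
have sab : a <= s <= b by rewrite (le_trans au us) (le_trans sv vb).
have k1 := hd s sab; have k2 := hd t tab.
have tx : `|t - x| < d.
  have := ler_normD (t - s) (s - x); rewrite subrKA [`|t - s|]distrC; lra.
have := k2 tx; have := k1 ltac:(lra).
have := ler_normD (f s - f x) (f x - f t); rewrite subrKA [`|f x - f t|]distrC; lra.
Qed.

Lemma rcont_bounded a b f : a <= b -> rcont a b f -> exists M, forall t, a <= t <= b -> `|f t| <= M.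
Proof.
move=> ab cf.
apply: (@interval_induction (fun u v => exists M, forall t, u <= t <= v -> `|f t| <= M)) => //.
- move=> u m v _ um mv _ [M h1] [M' h2]; exists (Num.max M M').
  move=> s /andP[us sv]; rewrite le_max.
  by case: (leP s m) => sm; [rewrite h1 ?us|rewrite h2 ?orbT ?sv ?(ltW sm)].
move=> x xab; have [d d0 hd] := cf x xab _ ltr01.
exists d => // u v au ux xv vb uv; exists (`|f x| + 1) => t /andP[ut tv].
have := hd t; rewrite (le_trans au ut) (le_trans tv vb) => /(_ isT).
have -> : `|t - x| < d by rewrite ltr_norml; apply/andP; split; lra.
by move=> /(_ isT); have := ler_normD (f t - f x) (f x); rewrite subrK; lra.
Qed.

Lemma rcont_cst a b k : rcont a b (fun=> k).
Proof. by move=> x _ e e0; exists 1 => // y _ _; rewrite subrr normr0. Qed.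

Definition cint a b (f : R -> R[i]) : R[i] :=
  Complex (rint a b (fun x => complex.Re (f x))) (rint a b (fun x => complex.Im (f x))).

Lemma cint_eq a b f g : (forall x, a <= x <= b -> f x = g x) -> cint a b f = cint a b g.
Proof. by move=> fg; congr Complex; apply: rint_eq => x /fg ->. Qed.

Lemma cint_cst a b k : a <= b -> cint a b (fun=> k) = k * (b - a)%:C%C.
Proof. by move=> ab; rewrite /cint !rint_cst //; case: k => u v /=; simpc. Qed.

Lemma cint_add a b f g : ccont a b f -> ccont a b g ->
  cint a b (fun x => f x + g x) = cint a b f + cint a b g.
Proof.
move=> cf cg; rewrite /cint; apply/eqP; rewrite eq_complex /=.
under [X in X == _]rint_eq do rewrite ReD.
under [X in _ && (X == _)]rint_eq do rewrite ImD.
by rewrite !rint_add ?eqxx //; try exact: ccont_Re; exact: ccont_Im.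
Qed.

Lemma rcont_scale a b f k : rcont a b f -> rcont a b (fun x => k * f x).
Proof.
move=> cf x xab e e0.
have e1 : 0 < e / (`|k| + 1) by rewrite divr_gt0 // ltr_wpDl.
have [d d0 fd] := cf x xab _ e1; exists d => // y yab yx.
rewrite -mulrBr normrM; have := fd y yab yx; rewrite ltr_pdivlMr ?ltr_wpDl //.
have := normr_ge0 k; have := normr_ge0 (f y - f x); nra.
Qed.

Lemma rcont_add a b f g : rcont a b f -> rcont a b g -> rcont a b (fun x => f x + g x).
Proof.
move=> cf cg x xab e e0.
have e2 : 0 < e / 2 by lra.
have [d d0 fd] := cf x xab _ e2; have [d' d'0 gd] := cg x xab _ e2.
exists (Num.min d d'); first by rewrite lt_min d0.
move=> y yab; rewrite lt_min => /andP[yd yd'].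
have := fd y yab yd; have := gd y yab yd'.
have := ler_normD (f y - f x) (g y - g x).
by rewrite (_ : f y - f x + _ = f y + g y - (f x + g x)); [lra|ring].
Qed.

Lemma cint_scale a b f k : ccont a b f -> cint a b (fun x => k * f x) = k * cint a b f.
Proof.
move=> cf; case: k => u v; rewrite /cint; apply/eqP; rewrite eq_complex /=.
have cR := ccont_Re cf; have cI := ccont_Im cf.
have E1 x : complex.Re (Complex u v * f x) = u * complex.Re (f x) + - v * complex.Im (f x).
  by case: (f x) => p q /=; ring.
have E2 x : complex.Im (Complex u v * f x) = u * complex.Im (f x) + v * complex.Re (f x).
  by case: (f x) => p q /=.
under [X in X == _]rint_eq do rewrite E1.
under [X in _ && (X == _)]rint_eq do rewrite E2.
rewrite !rint_add ?rint_scale //; try exact: rcont_scale.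
by rewrite mulNr !eqxx.
Qed.

Lemma cint_sub a b f g : ccont a b f -> ccont a b g ->
  cint a b (fun x => f x - g x) = cint a b f - cint a b g.
Proof.
move=> cf cg; rewrite -[- cint a b g]mulN1r -cint_scale // -cint_add //.
  by apply: cint_eq => x _; rewrite mulN1r.
exact: ccont_scale.
Qed.

Lemma cint_split a b c f : a <= b -> b <= c -> ccont a c f ->
  cint a c f = cint a b f + cint b c f.
Proof.
move=> ab bc cf; rewrite /cint (rint_split ab bc (ccont_Re cf)).
by rewrite (rint_split ab bc (ccont_Im cf)).
Qed.

(* Rotating the value of the integral to the positive reals loses no constant. *)
Lemma cint_bound_rint a b f : ccont a b f ->
  cmod (cint a b f) <= rint a b (fun x => cmod (f x)).
Proof.
move=> cf.
have [->|z0] := eqVneq (cint a b f) 0.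
  rewrite cmod0; have -> : (0 : R) = rint a b (fun=> 0) by rewrite /rint Rintegral_cst // mul0r.
  by apply: rint_le; [exact: rcont_cst|exact: ccont_cmod|move=> *; exact: cmod_ge0].
set z := cint a b f in z0 *.
have m0 : 0 < cmod z by rewrite cmod_gt0.
pose u : R[i] := (cmod z)%:C%C / z.
have um : cmod u = 1 by rewrite cmodM cmodR cmodV ger0_norm ?cmod_ge0 // divff ?gt_eqF.
have h : cint a b (fun x => u * f x) = (cmod z)%:C%C.
  by rewrite cint_scale // -/z /u divfK.
have -> : cmod z = rint a b (fun x => complex.Re (u * f x)).
  by have := congr1 (@complex.Re R) h.
apply: rint_le; [exact/ccont_Re/ccont_scale|exact: ccont_cmod|].
move=> x _; apply: le_trans (ler_norm _) _; apply: le_trans (cmod_ge_Re _) _.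
by rewrite cmodM um mul1r.
Qed.

Lemma cint_bound a b f M : a <= b -> ccont a b f ->
  (forall x, a <= x <= b -> cmod (f x) <= M) -> cmod (cint a b f) <= M * (b - a).
Proof.
move=> ab cf fM; apply: le_trans (cint_bound_rint cf) _.
by rewrite -rint_cst //; apply: rint_le => //; [exact: ccont_cmod|exact: rcont_cst].
Qed.

Lemma cint_expi a b : a <= b ->
  cint a b (fun t => Complex 0 1 * cexpi t) = cexpi b - cexpi a.
Proof.
rewrite le_eqVlt => /predU1P[->|ab].
  rewrite subrr; apply/eqP; rewrite eq_complex /= /rint set_itv1.
  by rewrite !Rintegral_set1 eqxx.
have cw (h : R -> R) : continuous h -> {within `[a, b], continuous h}.
  by move=> ch; apply: continuous_subspaceT.
apply/eqP; rewrite eq_complex /= /rint /Rintegral; apply/andP; split; apply/eqP.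
- under eq_integral do rewrite mul0r mul1r sub0r.
  rewrite (@continuous_FTC2 _ _ (@cos R)) //=.
  + by apply: cw => x; apply: continuousN; exact: continuous_sin.
  + split => [x _| |]; first exact: ex_derive.
      by apply: cvg_at_right_filter; exact: continuous_cos.
    by apply: cvg_at_left_filter; exact: continuous_cos.
  + by move=> x _; rewrite derive1E derive_val.
- under eq_integral do rewrite mul0r mul1r add0r.
  rewrite (@continuous_FTC2 _ _ (@sin R)) //=.
  + by apply: cw => x; exact: continuous_cos.
  + split => [x _| |]; first exact: ex_derive.
      by apply: cvg_at_right_filter; exact: continuous_sin.
    by apply: cvg_at_left_filter; exact: continuous_sin.
  + by move=> x _; rewrite derive1E derive_val.
Qed.

Lemma ccont_expi a b : ccont a b (@cexpi R).
Proof.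
move=> x _ e e0; have e2 : 0 < e / 2 by lra.
have /cvgrPdist_lt /(_ _ e2)[d1 /= d10 h1] := @continuous_cos R x.
have /cvgrPdist_lt /(_ _ e2)[d2 /= d20 h2] := @continuous_sin R x.
exists (Num.min d1 d2); first by rewrite lt_min d10.
move=> y _; rewrite lt_min distrC => /andP[y1 y2].
have := h1 y y1; have := h2 y y2; rewrite distrC [`|cos x - _|]distrC.
have := cmod_le_ReIm (cexpi y - cexpi x); rewrite ReB ImB /=; lra.
Qed.

(** A chord is shorter than its arc: the integrand of [cint_expi] has modulus 1. *)
Lemma cexpi_lip a b : cmod (cexpi b - cexpi a) <= `|b - a|.
Proof.
wlog ab : a b / a <= b => [hw|].
  case/orP: (le_total a b) => [|ba]; first exact: hw.
  by rewrite cmodC distrC hw.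
rewrite -cint_expi // ger0_norm ?subr_ge0 // -[X in _ <= X]mul1r.
apply: cint_bound => //; first exact/ccont_scale/ccont_expi.
by move=> x _; rewrite cmodM cmod_expi mulr1 cmod_sqrt /= expr0n expr1n add0r sqrtr1.
Qed.

End integral.

(** * Cauchy's formula on the unit disc *)

Section goursat.
Variable R : realType.

Lemma pow2_small (A d : R) : 0 < d -> exists n : nat, A / 2 ^+ n < d.
Proof.
move=> d0; have [n hn] : exists n : nat, `|A| / d < n%:R.
  by exists (Num.truncn (`|A| / d)).+1; exact: truncnS_gt.
exists n; rewrite ltr_pdivrMr ?exprn_gt0 // mulrC -ltr_pdivrMr //.
apply: le_lt_trans (_ : `|A| / d < _); first by rewrite ler_pM2r ?invr_gt0 // ler_norm.
apply: lt_trans hn _; rewrite -natrX ltr_nat; exact: ltn_expl.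
Qed.

(** Goursat's bisection for any rectangle function that is additive under cuts in both directions
    and small of second order near each point. It is kept abstract because it will be applied to the
    parameter rectangles of a homotopy, not to rectangles in the plane. *)
Lemma goursat_rect (I : R -> R -> R -> R -> R[i]) (a b c d : R) :
  a <= b -> c <= d ->
  (forall x1 x2 x3 y1 y2, a <= x1 -> x1 <= x2 -> x2 <= x3 -> x3 <= b ->
     c <= y1 -> y1 <= y2 -> y2 <= d -> I x1 x3 y1 y2 = I x1 x2 y1 y2 + I x2 x3 y1 y2) ->
  (forall x1 x2 y1 y2 y3, a <= x1 -> x1 <= x2 -> x2 <= b ->
     c <= y1 -> y1 <= y2 -> y2 <= y3 -> y3 <= d ->
     I x1 x2 y1 y3 = I x1 x2 y1 y2 + I x1 x2 y2 y3) ->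
  (forall x y, a <= x <= b -> c <= y <= d -> forall e, 0 < e ->
     exists2 r, 0 < r & forall x1 x2 y1 y2, a <= x1 -> x1 <= x -> x <= x2 -> x2 <= b ->
       c <= y1 -> y1 <= y -> y <= y2 -> y2 <= d -> x2 - x1 < r -> y2 - y1 < r ->
       cmod (I x1 x2 y1 y2) <= e * ((x2 - x1) + (y2 - y1)) ^+ 2) ->
  I a b c d = 0.
Proof.
move=> ab cd Hx Hy Hloc.
pose w n : R := (b - a) / 2 ^+ n; pose h n : R := (d - c) / 2 ^+ n.
have w0 n : 0 <= w n by rewrite divr_ge0 ?subr_ge0 ?exprn_ge0.
have h0 n : 0 <= h n by rewrite divr_ge0 ?subr_ge0 ?exprn_ge0.
have wS n : w n = w n.+1 + w n.+1.
  by rewrite /w exprS; field; rewrite expf_neq0.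
have hS n : h n = h n.+1 + h n.+1.
  by rewrite /h exprS; field; rewrite expf_neq0.
pose J n (p : R * R) := cmod (I p.1 (p.1 + w n) p.2 (p.2 + h n)).
pose inr n (p : R * R) := [/\ a <= p.1, p.1 + w n <= b, c <= p.2 & p.2 + h n <= d].
pose good n (p q : R * R) := [/\ p.1 <= q.1, q.1 + w n.+1 <= p.1 + w n,
  p.2 <= q.2, q.2 + h n.+1 <= p.2 + h n & J n p <= 4 * J n.+1 q].
(* The choice of the next corner has to be total; [(0, 0)] is a dummy value for rectangles that
   leave the domain. *)
have step (np : nat * (R * R)) : exists q, inr np.1 np.2 -> good np.1 np.2 q.
  case: np => n [x y] /=.
  have [[/= i1 i2 i3 i4]|] := pselect (inr n (x, y)); last by exists (0, 0).
  have := w0 n.+1; have := h0 n.+1 => hn wn; have E1 := wS n; have E2 := hS n.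
  (* If each quarter had less than a fourth of the size of the whole, the triangle inequality would
     contradict additivity. *)
  suff [q hq] : exists q, good n (x, y) q by exists q.
  apply: contrapT => /forallNP nq.
  have lt4 q1 q2 : (q1 = x \/ q1 = x + w n.+1) -> (q2 = y \/ q2 = y + h n.+1) ->
      4 * J n.+1 (q1, q2) < J n (x, y).
    move=> k1 k2; rewrite ltNge; apply/negP => k3; apply: (nq (q1, q2)).
    by split => //=; case: k1 => ?; case: k2 => ?; subst q1 q2; lra.
  have := lt4 x y (or_introl erefl) (or_introl erefl).
  have := lt4 (x + w n.+1) y (or_intror erefl) (or_introl erefl).
  have := lt4 x (y + h n.+1) (or_introl erefl) (or_intror erefl).
  have := lt4 (x + w n.+1) (y + h n.+1) (or_intror erefl) (or_intror erefl).
  rewrite /J /= -[x + w n.+1 + _]addrA -[y + h n.+1 + _]addrA -E1 -E2.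
  rewrite (Hx x (x + w n.+1) (x + w n)); try lra.
  rewrite (Hy _ _ y (y + h n.+1) (y + h n)); try lra.
  rewrite (Hy (x + w n.+1) _ y (y + h n.+1) (y + h n)); try lra.
  set A := I x (x + w n.+1) y (y + h n.+1); set B := I x (x + w n.+1) (y + h n.+1) (y + h n).
  set C := I (x + w n.+1) (x + w n) y (y + h n.+1).
  set D := I (x + w n.+1) (x + w n) (y + h n.+1) (y + h n).
  have := cmodD (A + B) (C + D); have := cmodD A B; have := cmodD C D; lra.
have [f hf] := choice step.
pose s := fix s n := if n is m.+1 then f (m, s m) else (a, c).
have sin n : inr n (s n).
  elim: n => [|n ih]; first by split => //=; rewrite /w /h expr0 divr1; lra.
  have [g1 g2 g3 g4 _] := hf (n, s n) ih; case: ih => i1 i2 i3 i4.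
  by split; rewrite /=; move: g1 g2 g3 g4 => /=; lra.
have sgood n : good n (s n) (s n.+1) by exact: (hf (n, s n) (sin n)).
have Jn n : J 0%N (s 0%N) <= 4 ^+ n * J n (s n).
  elim: n => [|n ih]; first by rewrite expr0 mul1r.
  have [_ _ _ _ g] := sgood n; apply: le_trans ih _.
  by rewrite exprSr -mulrA ler_pM2l ?exprn_gt0.
have lo m n : (m <= n)%N -> [/\ (s m).1 <= (s n).1, (s n).1 + w n <= (s m).1 + w m,
    (s m).2 <= (s n).2 & (s n).2 + h n <= (s m).2 + h m].
  move=> /subnKC <-; elim: (n - m)%N => [|k ih]; first by rewrite addn0.
  rewrite addnS; have [g1 g2 g3 g4 _] := sgood (m + k)%N; case: ih => *.
  by split; lra.
have up m n : (s m).1 <= (s n).1 + w n /\ (s m).2 <= (s n).2 + h n.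
  case/orP: (leq_total m n) => /lo [k1 k2 k3 k4].
    by have := w0 n; have := h0 n; split; lra.
  by have := w0 m; have := h0 m; split; lra.
(* The lower left corners increase and stay below all upper right corners, so their suprema give a
   point common to all rectangles. *)
pose X := sup (range (fun n => (s n).1)); pose Y := sup (range (fun n => (s n).2)).
have XP n : (s n).1 <= X <= (s n).1 + w n.
  apply/andP; split.
    apply: ub_le_sup; last by exists n.
    by exists ((s 0%N).1 + w 0%N) => _ [m _ <-]; have [] := up m 0%N.
  apply: ge_sup; first by exists (s 0%N).1, 0%N.
  by move=> _ [m _ <-]; have [] := up m n.
have YP n : (s n).2 <= Y <= (s n).2 + h n.
  apply/andP; split.
    apply: ub_le_sup; last by exists n.
    by exists ((s 0%N).2 + h 0%N) => _ [m _ <-]; have [] := up m 0%N.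
  apply: ge_sup; first by exists (s 0%N).2, 0%N.
  by move=> _ [m _ <-]; have [] := up m n.
have Xab : a <= X <= b.
  by have := XP 0%N; have [] := sin 0%N; move=> ? ? ? ? /andP[? ?]; apply/andP; split; lra.
have Ycd : c <= Y <= d.
  by have := YP 0%N; have [] := sin 0%N; move=> ? ? ? ? /andP[? ?]; apply/andP; split; lra.
apply/eqP; rewrite -cmod_eq0; apply/eqP/le_anti; rewrite cmod_ge0 andbT leNgt.
apply/negP => I0.
pose S := (b - a) + (d - c).
have S0 : 0 <= S ^+ 2 by rewrite sqr_ge0.
pose e := cmod (I a b c d) / (S ^+ 2 + 1).
have e0 : 0 < e by rewrite divr_gt0 //; lra.
have [r r0 hr] := Hloc X Y Xab Ycd e e0.
have [n hn] := pow2_small ((b - a) + (d - c)) r0.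
have hw : w n + h n < r by rewrite /w /h -mulrDl.
have [i1 i2 i3 i4] := sin n; have /andP[x1 x2] := XP n; have /andP[y1 y2] := YP n.
have := w0 n; have := h0 n => hn0 wn0.
have := hr (s n).1 ((s n).1 + w n) (s n).2 ((s n).2 + h n) i1 x1 x2 i2 i3 y1 y2 i4.
rewrite [(s n).1 + _ - _]addrC addKr [(s n).2 + _ - _]addrC addKr.
move=> /(_ ltac:(lra) ltac:(lra)).
have -> : w n + h n = S / 2 ^+ n by rewrite /w /h -mulrDl.
have := Jn n; rewrite {1}/J /= /w /h expr0 !divr1 ![_ + (_ - _)]addrC !subrK => J1 J2.
have {J1 J2} : cmod (I a b c d) <= 4 ^+ n * (e * (S / 2 ^+ n) ^+ 2).
  by apply: le_trans J1 _; rewrite ler_pM2l ?exprn_gt0.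
(* The loss [4 ^+ n] of the bisection is exactly compensated by the square of the scale
   [1 / 2 ^+ n]. *)
have -> : 4 ^+ n * (e * (S / 2 ^+ n) ^+ 2) = e * S ^+ 2.
  rewrite exprMn exprVn -exprM mulnC exprM (_ : 2 ^+ 2 = 4 :> R); last by ring.
  by field; rewrite expf_neq0.
have : e * (S ^+ 2 + 1) = cmod (I a b c d) by rewrite /e divfK // gt_eqF //; lra.
lra.
Qed.

End goursat.

(** * Complex derivatives in one variable *)

Section cderiv.
Variable R : realType.
Implicit Types (h g : R[i] -> R[i]) (z l : R[i]).

(** The difference quotient is multiplied out, so that the point [y = z] fits in. *)
Definition cderiv h z l := forall e : R, 0 < e -> exists2 d, 0 < d &
  forall y, cmod (y - z) < d -> cmod (h y - h z - l * (y - z)) <= e * cmod (y - z).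

Definition cdiff h z := exists l, cderiv h z l.

Definition ccat h z := forall e : R, 0 < e -> exists2 d, 0 < d &
  forall y, cmod (y - z) < d -> cmod (h y - h z) < e.

Lemma cderiv_ccat h z l : cderiv h z l -> ccat h z.
Proof.
move=> hz e e0; have [d d0 hd] := hz 1 ltr01.
have l0 := cmod_ge0 l.
have e1 : 0 < e / (cmod l + 1) by rewrite divr_gt0 //; lra.
exists (Num.min d (e / (cmod l + 1))); first by rewrite lt_min d0.
move=> y; rewrite lt_min ltr_pdivlMr ?ltr_wpDl // => /andP[yd ye].
have := hd y yd; have := cmodD (h y - h z - l * (y - z)) (l * (y - z)).
rewrite subrK cmodM; nra.
Qed.

Lemma cdiff_ccat h z : cdiff h z -> ccat h z.
Proof. by case=> l; exact: cderiv_ccat. Qed.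

Lemma cderiv_cst (k z : R[i]) : cderiv (fun=> k) z 0.
Proof.
move=> e e0; exists 1 => // y _.
by rewrite subrr mul0r subrr cmod0 mulr_ge0 ?cmod_ge0 // ltW.
Qed.

Lemma cderiv_id z : cderiv id z 1.
Proof.
move=> e e0; exists 1 => // y _.
by rewrite mul1r subrr cmod0 mulr_ge0 ?cmod_ge0 // ltW.
Qed.

Lemma cderiv_add h g z l m : cderiv h z l -> cderiv g z m ->
  cderiv (fun y => h y + g y) z (l + m).
Proof.
move=> hz gz e e0; have e2 : 0 < e / 2 by lra.
have [d d0 hd] := hz _ e2; have [d' d'0 gd] := gz _ e2.
exists (Num.min d d'); first by rewrite lt_min d0.
move=> y; rewrite lt_min => /andP[/hd k1 /gd k2].
have := cmodD (h y - h z - l * (y - z)) (g y - g z - m * (y - z)).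
rewrite (_ : _ + _ = h y + g y - (h z + g z) - (l + m) * (y - z)); last by ring.
lra.
Qed.

Lemma cderiv_mul h g z l m : cderiv h z l -> cderiv g z m ->
  cderiv (fun y => h y * g y) z (l * g z + h z * m).
Proof.
move=> hz gz e e0.
have h0 := cmod_ge0 (h z); have g0 := cmod_ge0 (g z); have l0 := cmod_ge0 l.
pose S := cmod (h z) + cmod (g z) + cmod l + 2.
have S0 : 0 < S by rewrite /S; lra.
have e1 : 0 < e / S by rewrite divr_gt0.
have [d1 d10 hd1] := hz _ e1; have [d2 d20 gd] := gz _ e1.
have [d3 d30 gc] := cderiv_ccat gz e1.
have [d4 d40 gb] := cderiv_ccat gz ltr01.
exists (Num.min (Num.min d1 d4) (Num.min d2 d3)); first by rewrite !lt_min d10 d20 d30 d40.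
move=> y; rewrite !lt_min => /andP[/andP[/hd1 k1 /gb k4] /andP[/gd k2 /gc k3]].
have y0 := cmod_ge0 (y - z).
have Y0 : 0 <= e / S * cmod (y - z) by rewrite mulr_ge0 // ltW.
have gy : cmod (g y) <= cmod (g z) + 1.
  by have := cmodD (g y - g z) (g z); rewrite subrK; lra.
have -> : h y * g y - h z * g z - (l * g z + h z * m) * (y - z) =
   (h y - h z - l * (y - z)) * g y + h z * (g y - g z - m * (y - z)) +
   l * (y - z) * (g y - g z) by ring.
apply: le_trans (cmodD _ _) _; apply: le_trans (lerD (cmodD _ _) (lexx _)) _.
rewrite !cmodM.
have -> : e * cmod (y - z) = (e / S * cmod (y - z)) * (cmod (g z) + 1 + cmod (h z) + cmod l + 1).
  have -> : cmod (g z) + 1 + cmod (h z) + cmod l + 1 = S by rewrite /S; ring.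
  by rewrite mulrAC divfK // gt_eqF.
have A1 : cmod (h y - h z - l * (y - z)) * cmod (g y) <= (e / S * cmod (y - z)) * (cmod (g z) + 1).
  by apply: ler_pM; rewrite ?cmod_ge0.
have A2 : cmod (h z) * cmod (g y - g z - m * (y - z)) <= cmod (h z) * (e / S * cmod (y - z)).
  exact: ler_wpM2l.
have A3 : cmod l * cmod (y - z) * cmod (g y - g z) <= cmod l * cmod (y - z) * (e / S).
  by apply: ler_wpM2l; [rewrite mulr_ge0|exact: ltW].
lra.
Qed.

Lemma cderiv_scale h z l (k : R[i]) : cderiv h z l -> cderiv (fun y => k * h y) z (k * l).
Proof. by move=> hz; have := cderiv_mul (cderiv_cst k z) hz; rewrite mul0r add0r. Qed.

Lemma cderiv_sub h g z l m : cderiv h z l -> cderiv g z m ->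
  cderiv (fun y => h y - g y) z (l - m).
Proof.
move=> hz gz; have := cderiv_add hz (cderiv_scale (-1) gz).
by rewrite mulN1r (_ : (fun y => _) = (fun y => h y - g y)) //; apply: funext => y; rewrite mulN1r.
Qed.

Lemma cderiv_inv h z l : h z != 0 -> cderiv h z l ->
  cderiv (fun y => (h y)^-1) z (- l / h z ^+ 2).
Proof.
move=> hz0 hz e e0.
have m0 : 0 < cmod (h z) by rewrite cmod_gt0.
have m2 : 0 < cmod (h z) / 2 by lra.
have l0 := cmod_ge0 l.
pose c := cmod (h z) ^+ 2 / 2.
have c0 : 0 < c by rewrite /c divr_gt0 ?exprn_gt0.
pose b := cmod (h z) / 2 * cmod (h z) ^+ 2 .
have b0 : 0 < b by rewrite mulr_gt0 // exprn_gt0.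
have e1 : 0 < e * c / 2 by rewrite divr_gt0 // mulr_gt0.
have e2 : 0 < e * b / 2 / (cmod l + 1) by rewrite !divr_gt0 ?mulr_gt0 //; lra.
have [d1 d10 hd1] := hz _ e1; have [d2 d20 hd2] := cderiv_ccat hz m2.
have [d3 d30 hd3] := cderiv_ccat hz e2.
exists (Num.min d1 (Num.min d2 d3)); first by rewrite !lt_min d10 d20.
move=> y; rewrite !lt_min => /and3P[/hd1 k1 /hd2 k2 /hd3 k3].
have y0 := cmod_ge0 (y - z).
have hy : cmod (h z) / 2 < cmod (h y) by have := cmod_revB (h z) (h y); rewrite cmodC; lra.
have hy0 : h y != 0 by rewrite -cmod_gt0; lra.
have -> : (h y)^-1 - (h z)^-1 - - l / h z ^+ 2 * (y - z) =
   - (h y - h z - l * (y - z)) / (h y * h z) + l * (y - z) * (h y - h z) / (h y * h z ^+ 2).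
  by field; rewrite hz0 hy0.
apply: le_trans (cmodD _ _) _; rewrite !(cmodM, cmodV, cmodN, cmodX).
have A1 : cmod (h y - h z - l * (y - z)) / (cmod (h y) * cmod (h z)) <= e / 2 * cmod (y - z).
  rewrite ler_pdivrMr; last by rewrite mulr_gt0 //; lra.
  apply: le_trans k1 _.
  have : c <= cmod (h y) * cmod (h z) by rewrite /c; nra.
  move=> cc; have -> : e * c / 2 * cmod (y - z) = e / 2 * cmod (y - z) * c by ring.
  by apply: ler_wpM2l => //; rewrite mulr_ge0 //; lra.
have A2 : cmod l * cmod (y - z) * cmod (h y - h z) / (cmod (h y) * cmod (h z) ^+ 2) <= e / 2 * cmod (y - z).
  rewrite ler_pdivrMr; last by rewrite mulr_gt0 ?exprn_gt0 //; lra.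
  have bb : b <= cmod (h y) * cmod (h z) ^+ 2.
    by rewrite /b; apply: ler_wpM2r; [exact: sqr_ge0|exact: ltW].
  apply: le_trans (_ : e / 2 * cmod (y - z) * b <= _); last first.
    by apply: ler_wpM2l => //; rewrite mulr_ge0 //; lra.
  move: k3; rewrite ltr_pdivlMr ?ltr_wpDl // => k3.
  have k5 : cmod l * cmod (h y - h z) <= e * b / 2.
    by have := cmod_ge0 (h y - h z); nra.
  have -> : e / 2 * cmod (y - z) * b = e * b / 2 * cmod (y - z) by ring.
  by rewrite mulrAC; apply: ler_wpM2r.
lra.
Qed.

Lemma ccont_comp h (p : R -> R[i]) a b : ccont a b p ->
  (forall t, a <= t <= b -> ccat h (p t)) -> ccont a b (fun t => h (p t)).
Proof.
move=> cp ch x xab e e0; have [d d0 hd] := ch x xab e e0.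
have [r r0 pr] := cp x xab d d0; exists r => // y yab yx.
by apply: hd; exact: pr.
Qed.

(** Boundary points are included, with derivatives taken in full neighbourhoods: Cauchy's formula
    will be integrated over the unit circle itself. *)
Definition hol1 h := forall z, cmod z <= 1 -> cdiff h z.

End cderiv.

(** * Cauchy's formula by contracting the circle *)

Section cauchy.
Variable R : realType.
Implicit Types (h : R[i] -> R[i]) (x z : R[i]).
Local Notation E := (@cexpi R).
Local Notation I2 := (2 * pi : R).

Lemma twopi_gt0 : 0 < I2.
Proof. by rewrite mulr_gt0 // pi_gt0. Qed.

Lemma circle_neq x t : cmod x < 1 -> E t - x != 0.
Proof.
by move=> x1; rewrite subr_eq0; apply/eqP => Ex; move: x1; rewrite -Ex cmod_expi ltxx.
Qed.

Lemma circle_ge x t : 1 - cmod x <= cmod (E t - x).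
Proof. by have := cmod_revB (E t) x; rewrite cmod_expi. Qed.

Lemma circle_le x t : cmod (E t - x) <= 1 + cmod x.
Proof. by have := cmodB (E t) x; rewrite cmod_expi. Qed.

Lemma hol1_ccont h a b (p : R -> R[i]) : hol1 h -> ccont a b p ->
  (forall t, a <= t <= b -> cmod (p t) <= 1) -> ccont a b (fun t => h (p t)).
Proof. by move=> hh cp p1; apply: ccont_comp => // t /p1 /hh; exact: cdiff_ccat. Qed.

Lemma ccont_real a b : ccont a b (fun l : R => l%:C%C).
Proof.
by move=> u _ e e0; exists e => // v _; rewrite -rmorphB cmodR.
Qed.

Lemma cderiv_affine (a b z : R[i]) : cderiv (fun y => a + b * y) z b.
Proof.
have := cderiv_add (cderiv_cst a z) (cderiv_scale b (cderiv_id z)).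
by rewrite add0r mulr1.
Qed.

Section homotopy.
Variables (h : R[i] -> R[i]) (x : R[i]).
Hypotheses (hh : hol1 h) (x1 : cmod x < 1).
(** Contraction of the unit circle ([l = 1]) to the point [x] ([l = 0]) along segments. *)
Let gam (l t : R) : R[i] := x + l%:C%C * (E t - x).

Let gam1 l t : 0 <= l <= 1 -> cmod (gam l t) <= 1.
Proof.
move=> /andP[l0 l1]; have -> : gam l t = (1 - l)%:C%C * x + l%:C%C * E t.
  by rewrite /gam rmorphB /=; ring.
apply: le_trans (cmodD _ _) _; rewrite !cmodM !cmodR cmod_expi !ger0_norm ?subr_ge0 //.
have : 0 <= (1 - l) * (1 - cmod x) by rewrite mulr_ge0 ?subr_ge0 // ltW.
rewrite mulr1; nra.
Qed.

Let gam_t a b l : ccont a b (gam l).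
Proof.
apply: ccont_add; first exact: ccont_cst.
by apply: ccont_scale; apply: ccont_subr; [exact: ccont_expi|exact: ccont_cst].
Qed.

Let gam_l a b t : ccont a b (fun l => gam l t).
Proof.
apply: ccont_add; first exact: ccont_cst.
by apply: ccont_mul; [exact: ccont_real|exact: ccont_cst].
Qed.

(** Along [gam] the form [dz / (z - x)] becomes [k t dt + dl / l], for every [l > 0]. *)
Let k (t : R) : R[i] := Complex 0 1 * E t / (E t - x).

Let k_cont a b : ccont a b k.
Proof.
apply: ccont_mul; first by apply: ccont_scale; exact: ccont_expi.
apply: ccont_inv; first by move=> t _; exact: circle_neq.
by apply: ccont_subr; [exact: ccont_expi|exact: ccont_cst].
Qed.

Let cmodi : cmod (Complex 0 1 : R[i]) = 1.
Proof. by rewrite cmod_sqrt /= expr0n expr1n add0r sqrtr1. Qed.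

Let K : R := (1 - cmod x)^-1.
Let K0 : 0 < K. Proof. by rewrite invr_gt0 subr_gt0. Qed.
Let kK t : cmod (k t) <= K.
Proof.
rewrite /k !cmodM cmodi cmod_expi !mul1r cmodV /K lef_pV2 ?posrE ?cmod_gt0 ?circle_neq ?subr_gt0 //.
exact: circle_ge.
Qed.

(** The integral of [h(z) dz / (z - x)], pulled back by [gam], along the boundary of a parameter
    rectangle. *)
Let I (l1 l2 t1 t2 : R) : R[i] :=
  cint t1 t2 (fun t => (h (gam l2 t) - h (gam l1 t)) * k t) -
  cint l1 l2 (fun l => (h (gam l t2) - h (gam l t1)) * (l%:C%C)^-1).

Section fixl0.
Variable l0 : R.
Hypotheses (l0_gt0 : 0 < l0) (l0_le1 : l0 <= 1).

Let ht a b l : 0 <= l <= 1 -> ccont a b (fun t => h (gam l t)).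
Proof. by move=> l01; apply: hol1_ccont => // t _; exact: gam1. Qed.

Let hl a b t : 0 <= a -> b <= 1 -> ccont a b (fun l => h (gam l t)).
Proof.
move=> a0 b1; apply: hol1_ccont => // l /andP[al lb]; apply: gam1.
by rewrite (le_trans a0 al) (le_trans lb b1).
Qed.

Let linv a b : 0 < a -> ccont a b (fun l : R => (l%:C%C : R[i])^-1).
Proof.
move=> a0; apply: ccont_inv; last exact: ccont_real.
move=> l /andP[al _]; rewrite -cmod_gt0 cmodR normr_gt0 gt_eqF //.
exact: lt_le_trans al.
Qed.

Let f1 a b l1 l2 : 0 <= l1 <= 1 -> 0 <= l2 <= 1 ->
  ccont a b (fun t => (h (gam l2 t) - h (gam l1 t)) * k t).
Proof. by move=> *; apply: ccont_mul => //; apply: ccont_subr; exact: ht. Qed.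

Let f2 a b t1 t2 : 0 < a -> b <= 1 ->
  ccont a b (fun l => (h (gam l t2) - h (gam l t1)) * (l%:C%C)^-1).
Proof.
move=> a0 b1; apply: ccont_mul; last exact: linv.
by apply: ccont_subr; apply: hl => //; exact: ltW.
Qed.

Let gam_near l t l' t' : 0 <= l <= 1 ->
  cmod (gam l' t' - gam l t) <= 2 * `|l' - l| + `|t' - t|.
Proof.
move=> /andP[l_ge0 l_le1].
have -> : gam l' t' - gam l t = (l' - l)%:C%C * (E t' - x) + l%:C%C * (E t' - E t).
  by rewrite /gam rmorphB /=; ring.
apply: le_trans (cmodD _ _) _; rewrite !cmodM !cmodR (ger0_norm l_ge0).
have := circle_le x t'; have := cexpi_lip t t'.
move=> A1 A2; have x1' := x1.
have : `|l' - l| * cmod (E t' - x) <= `|l' - l| * 2 by apply: ler_wpM2l => //; lra.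
have : l * cmod (E t' - E t) <= 1 * cmod (E t' - E t) by apply: ler_wpM2r; rewrite ?cmod_ge0.
lra.
Qed.

(** Near any parameter point [h] is affine up to a small remainder, and the affine part contributes
    nothing, so [goursat_rect] applies. Taking [l0 > 0] keeps away from the pole of [dl / l]. *)
Lemma homotopy_rect : I l0 1 0 I2 = 0.
Proof.
have I0 : 0 <= I2 by rewrite ltW // twopi_gt0.
have l0g := l0_gt0; have l0l := l0_le1; have x1' := x1.
apply: (@goursat_rect _ I) => //.
- move=> a b c t1 t2 la ab bc c1 t10 t12 t2I.
  rewrite /I (cint_split ab bc) //; last by apply: f2 => //; lra.
  rewrite (_ : cint t1 t2 _ = cint t1 t2 (fun t => (h (gam b t) - h (gam a t)) * k t)
     + cint t1 t2 (fun t => (h (gam c t) - h (gam b t)) * k t)); first by ring.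
  rewrite -cint_add; [|by apply: f1; apply/andP; split; lra..].
  by apply: cint_eq => t _; ring.
- move=> a b t1 t2 t3 la ab b1 t10 t12 t23 t3I.
  rewrite /I (cint_split t12 t23); last by apply: f1; apply/andP; split; lra.
  rewrite (_ : cint a b _ = cint a b (fun l => (h (gam l t2) - h (gam l t1)) * (l%:C%C)^-1)
     + cint a b (fun l => (h (gam l t3) - h (gam l t2)) * (l%:C%C)^-1)); first by ring.
  rewrite -cint_add; [|by apply: f2 => //; lra..].
  by apply: cint_eq => t _; ring.
move=> l t /andP[ll l1] /andP[t0 tI] e e0.
have l01 : 0 <= l <= 1 by apply/andP; split; lra.
have [b hb] := hh (gam1 t l01).
set z := gam l t in hb.
pose r w := h w - h z - b * (w - z).
have rd : hol1 r.
  move=> w /hh[m hm]; exists (m - b).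
  have := cderiv_sub (cderiv_sub hm (cderiv_cst (h z) w)) (cderiv_affine (- (b * z)) b w).
  rewrite subr0 (_ : (fun _ => _) = r) //; apply: funext => y; rewrite /r; ring.
have li0 : 0 < l0^-1 by rewrite invr_gt0.
(* The two remainder integrals will be at most [4 * eta * s * K * (t2 - t1)] and
   [4 * eta * s * l0^-1 * (c - a)]; this [eta] bounds their sum by [e * s ^+ 2]. *)
pose eta := e / (4 * (K + l0^-1)).
have eta0 : 0 < eta by rewrite divr_gt0 // mulr_gt0 // addr_gt0.
have [d d0 hd] := hb _ eta0.
exists (d / 4); first lra.
move=> a c t1 t2 la al lc c1 t10 t1t tt2 t2I ac tt.
set s := c - a + (t2 - t1).
have rb l' t' : a <= l' <= c -> t1 <= t' <= t2 -> cmod (r (gam l' t')) <= eta * (2 * s).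
  move=> /andP[i1 i2] /andP[i3 i4].
  have dist : cmod (gam l' t' - z) <= 2 * (c - a) + (t2 - t1).
    apply: le_trans (gam_near _ _ _ l01) _.
    have : `|l' - l| <= c - a by rewrite ler_norml; apply/andP; split; lra.
    have : `|t' - t| <= t2 - t1 by rewrite ler_norml; apply/andP; split; lra.
    by lra.
  apply: le_trans (hd _ _) _; first by lra.
  by rewrite ler_pM2l // /s; lra.
have rt u v l' : 0 <= l' <= 1 -> ccont u v (fun t => r (gam l' t)).
  by move=> ?; apply: hol1_ccont => // ? _; exact: gam1.
have rl u v t' : 0 <= u -> v <= 1 -> ccont u v (fun l => r (gam l t')).
  move=> u0 v1; apply: hol1_ccont => // ? /andP[? ?]; apply: gam1.
  by apply/andP; split; lra.
have a01 : 0 <= a <= 1 by apply/andP; split; lra.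
have c01 : 0 <= c <= 1 by apply/andP; split; lra.
have t12 : t1 <= t2 by lra.
have lac : a <= c by lra.
(* For the affine part of [h] at [z] both integrals equal [b * (c - a) * (E t2 - E t1)] and cancel;
   only the remainder [r] is left. *)
have -> : I a c t1 t2 = cint t1 t2 (fun t => (r (gam c t) - r (gam a t)) * k t) -
    cint a c (fun l => (r (gam l t2) - r (gam l t1)) * (l%:C%C)^-1).
  rewrite /I.
  have -> : cint t1 t2 (fun t => (h (gam c t) - h (gam a t)) * k t) =
     cint t1 t2 (fun t => (r (gam c t) - r (gam a t)) * k t) +
     b * (c - a)%:C%C * (E t2 - E t1).
    rewrite -cint_expi // -cint_scale; last by apply: ccont_scale; exact: ccont_expi.
    rewrite -cint_add; last by do 2! apply: ccont_scale; exact: ccont_expi.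
      by apply: cint_eq => u _; rewrite /r /gam /k rmorphB /=; field; exact: circle_neq.
    by apply: ccont_mul => //; apply: ccont_subr; exact: rt.
  have -> : cint a c (fun l => (h (gam l t2) - h (gam l t1)) * (l%:C%C)^-1) =
     cint a c (fun l => (r (gam l t2) - r (gam l t1)) * (l%:C%C)^-1) +
     b * (E t2 - E t1) * (c - a)%:C%C.
    rewrite -cint_cst // -cint_add; last exact: ccont_cst.
      apply: cint_eq => u /andP[au _]; rewrite /r /gam; field.
      by rewrite -cmod_gt0 cmodR normr_gt0 gt_eqF //; lra.
    apply: ccont_mul; last by apply: linv; lra.
    by apply: ccont_subr; apply: rl; lra.
  by ring.
apply: le_trans (cmodB _ _) _.
have s1 : 0 <= s by rewrite /s; lra.
have B1 : cmod (cint t1 t2 (fun t => (r (gam c t) - r (gam a t)) * k t)) <=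
    4 * eta * s * K * (t2 - t1).
  apply: cint_bound => //.
    by apply: ccont_mul => //; apply: ccont_subr; exact: rt.
  move=> u u12; rewrite cmodM; apply: ler_pM; rewrite ?cmod_ge0 //.
  apply: le_trans (cmodB _ _) _.
  have := rb c u _ u12; have := rb a u _ u12.
  rewrite !lexx lac => /(_ isT) ? /(_ isT) ?; lra.
have B2 : cmod (cint a c (fun l => (r (gam l t2) - r (gam l t1)) * (l%:C%C)^-1)) <=
    4 * eta * s * l0^-1 * (c - a).
  apply: cint_bound => //.
    apply: ccont_mul; last by apply: linv; lra.
    by apply: ccont_subr; apply: rl; lra.
  move=> u uac; rewrite cmodM; have /andP[au uc] := uac.
  apply: ler_pM; rewrite ?cmod_ge0 //.
    apply: le_trans (cmodB _ _) _.
    have := rb u t2 uac; have := rb u t1 uac.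
    rewrite !lexx t12 => /(_ isT) ? /(_ isT) ?; lra.
  rewrite cmodV cmodR ger0_norm; last by lra.
  by rewrite lef_pV2 ?posrE; lra.
have E4 : 4 * eta * (K + l0^-1) = e.
  by rewrite /eta -[4 * _]mulrC -mulrA divfK // gt_eqF // mulr_gt0 // addr_gt0.
apply: le_trans (lerD B1 B2) _.
rewrite -E4 -/s expr2.
have es : 0 <= 4 * eta * s by apply: mulr_ge0 => //; apply: mulr_ge0 => //; exact: ltW.
have -> : 4 * eta * s * K * (t2 - t1) + 4 * eta * s * l0^-1 * (c - a) =
  4 * eta * s * (K * (t2 - t1) + l0^-1 * (c - a)) by ring.
have -> : 4 * eta * (K + l0^-1) * (s * s) = 4 * eta * s * ((K + l0^-1) * s) by ring.
apply: ler_wpM2l => //; rewrite /s.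
have := K0; nra.
Qed.

End fixl0.

(** The sides [t = 0] and [t = 2 * pi] of the parameter rectangle agree by periodicity, so the
    integrals over the unit circle and over a small curve [gam l] coincide; on the latter [h] is
    close to [h x]. *)
Lemma homotopy_kernel : cint 0 I2 (fun t => h (E t) * k t) = h x * cint 0 I2 k.
Proof.
have I0 := twopi_gt0; have x1' := x1.
have hE : ccont 0 I2 (fun t => h (E t)).
  by apply: hol1_ccont => //; [exact: ccont_expi|move=> t _; rewrite cmod_expi].
have hEk : ccont 0 I2 (fun t => h (E t) * k t) by exact: ccont_mul.
have hxk : ccont 0 I2 (fun t => h x * k t) by exact: ccont_scale.
rewrite -cint_scale //; apply/eqP; rewrite -subr_eq0 -cint_sub //.
rewrite -cmod_eq0; apply/eqP/le_anti; rewrite cmod_ge0 andbT leNgt; apply/negP.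
set J := cmod _ => J0.
pose eta := J / (I2 * K) / 2.
have IK : 0 < I2 * K by apply: mulr_gt0 => //; exact: K0.
have eta0 : 0 < eta by apply: divr_gt0 => //; apply: divr_gt0.
have [d d0 hd] := cdiff_ccat (hh (ltW x1)) eta0.
(* Points of the circle are at distance at most 2 from [x], so [gam l] stays within [d / 2] of
   [x]. *)
pose l := Num.min 1 (d / 4).
have l_gt0 : 0 < l by rewrite lt_min ltr01 /=; lra.
have l_le1 : l <= 1 by rewrite ge_min lexx.
have l_d : l <= d / 4 by rewrite ge_min lexx orbT.
have l01 : 0 <= l <= 1 by rewrite (ltW l_gt0).
have := homotopy_rect l_gt0 l_le1; rewrite /I.
rewrite (_ : cint l 1 _ = 0); last first.
  rewrite (@cint_eq _ _ _ _ (fun=> 0)) ?cint_cst ?mul0r // => u _.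
  by rewrite /gam cexpi2pi cexpi0 subrr mul0r.
rewrite subr0 => H.
have : J <= eta * K * (I2 - 0).
  have ct : ccont 0 I2 (fun t => h (gam l t)).
    by apply: hol1_ccont => // t _; exact: gam1.
  rewrite /J (_ : cint _ _ _ = cint 0 I2 (fun t => (h (gam l t) - h x) * k t)); last first.
    have q1 : ccont 0 I2 (fun t => (h (gam l t) - h x) * k t).
      by apply: ccont_mul => //; apply: ccont_subr => //; exact: ccont_cst.
    have q2 : ccont 0 I2 (fun t => h (E t) * k t - h x * k t) by exact: ccont_subr.
    apply/eqP; rewrite -subr_eq0 -cint_sub //.
    rewrite -[X in _ == X]H; apply/eqP/cint_eq => u _.
    rewrite (_ : gam 1 u = E u); first by ring.
    by rewrite /gam mul1r addrC subrK.
  apply: cint_bound; first exact: ltW.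
    by apply: ccont_mul => //; apply: ccont_subr => //; exact: ccont_cst.
  move=> t _; rewrite cmodM; apply: ler_pM; rewrite ?cmod_ge0 //; apply/ltW/hd.
  rewrite /gam addrC addKr cmodM cmodR (gtr0_norm l_gt0).
  have := circle_le x t; have := cmod_ge0 (E t - x); nra.
have := K0; rewrite subr0 => K1; have -> : eta * K * I2 = J / 2.
  by rewrite /eta -mulrA [K * _]mulrC mulrAC divfK // gt_eqF.
by lra.
Qed.

End homotopy.

Definition ck x t : R[i] := E t / (E t - x).

Lemma ck_cont x a b : cmod x < 1 -> ccont a b (ck x).
Proof.
move=> x1; apply: ccont_mul; first exact: ccont_expi.
apply: ccont_inv; first by move=> t _; exact: circle_neq.
by apply: ccont_subr; [exact: ccont_expi|exact: ccont_cst].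
Qed.

Lemma cauchy_kernel h x : hol1 h -> cmod x < 1 ->
  cint 0 I2 (fun t => h (E t) * ck x t) = h x * cint 0 I2 (ck x).
Proof.
move=> hh x1; have := homotopy_kernel hh x1.
have hE : ccont 0 I2 (fun t => h (E t)).
  by apply: hol1_ccont => //; [exact: ccont_expi|move=> t _; rewrite cmod_expi].
have ci : (Complex 0 1 : R[i]) != 0 by rewrite eq_complex /= oner_eq0 andbF.
rewrite (_ : cint 0 I2 (fun t => _ / _) = Complex 0 1 * cint 0 I2 (ck x)); last first.
  by rewrite -cint_scale; [apply: cint_eq => t _; rewrite /ck mulrA|exact: ck_cont].
rewrite (_ : cint 0 I2 (fun t => h _ * (_ / _)) = Complex 0 1 * cint 0 I2 (fun t => h (E t) * ck x t)).
  by rewrite mulrCA => /(mulfI ci).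
rewrite -cint_scale; last by apply: ccont_mul => //; exact: ck_cont.
by apply: cint_eq => t _; rewrite /ck; ring.
Qed.

Lemma cint_conj a b (f : R -> R[i]) : ccont a b f ->
  cint a b (fun t => conjc (f t)) = conjc (cint a b f).
Proof.
move=> cf; rewrite /cint /=; congr Complex; first by apply: rint_eq => t _; case: (f t).
rewrite -mulN1r -rint_scale; last exact: ccont_Im.
by apply: rint_eq => t _; case: (f t) => u v /=; rewrite mulN1r.
Qed.

Lemma cint_ck0 : cint 0 I2 (ck 0) = I2%:C%C.
Proof.
rewrite (@cint_eq _ _ _ _ (fun=> 1)); first by rewrite cint_cst ?ltW ?twopi_gt0 // mul1r subr0.
by move=> t _; rewrite /ck subr0 divff // cexpi_neq0.
Qed.

Lemma conjcM (u v : R[i]) : conjc (u * v) = conjc u * conjc v.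
Proof. exact: rmorphM. Qed.
Lemma conjcB (u v : R[i]) : conjc (u - v) = conjc u - conjc v.
Proof. exact: rmorphB. Qed.
Lemma conjcV (u : R[i]) : conjc u^-1 = (conjc u)^-1.
Proof. exact: fmorphV. Qed.

Lemma conj_expi t : conjc (E t) = (E t)^-1.
Proof.
apply: (mulfI (cexpi_neq0 t)); rewrite divff ?cexpi_neq0 //.
rewrite /cexpi; simpc; rewrite -!expr2 cos2Dsin2 [sin t * _]mulrC addNr //.
Qed.

(** On the circle the conjugate of [ck x] is the boundary value of [g], which is holomorphic on the
    closed disc with [g 0 = 1]. The formula at the centre, where the kernel is constantly 1, then
    yields the winding number without any logarithm. *)
Lemma cint_ck x : cmod x < 1 -> cint 0 I2 (ck x) = I2%:C%C.
Proof.
move=> x1; pose g z : R[i] := (1 - conjc x * z)^-1.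
have cx : cmod (conjc x) = cmod x by rewrite /cmod normcJ.
have g0 z : cmod z <= 1 -> 1 - conjc x * z != 0.
  move=> z1; rewrite subr_eq0; apply/eqP => /(congr1 (@cmod R)).
  rewrite cmod1 cmodM cx; have := cmod_ge0 x; have := cmod_ge0 z; nra.
have hg : hol1 g.
  move=> z z1; eexists; apply: cderiv_inv; first exact: g0.
  by apply: cderiv_sub; [exact: cderiv_cst|apply: cderiv_scale; exact: cderiv_id].
have := @cauchy_kernel g 0 hg; rewrite cmod0 => /(_ ltr01).
rewrite cint_ck0 {2}/g mulr0 subr0 invr1 mul1r => H.
apply: (can_inj (@conjcK R)); rewrite -cint_conj; last exact: ck_cont.
rewrite conjc_real -H; apply: cint_eq => t _.
rewrite /ck subr0 divff ?cexpi_neq0 // mulr1 conjcM conjcV conjcB conj_expi /g.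
have E0 := cexpi_neq0 t.
have e1 : 1 - conjc x * E t != 0 by apply: g0; rewrite cmod_expi.
rewrite -invfM; congr (_^-1); rewrite mulrBr divff //; ring.
Qed.

Theorem cauchy h x : hol1 h -> cmod x < 1 ->
  cint 0 I2 (fun t => h (E t) * ck x t) = h x * I2%:C%C.
Proof. by move=> hh x1; rewrite cauchy_kernel // cint_ck. Qed.

End cauchy.

(** * Taylor coefficients and divided differences *)

Section cauchy_consequences.
Variable R : realType.
Implicit Types (h : R[i] -> R[i]) (x y z : R[i]).
Local Notation E := (@cexpi R).
Local Notation I2 := (2 * pi : R).
Local Notation I2C := ((2 * pi)%:C%C : R[i]).

Let I2C0 : I2C != 0.
Proof. by rewrite -cmod_gt0 cmodR normr_gt0 gt_eqF // twopi_gt0. Qed.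

Let I2ge0 : 0 <= I2. Proof. exact: ltW (twopi_gt0 R). Qed.

(** Cauchy's formula as a property in its own right: it survives uniform limits, and Taylor
    expansions and divided differences need nothing else. *)
Definition crep h := ccont 0 I2 (fun t => h (E t)) /\
  forall x, cmod x < 1 -> cint 0 I2 (fun t => h (E t) * ck x t) = h x * I2C.

Lemma hol1_circle h a b : hol1 h -> ccont a b (fun t => h (E t)).
Proof. by move=> hh; apply: hol1_ccont => //; [exact: ccont_expi|move=> t _; rewrite cmod_expi]. Qed.

Lemma hol1_crep h : hol1 h -> crep h.
Proof. by move=> hh; split; [exact: hol1_circle|move=> x; exact: cauchy]. Qed.

Definition cmean (f : R -> R[i]) : R[i] := cint 0 I2 f / I2C.

Lemma cmean_bound f M : ccont 0 I2 f -> (forall t, 0 <= t <= I2 -> cmod (f t) <= M) ->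
  cmod (cmean f) <= M.
Proof.
move=> cf fM; rewrite /cmean cmodM cmodV cmodR ger0_norm //.
rewrite ler_pdivrMr ?twopi_gt0 //; have := cint_bound I2ge0 cf fM.
by rewrite subr0.
Qed.

Lemma cmean_add f g : ccont 0 I2 f -> ccont 0 I2 g ->
  cmean (fun t => f t + g t) = cmean f + cmean g.
Proof. by move=> cf cg; rewrite /cmean cint_add // mulrDl. Qed.

Lemma cmean_sub f g : ccont 0 I2 f -> ccont 0 I2 g ->
  cmean (fun t => f t - g t) = cmean f - cmean g.
Proof. by move=> cf cg; rewrite /cmean cint_sub // mulrBl. Qed.

Lemma cmean_scale f (k : R[i]) : ccont 0 I2 f -> cmean (fun t => k * f t) = k * cmean f.
Proof. by move=> cf; rewrite /cmean cint_scale // mulrA. Qed.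

Lemma cmean_eq f g : (forall t, 0 <= t <= I2 -> f t = g t) -> cmean f = cmean g.
Proof. by move=> fg; rewrite /cmean (cint_eq fg). Qed.

Lemma crepE h x : crep h -> cmod x < 1 -> h x = cmean (fun t => h (E t) * ck x t).
Proof. by move=> [_ hx] x1; rewrite /cmean hx // mulfK. Qed.

Lemma cmod_ck x t : cmod x < 1 -> cmod (ck x t) <= (1 - cmod x)^-1.
Proof.
move=> x1; rewrite /ck cmodM cmod_expi mul1r cmodV lef_pV2 ?posrE ?cmod_gt0 ?circle_neq ?subr_gt0 //.
exact: circle_ge.
Qed.

Lemma maximum_principle h B : hol1 h -> (forall t, 0 <= t <= I2 -> cmod (h (E t)) <= B) ->
  cmod (h 0) <= B.
Proof.
move=> hh hB; have hr := hol1_crep hh.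
have z1 : cmod (0 : R[i]) < 1 by rewrite cmod0.
rewrite (crepE hr z1); apply: cmean_bound.
  by apply: ccont_mul; [exact: hr.1|exact: ck_cont].
by move=> t tI; rewrite cmodM /ck subr0 divff ?cexpi_neq0 // cmod1 mulr1 hB.
Qed.

Lemma crep_uniform_limit h : (forall eta : R, 0 < eta -> exists q, crep q /\
    forall z, cmod z <= 1 -> cmod (q z - h z) <= eta) -> crep h.
Proof.
move=> hl.
have ch : ccont 0 I2 (fun t => h (E t)).
  move=> t tI e e0; have e4 : 0 < e / 4 by lra.
  have [q [[cq _] qh]] := hl _ e4.
  have [d d0 qd] := cq t tI _ e4; exists d => // s sI st.
  have := qd s sI st; have := qh (E t); have := qh (E s).
  rewrite !cmod_expi lexx => /(_ isT) k1 /(_ isT) k2 k3.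
  have := cmodD (h (E s) - q (E s)) (q (E s) - q (E t) + (q (E t) - h (E t))).
  have := cmodD (q (E s) - q (E t)) (q (E t) - h (E t)).
  rewrite (_ : _ - _ + (_ - _ + _) = h (E s) - h (E t)); last by ring.
  rewrite (cmodC (h (E s)) (q (E s))); lra.
split=> // x x1; apply/eqP; rewrite -subr_eq0 -cmod_eq0; apply/eqP/le_anti.
rewrite cmod_ge0 andbT leNgt; apply/negP; set J := cmod _ => J0.
have K0 : 0 < (1 - cmod x)^-1 by rewrite invr_gt0 subr_gt0.
set K := (1 - cmod x)^-1 in K0.
have S0 : 0 < I2 * (K + 1) by apply: mulr_gt0; [exact: twopi_gt0|lra].
have e0 : 0 < J / (I2 * (K + 1)) / 2 by do 2! apply: divr_gt0 => //.
have [q [[cq qx] qh]] := hl _ e0; set e := J / _ / 2 in e0 qh.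
have k1 : cmod (cint 0 I2 (fun t => (q (E t) - h (E t)) * ck x t)) <= e * K * (I2 - 0).
  apply: cint_bound => //.
    by apply: ccont_mul; [exact: ccont_subr|exact: ck_cont].
  move=> t _; rewrite cmodM; apply: ler_pM; rewrite ?cmod_ge0 ?cmod_ck //.
  by apply: qh; rewrite cmod_expi.
have k2 : cmod ((q x - h x) * I2C) <= e * I2.
  rewrite cmodM cmodR ger0_norm //; apply: ler_wpM2r => //.
  by apply: qh; exact: ltW.
have : J <= e * K * (I2 - 0) + e * I2.
  apply: le_trans _ (lerD k1 k2); rewrite -(cmodN (cint _ _ _)).
  apply: le_trans _ (cmodD _ _); rewrite /J mulrBl -qx //.
  have -> : cint 0 I2 (fun t => (q (E t) - h (E t)) * ck x t) =
      cint 0 I2 (fun t => q (E t) * ck x t) - cint 0 I2 (fun t => h (E t) * ck x t).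
    rewrite -cint_sub; [|by apply: ccont_mul => //; exact: ck_cont..].
    by apply: cint_eq => t _; rewrite mulrBl.
  by rewrite le_eqVlt; apply/orP; left; apply/eqP; congr cmod; ring.
have -> : e * K * (I2 - 0) + e * I2 = e * (I2 * (K + 1)) by ring.
by rewrite /e mulrAC divfK ?gt_eqF //; lra.
Qed.

Definition taylor_coef h k : R[i] := cmean (fun t => h (E t) / (E t) ^+ k).

Lemma ccont_expiX a b k : ccont a b (fun t => ((E t) ^+ k)^-1).
Proof.
apply: ccont_inv => [t _|]; first by rewrite expf_neq0 // cexpi_neq0.
elim: k => [|k ih]; first by rewrite [fun t => _](_ : _ = fun=> 1); [exact: ccont_cst|apply: funext].
apply: (@ccont_eq _ _ _ (fun t => E t * E t ^+ k)); first by move=> *; rewrite exprS.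
by apply: ccont_mul => //; exact: ccont_expi.
Qed.

(** The Taylor remainder of order [k] divided by [x ^+ k]. The step to [k.+1] rests on
    [ck x t = 1 + x * (E t)^-1 * ck x t]. *)
Let rem h k x := cmean (fun t => h (E t) / (E t) ^+ k * ck x t).

Let remS h k x : ccont 0 I2 (fun t => h (E t)) -> cmod x < 1 ->
  rem h k x = taylor_coef h k + x * rem h k.+1 x.
Proof.
move=> ch x1; have cE j : ccont 0 I2 (fun t => h (E t) / E t ^+ j).
  by apply: ccont_mul => //; exact: ccont_expiX.
have cc j : ccont 0 I2 (fun t => h (E t) / E t ^+ j * ck x t).
  by apply: ccont_mul => //; exact: ck_cont.
rewrite /rem /taylor_coef -cmean_scale // -cmean_add //; last exact: ccont_scale.
apply: cmean_eq => t _; have E0 := cexpi_neq0 t; have Ex := circle_neq t x1.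
by rewrite /ck exprS; field; rewrite Ex E0 expf_neq0.
Qed.

Lemma taylor_rem h M i x : crep h -> (forall t, 0 <= t <= I2 -> cmod (h (E t)) <= M) ->
  cmod x <= 1 / 2 ->
  cmod (h x - \sum_(j < i) taylor_coef h j * x ^+ j) <= 2 * M * cmod x ^+ i.
Proof.
move=> hr hM x2; have x1 : cmod x < 1 by lra.
have ch := hr.1.
have -> : h x - \sum_(j < i) taylor_coef h j * x ^+ j = x ^+ i * rem h i x.
  elim: i => [|i ih].
    rewrite big_ord0 subr0 mul1r (crepE hr x1) /rem; apply: cmean_eq => t _.
    by rewrite expr0 divr1.
  rewrite big_ord_recr /= opprD addrA ih remS // exprS; ring.
rewrite cmodM cmodX mulrC; apply: ler_wpM2r; first by rewrite exprn_ge0 // cmod_ge0.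
apply: cmean_bound => [|t tI].
  apply: ccont_mul; last exact: ck_cont.
  by apply: ccont_mul => //; exact: ccont_expiX.
rewrite cmodM [cmod (h _ / _)]cmodM cmodV cmodX cmod_expi expr1n invr1 mulr1 mulrC.
apply: ler_pM; rewrite ?cmod_ge0 ?hM //.
apply: le_trans (cmod_ck _ x1) _.
rewrite -[X in _ <= X]invrK lef_pV2 ?posrE ?invr_gt0; lra.
Qed.

(** The remainder of order 2 identifies the derivative at 0, with an error controlled by the maximum
    on the circle alone. *)
Lemma crep_cderiv0 h M : crep h -> (forall t, 0 <= t <= I2 -> cmod (h (E t)) <= M) ->
  (forall x, cmod x <= 1 / 2 -> cmod (h x - h 0 - taylor_coef h 1 * x) <= 2 * M * cmod x ^+ 2)
  /\ cderiv h 0 (taylor_coef h 1).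
Proof.
move=> hr hM.
have M0 : 0 <= M by apply: le_trans (cmod_ge0 (h (E 0))) (hM _ _); rewrite lexx.
have half0 : cmod (0 : R[i]) <= 1 / 2 by rewrite cmod0; lra.
have h0 : h 0 = taylor_coef h 0.
  have := taylor_rem 1 hr hM half0; rewrite big_ord_recl big_ord0 cmod0 expr1 mulr0 addr0.
  rewrite expr0 mulr1 => k; apply/eqP; rewrite -subr_eq0 -cmod_eq0; apply/eqP/le_anti.
  by rewrite k cmod_ge0.
have T x : cmod x <= 1 / 2 -> cmod (h x - h 0 - taylor_coef h 1 * x) <= 2 * M * cmod x ^+ 2.
  move=> x2; have := taylor_rem 2 hr hM x2.
  rewrite big_ord_recr /= big_ord_recr /= big_ord0 add0r expr0 expr1 mulr1 -h0.
  by rewrite opprD addrA.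
split=> // e e0; exists (Num.min (1 / 2) (e / (2 * M + 1))).
  by rewrite lt_min divr_gt0 //= divr_gt0 //; lra.
have M1 : 0 < 2 * M + 1 by lra.
move=> y; rewrite subr0 lt_min => /andP[y2]; rewrite ltr_pdivlMr // => ye.
apply: le_trans (T y (ltW y2)) _.
rewrite expr2 mulrA; apply: ler_wpM2r; first exact: cmod_ge0.
by have := cmod_ge0 y; nra.
Qed.

(** The contour integral formula for the divided difference of order [size xs] at the nodes
    [y :: xs]. Unlike the recursive quotient it makes sense for coinciding nodes and is visibly
    continuous in them. *)
Definition divdiff h (xs : seq R[i]) y : R[i] :=
  cmean (fun t => h (E t) * (ck y t * \prod_(x <- xs) (E t - x)^-1)).

Let ker_cont a b xs y : all (fun x => cmod x < 1) xs -> cmod y < 1 ->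
  ccont a b (fun t => ck y t * \prod_(x <- xs) (E t - x)^-1).
Proof.
move=> + y1; elim: xs => [_|x xs ih /= /andP[x1 /ih {}ih]].
  apply: (@ccont_eq _ _ _ (ck y)); last exact: ck_cont.
  by move=> t _; rewrite big_nil mulr1.
apply: (@ccont_eq _ _ _ (fun t => (E t - x)^-1 * (ck y t * \prod_(x <- xs) (E t - x)^-1))).
  by move=> t _; rewrite big_cons; ring.
apply: ccont_mul => //; apply: ccont_inv; first by move=> t _; exact: circle_neq.
by apply: ccont_subr; [exact: ccont_expi|exact: ccont_cst].
Qed.

Lemma divdiff_cons h xs x y : ccont 0 I2 (fun t => h (E t)) ->
  all (fun x => cmod x < 1) xs -> cmod x < 1 -> cmod y < 1 ->
  divdiff h xs y - divdiff h xs x = (y - x) * divdiff h (x :: xs) y.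
Proof.
move=> ch xs1 x1 y1; rewrite /divdiff -cmean_sub; [|by apply: ccont_mul => //; exact: ker_cont..].
rewrite -cmean_scale; last by apply: ccont_mul => //; apply: ker_cont => //=; rewrite x1.
apply: cmean_eq => t _; rewrite big_cons /ck.
by field; rewrite !circle_neq.
Qed.

Definition separated (d : R) (xs : seq R[i]) := pairwise (fun x y => d <= cmod (x - y)) xs.

(** Each use of the recursion [divdiff_cons] doubles the bound and divides it by a difference of
    nodes, which is at least [d] in modulus. *)
Lemma divdiff_upper h xs y d e : 0 < d -> crep h ->
  all (fun x => cmod x < 1) (y :: xs) -> separated d (y :: xs) ->
  all (fun x => cmod (h x) <= e) (y :: xs) ->
  cmod (divdiff h xs y) <= (2 / d) ^+ size xs * e.
Proof.
move=> d0 hr; elim: xs y => [|x xs ih] y.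
  rewrite /= => /andP[y1 _] _ /andP[ye _]; rewrite expr0 mul1r.
  rewrite /divdiff (_ : cmean _ = h y) // (crepE hr y1).
  by apply: cmean_eq => t _; rewrite big_nil mulr1.
move=> /and3P[y1 x1 xs1] /=; rewrite /separated /=.
move=> /andP[/andP[yx yxs] /andP[xxs sxs]] /and3P[ye xe xse].
have Hy : cmod (divdiff h xs y) <= (2 / d) ^+ size xs * e.
  by apply: ih; rewrite /separated /= ?y1 ?yxs ?sxs ?ye.
have Hx : cmod (divdiff h xs x) <= (2 / d) ^+ size xs * e.
  by apply: ih; rewrite /separated /= ?x1 ?xxs ?sxs ?xe.
have := divdiff_cons hr.1 xs1 x1 y1 => /(congr1 (@cmod R)); rewrite cmodM => H.
have := cmodB (divdiff h xs y) (divdiff h xs x); rewrite H => H2.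
have : d * cmod (divdiff h (x :: xs) y) <= 2 * ((2 / d) ^+ size xs * e).
  apply: le_trans (_ : cmod (y - x) * cmod (divdiff h (x :: xs) y) <= _); last by lra.
  by apply: ler_wpM2r => //; exact: cmod_ge0.
rewrite -ler_pdivlMl // => /le_trans; apply.
by rewrite exprS le_eqVlt; apply/orP; left; apply/eqP; ring.
Qed.

(** As all nodes tend to 0, the kernel tends to that of the Taylor coefficient, uniformly on the
    circle. *)
Let ker_near i (eta : R) : 0 < eta -> exists2 d : R, 0 < d <= 1 / 2 &
  forall xs y t, size xs = i -> all (fun x => cmod x <= d) (y :: xs) ->
  cmod (ck y t * \prod_(x <- xs) (E t - x)^-1 - ((E t) ^+ i)^-1) <= eta.
Proof.
have near1 d x t : d <= 1 / 2 -> cmod x <= d ->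
    cmod ((E t - x)^-1) <= 2 /\ cmod ((E t - x)^-1 - (E t)^-1) <= 2 * d.
  move=> d2 xd; have x1 : cmod x < 1 by lra.
  have b2 : cmod ((E t - x)^-1) <= 2.
    rewrite cmodV -[X in _ <= X]invrK lef_pV2 ?posrE ?invr_gt0 ?cmod_gt0 ?circle_neq //.
    by apply: le_trans _ (circle_ge x t); lra.
  split=> //; have -> : (E t - x)^-1 - (E t)^-1 = (E t - x)^-1 * (x * (E t)^-1).
    by field; rewrite circle_neq //= cexpi_neq0.
  rewrite cmodM [cmod (x * _)]cmodM cmodV [cmod (E t)^-1]cmodV cmod_expi invr1 mulr1 -cmodV.
  by apply: ler_pM; rewrite ?cmod_ge0.
elim: i eta => [|i ih] eta e0.
  exists (Num.min (1 / 2) (eta / 2)); first by rewrite ge_min lexx lt_min; lra.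
  move=> [|//] y t _ /= /andP[yd _]; rewrite big_nil mulr1 expr0 invr1.
  have [|_] := near1 (Num.min (1 / 2) (eta / 2)) y t _ yd; first by rewrite ge_min lexx.
  move=> k; have -> : ck y t - 1 = E t * ((E t - y)^-1 - (E t)^-1).
    by rewrite /ck mulrBr divff // cexpi_neq0.
  rewrite cmodM cmod_expi mul1r; apply: le_trans k _.
  have : Num.min (1 / 2) (eta / 2) <= eta / 2 by rewrite ge_min lexx orbT.
  lra.
have e4 : 0 < eta / 4 by lra.
have [d /andP[d0 d2] hd] := ih _ e4.
exists (Num.min d (eta / 4)); first by rewrite lt_min d0 ge_min d2 /= andbT.
move=> [//|x xs] y t /= [sxs] /and3P[]; rewrite !le_min => /andP[yd ye] /andP[xd xe] xsd.
rewrite big_cons exprS.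
have {}xsd : all (fun x => cmod x <= d) xs.
  by apply: sub_all xsd => z; rewrite le_min => /andP[].
have := hd xs y t sxs; rewrite /= yd xsd => /(_ isT); set P := \prod_(_ <- _) _ => k1.
have d2' : Num.min d (eta / 4) <= 1 / 2 by rewrite ge_min d2.
have [||k2 k3] := near1 (Num.min d (eta / 4)) x t => //; first by rewrite le_min xd.
have me : Num.min d (eta / 4) <= eta / 4 by rewrite ge_min lexx orbT.
have -> : ck y t * ((E t - x)^-1 * P) - (E t * E t ^+ i)^-1 =
   (ck y t * P - (E t ^+ i)^-1) * (E t - x)^-1 + (E t ^+ i)^-1 * ((E t - x)^-1 - (E t)^-1).
  by rewrite invfM; ring.
apply: le_trans (cmodD _ _) _; rewrite !cmodM [cmod (_ ^+ i)^-1]cmodV cmodX cmod_expi expr1n invr1 mul1r.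
have := cmod_ge0 (ck y t * P - (E t ^+ i)^-1); have := cmod_ge0 ((E t - x)^-1); nra.
Qed.

(** The radius is uniform in [h] as well as in the nodes, because the estimate will be used on all
    lines close and parallel to a given one. *)
Lemma divdiff_near h0 i M (eta : R) : ccont 0 I2 (fun t => h0 (E t)) ->
  (forall t, 0 <= t <= I2 -> cmod (h0 (E t)) <= M) -> 0 < eta ->
  exists2 d : R, 0 < d <= 1 / 2 &
  forall h xs y, ccont 0 I2 (fun t => h (E t)) ->
    (forall t, 0 <= t <= I2 -> cmod (h (E t) - h0 (E t)) <= d) -> size xs = i ->
    all (fun x => cmod x <= d) (y :: xs) ->
    cmod (divdiff h xs y - taylor_coef h0 i) <= eta.
Proof.
move=> ch0 h0M e0.
have M0 : 0 <= M by apply: le_trans (cmod_ge0 (h0 (E 0))) (h0M _ _); rewrite lexx.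
pose e1 := Num.min 1 (eta / (2 * (M + 1))).
have e10 : 0 < e1 by rewrite lt_min ltr01 divr_gt0 //; lra.
have [d /andP[d0 d2] hd] := ker_near i e10.
have D0 : 0 < Num.min d (eta / 4) by rewrite lt_min d0; lra.
exists (Num.min d (eta / 4)); first by rewrite D0 ge_min d2.
move=> h xs y ch hh0 sxs xsd.
have [dd de] : Num.min d (eta / 4) <= d /\ Num.min d (eta / 4) <= eta / 4.
  by split; rewrite ge_min lexx ?orbT.
have xsd' : all (fun x => cmod x <= d) (y :: xs).
  by apply: sub_all xsd => z /le_trans; apply.
have xs1 : all (fun x => cmod x < 1) (y :: xs).
  by apply: sub_all xsd' => z zd; lra.
have /andP[y1 xs1'] := xs1.
have cK := @ker_cont 0 I2 xs y xs1' y1.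
rewrite /divdiff /taylor_coef -cmean_sub; last 2 first.
- exact: ccont_mul.
- by apply: ccont_mul => //; exact: ccont_expiX.
apply: cmean_bound => [|t tI].
  by apply: ccont_subr; apply: ccont_mul => //; exact: ccont_expiX.
set P := _ * \prod_(_ <- _) _.
have Pk : cmod (P - (E t ^+ i)^-1) <= e1 by apply: hd.
have P2 : cmod P <= 2.
  have := cmodD (P - (E t ^+ i)^-1) (E t ^+ i)^-1; rewrite subrK.
  rewrite cmodV cmodX cmod_expi expr1n invr1.
  have : e1 <= 1 by rewrite ge_min lexx.
  lra.
have -> : h (E t) * P - h0 (E t) / E t ^+ i =
  (h (E t) - h0 (E t)) * P + h0 (E t) * (P - (E t ^+ i)^-1) by ring.
apply: le_trans (cmodD _ _) _; rewrite [cmod (_ * P)]cmodM [cmod (h0 _ * _)]cmodM.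
have k1 : cmod (h (E t) - h0 (E t)) * cmod P <= eta / 4 * 2.
  by apply: ler_pM; rewrite ?cmod_ge0 //; apply: le_trans de; exact: hh0.
have k2 : cmod (h0 (E t)) * cmod (P - (E t ^+ i)^-1) <= M * (eta / (2 * (M + 1))).
  apply: ler_pM; rewrite ?cmod_ge0 ?h0M //.
  by apply: le_trans Pk _; rewrite ge_min lexx orbT.
have k3 : M * (eta / (2 * (M + 1))) <= eta / 2.
  rewrite mulrA ler_pdivrMr; last lra.
  by rewrite (_ : eta / 2 * _ = eta * (M + 1)); [nra|field].
lra.
Qed.

End cauchy_consequences.

(** * Jensen's inequality *)

Section jensen.
Variable R : realType.
Implicit Types (h : R[i] -> R[i]).
Local Notation E := (@cexpi R).
Local Notation I2 := (2 * pi : R).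

Lemma cderiv_comp_scale h (k z l : R[i]) : cderiv h (k * z) l ->
  cderiv (fun y => h (k * y)) z (l * k).
Proof.
move=> hz e e0; have k0 := cmod_ge0 k.
have e1 : 0 < e / (cmod k + 1) by rewrite divr_gt0 //; lra.
have [d d0 hd] := hz _ e1.
exists (d / (cmod k + 1)); first by rewrite divr_gt0 //; lra.
move=> y; rewrite ltr_pdivlMr ?ltr_wpDl // => yd.
have y0 := cmod_ge0 (y - z).
have H := hd (k * y); rewrite -mulrBr cmodM in H.
rewrite -mulrA; apply: le_trans (H ltac:(nra)) _.
rewrite mulrA; apply: ler_wpM2r => //.
rewrite mulrAC ler_pdivrMr ?ltr_wpDl //; nra.
Qed.

Lemma cdiff_prod (n : nat) (F : 'I_n -> R[i] -> R[i]) z : (forall k, cdiff (F k) z) ->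
  cdiff (fun y => \prod_(k < n) F k y) z.
Proof.
elim: n F => [|n ih] F hF.
  rewrite (_ : (fun y => _) = fun=> 1); last by apply: funext => y; rewrite big_ord0.
  by exists 0; exact: cderiv_cst.
rewrite (_ : (fun y => _) = fun y => F ord0 y * \prod_(k < n) F (lift ord0 k) y); last first.
  by apply: funext => y; rewrite big_ord_recl.
have [l hl] := hF ord0.
have [m hm] : cdiff (fun y => \prod_(k < n) F (lift ord0 k) y) z.
  by apply: (ih (fun k => F (lift ord0 k))) => k; exact: hF.
by exists (l * (\prod_(k < n) F (lift ord0 k) z) + F ord0 z * m); apply: cderiv_mul.
Qed.

Section circle_product.
Variables (h : R[i] -> R[i]) (N : nat).
Hypotheses (hh : hol1 h) (N0 : (0 < N)%N).
Let w : R := I2 / N%:R.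
Let P z := \prod_(k < N) h (E (w *+ k) * z).

Let w0 : 0 < w. Proof. by rewrite divr_gt0 ?twopi_gt0 // ltr0n. Qed.
Let wN : w *+ N = I2.
Proof. by rewrite /w -[_ *+ N]mulr_natr divfK // pnatr_eq0 -lt0n. Qed.

Let P_shift z : P (E w * z) = P z.
Proof.
rewrite /P; case: N N0 wN => // m _ wm.
rewrite big_ord_recr big_ord_recl /= mulr0n cexpi0 mul1r mulrC.
congr (_ * _).
  by rewrite mulrA -cexpiD -mulrSr wm cexpi2pi mul1r.
apply: eq_bigr => k _; rewrite mulrA -cexpiD /bump /= add1n.
by rewrite -mulrSr.
Qed.

Let P_shiftn z n : P (E (w *+ n) * z) = P z.
Proof.
elim: n z => [|n ih] z; first by rewrite mulr0n cexpi0 mul1r.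
by rewrite mulrSr cexpiD -mulrA ih P_shift.
Qed.

(* By the maximum principle, and since the product is invariant under the N-th roots of
   unity, its value at 0 is dominated by its value at some point of the arc [0, w]. *)
Lemma circle_product_bound B : (forall t, 0 <= t <= w ->
    \prod_(k < N) cmod (h (E (t + w *+ k))) <= B) -> cmod (h 0) ^+ N <= B.
Proof.
move=> hB.
have -> : cmod (h 0) ^+ N = cmod (P 0).
  rewrite /P cmod_prod; under eq_bigr do rewrite mulr0.
  by rewrite big_const_ord iter_mulr_1.
apply: maximum_principle.
  move=> z z1; apply: cdiff_prod => k.
  have [l hl] : cdiff h (E (w *+ k) * z) by apply: hh; rewrite cmodM cmod_expi mul1r.
  by eexists; apply: cderiv_comp_scale; exact: hl.
move=> t /andP[t0 _].
pose j := Num.truncn (t / w).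
have tw : 0 <= t / w by rewrite divr_ge0 // ltW.
have jt : j%:R <= t / w < j.+1%:R by apply: truncn_itv.
have tE : E t = E (w *+ j) * E (t - w *+ j) by rewrite -cexpiD addrC subrK.
rewrite tE P_shiftn /P cmod_prod; apply: le_trans (hB (t - w *+ j) _); last first.
  move/andP: jt; rewrite ler_pdivlMr // ltr_pdivrMr // => -[j1 j2].
  by rewrite -mulr_natl; apply/andP; split; move: j2; rewrite -natr1 ?mulrDl; lra.
by apply: ler_prod => k _; rewrite cmod_ge0 -cexpiD addrC /=.
Qed.
End circle_product.

(* Bounding |h(0)|^N by the product of |h| over N equally spaced points of the circle
   turns the maximum principle into a Riemann-sum estimate. *)
Lemma jensen_rcont h (g : R -> R) : hol1 h -> h 0 != 0 -> rcont 0 I2 g ->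
  (forall t, 0 <= t <= I2 -> cmod (h (E t)) <= expR (g t)) ->
  ln (cmod (h 0)) * I2 <= rint 0 I2 g.
Proof.
move=> hh h0 cg hg; have I0 := twopi_gt0 R.
rewrite leNgt; apply/negP => lt.
set L := ln _ * I2 in lt.
(* Over the whole circle an error of [e] costs half of the assumed gap. *)
pose e := (L - rint 0 I2 g) / (2 * I2).
have e0 : 0 < e by rewrite divr_gt0 ?subr_gt0 // mulr_gt0.
have [d d0 hd] := rcont_unif e0 (ltW I0) cg.
have [N0 hN] : exists n : nat, I2 / d < n%:R.
  by exists (Num.truncn (I2 / d)).+1; exact: truncnS_gt.
have N_gt0 : (0 < N0)%N.
  by rewrite -(ltr_nat R); apply: le_lt_trans hN; rewrite divr_ge0 // ltW.
have NR : 0 < N0%:R :> R by rewrite ltr0n.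
pose w : R := I2 / N0%:R.
have w0 : 0 < w by rewrite divr_gt0.
have wd : w < d by rewrite /w ltr_pdivrMr // [d * _]mulrC -ltr_pdivrMr.
have wN : w *+ N0 = I2 by rewrite /w -[_ *+ N0]mulr_natr divfK // gt_eqF.
have rsum n : (n <= N0)%N -> rint 0 (w *+ n) g = \sum_(k < n) rint (w *+ k) (w *+ k.+1) g.
  elim: n => [_|n ih nN].
    by rewrite big_ord0 mulr0n /rint set_itv1 Rintegral_set1.
  rewrite big_ord_recr /= -ih ?(ltnW nN) //; apply: rint_split.
  - by rewrite mulrn_wge0 // ltW.
  - by rewrite ler_pMn2l.
  - move=> x /andP[x1 x2] r r0.
    have nI : w *+ n.+1 <= I2 by rewrite -wN ler_pMn2l.
    have [|q q0 hq] := cg x _ r r0; first by apply/andP; split; lra.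
    by exists q => // y /andP[y1 y2]; apply: hq; apply/andP; split; lra.
have := @circle_product_bound _ N0 hh N_gt0 (expR ((rint 0 I2 g + e * I2) / w)).
rewrite -/w => H; clearbody w.
have {H} : cmod (h 0) ^+ N0 <= expR ((rint 0 I2 g + e * I2) / w).
  apply: H => t /andP[t0 tw].
  apply: le_trans (_ : \prod_(k < N0) expR (g (t + w *+ k)) <= _).
    apply: ler_prod => k _; rewrite cmod_ge0 hg //.
    apply/andP; split; first by rewrite addr_ge0 // mulrn_wge0 // ltW.
    rewrite -wN; apply: le_trans (_ : w *+ k.+1 <= _); last by rewrite ler_pMn2l.
    by rewrite mulrS lerD2r.
  rewrite -expR_sum ler_expR ler_pdivlMr // mulr_suml.
  have -> : rint 0 I2 g = \sum_(k < N0) rint (w *+ k) (w *+ k.+1) g by rewrite -rsum // wN.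
  have -> : e * I2 = \sum_(k < N0) (e * w) by rewrite sumr_const card_ord -wN mulrnAr.
  rewrite -big_split /=; apply: ler_sum => k _.
  have wk : w *+ k <= w *+ k.+1 by rewrite ler_pMn2l.
  have wkw : w *+ k.+1 - w *+ k = w by rewrite mulrS addrK.
  have kN : w *+ k.+1 <= I2 by rewrite -wN ler_pMn2l.
  have k0 : 0 <= w *+ k by rewrite mulrn_wge0 // ltW.
  have cgk : rcont (w *+ k) (w *+ k.+1) g.
    move=> x /andP[x1 x2] r r0; have [|q q0 hq] := cg x _ r r0; first by apply/andP; split; lra.
    by exists q => // y /andP[y1 y2]; apply: hq; apply/andP; split; lra.
  have : rint (w *+ k) (w *+ k.+1) (fun=> g (t + w *+ k) - e) <= rint (w *+ k) (w *+ k.+1) g.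
    apply: rint_le => //; first exact: rcont_cst.
    move=> x /andP[x1 x2].
    have /= := hd (t + w *+ k) x; rewrite ler_norml => H.
    have /andP[] : - e <= g (t + w *+ k) - g x <= e.
      apply: H; [by apply/andP; split; rewrite mulrS in kN; lra|by apply/andP; split; lra|].
      by rewrite ltr_norml; move: x2; rewrite mulrS => x2; apply/andP; split; lra.
    lra.
  by rewrite rint_cst // wkw mulrBl; lra.
have h0' : 0 < cmod (h 0) by rewrite cmod_gt0.
rewrite -[X in X ^+ _]lnK ?posrE // -expRM_natl ler_expR ler_pdivlMr //.
rewrite (_ : _ * w = L); last by rewrite /L -wN; rewrite -mulr_natl; ring.
have : e * I2 = (L - rint 0 I2 g) / 2 by rewrite /e; move: (L - _) => X; move: (2 * pi : R) I0 => i i0; field; rewrite gt_eqF.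
lra.
Qed.

End jensen.

(** * The sub-mean value inequality for logarithms of holomorphic functions *)

Section submean.
Variable R : realType.
Implicit Types (h : R[i] -> R[i]).
Local Notation E := (@cexpi R).
Local Notation I2 := (2 * pi : R).
Local Notation mu := (@lebesgue_measure R).
Local Notation D := (`[0, I2]%classic : set R).

Lemma rcont_comp a b (f phi : R -> R) : rcont a b f ->
  (forall x, a <= x <= b -> {for f x, continuous phi}) -> rcont a b (phi \o f).
Proof.
move=> cf cp x xab e e0.
have /cvgrPdist_lt /(_ _ e0)[d /= d0 hd] := cp x xab.
have [r r0 hr] := cf x xab d d0; exists r => // y yab yx.
by rewrite distrC; apply: hd; rewrite /= distrC; exact: hr.
Qed.

Lemma rcont_max a b (f : R -> R) k : rcont a b f -> rcont a b (fun x => Num.max (f x) k).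
Proof.
move=> cf x xab e e0; have [r r0 hr] := cf x xab e e0; exists r => // y yab yx.
have := hr y yab yx; rewrite !ltr_norml => /andP[h1 h2].
by case: (leP (f y) k) => k1; case: (leP (f x) k) => k2; apply/andP; split; lra.
Qed.

Lemma cvg_mine_nat (x : \bar R) : (0 <= x)%E ->
  (fun n : nat => mine x n%:R%:E) @ \oo --> x.
Proof.
case: x => [r| |] // _.
  apply: cvg_near_cst; exists (Num.truncn r).+1 => // n /= hn.
  apply/min_idPl; rewrite lee_fin; apply: ltW; apply: lt_le_trans (truncnS_gt r) _.
  by rewrite ler_nat.
rewrite (_ : (fun n : nat => _) = (fun n : nat => n%:R%:E)); last first.
  by apply: funext => n; apply/min_idPr; rewrite leey.
exact/cvgenyP.
Qed.

(** When [w] is a maximum of terms [al * log |h| + be], applying this to each term gives the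
    sub-mean value inequality of [w]. As [log |h|] may be [-oo] on the circle, the estimate is made
    for truncations, and the negative part of [w] is recovered by monotone convergence. *)
Lemma jensen_submean h (al be C : R) (w : R -> \bar R) : hol1 h -> 0 < al ->
  measurable_fun D w -> (forall t, D t -> (w t <= C%:E)%E) ->
  (forall t, D t -> (al%:E * lne (cmod (h (E t)))%:E + be%:E <= w t)%E) ->
  (al%:E * lne (cmod (h 0))%:E + be%:E <= (I2^-1)%:E * \int[mu]_(t in D) w t)%E.
Proof.
move=> hh al0 mw wC hw.
have I0 := twopi_gt0 R.
have mD : measurable D by [].
have muD : mu D = I2%:E by rewrite measure_itv ?subr0 // ltW.
have muDoo : (mu D < +oo)%E by rewrite muD ltry.
have [->|h0] := eqVneq (h 0) 0.
  by rewrite cmod0 le0_lneNy // gt0_muleNy ?lte_fin // addNye leNye.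
have h0p : 0 < cmod (h 0) by rewrite cmod_gt0.
rewrite lne_EFin // -EFinM -EFinD; set u0 := al * ln _ + be.
pose wp := (w^\+)%E; pose wm := (w^\-)%E.
have mwp : measurable_fun D wp by exact: measurable_funepos.
have mwm : measurable_fun D wm by exact: measurable_funeneg.
pose C' := Num.max C 0.
have wpC t : D t -> (wp t <= C'%:E)%E.
  move=> tD; rewrite /wp funeposE ge_max EFin_max le_max wC //= le_max.
  by rewrite lexx orbT.
have wpi : mu.-integrable D wp.
  apply: (@le_integrable _ _ _ mu D mD _ (fun=> C'%:E)) => //.
    by move=> t tD; rewrite gee0_abs ?funepos_ge0 // gee0_abs ?wpC // lee_fin le_max lexx orbT.
  exact: (rcont_integrable (@rcont_cst _ 0 I2 C')).
set A := (\int[mu]_(t in D) wp t)%E.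
have Afin : A \is a fin_num by exact: integrable_fin_num.
have key n : (\int[mu]_(t in D) mine (wm t) n%:R%:E <= A - (u0 * I2)%:E)%E.
  (* Cutting [|h|] off at [exp (- L)] cuts [al * log |h| + be] off at [- n]. *)
  pose L := (n%:R + be) / al.
  pose g t := ln (Num.max (cmod (h (E t))) (expR (- L))).
  have mx0 t : 0 < Num.max (cmod (h (E t))) (expR (- L)) by rewrite lt_max expR_gt0 orbT.
  have cg : rcont 0 I2 g.
    apply: (@rcont_comp _ _ (fun t => Num.max (cmod (h (E t))) (expR (- L))) (@ln R)).
      by apply: rcont_max; apply: ccont_cmod; exact: hol1_circle.
    by move=> t _; exact: continuous_ln.
  have Jg : ln (cmod (h 0)) * I2 <= rint 0 I2 g.
    apply: jensen_rcont => // t _; rewrite /g lnK ?posrE // le_max lexx //.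
  have cg' : rcont 0 I2 (fun t => al * g t + be).
    by apply: rcont_add; [exact: rcont_scale|exact: rcont_cst].
  have gi := rcont_integrable cg'.
  have mi : mu.-integrable D (fun t => mine (wm t) n%:R%:E).
    apply: (@le_integrable _ _ _ mu D mD _ (fun=> n%:R%:E)) => //.
    - by apply: measurable_mine.
    - move=> t tD; rewrite !gee0_abs ?lee_fin ?le_min ?funeneg_ge0 ?lee_fin ?ler0n //.
      by rewrite ge_min lexx orbT.
    - exact: (rcont_integrable (@rcont_cst _ 0 I2 n%:R)).
  have mfin : (\int[mu]_(t in D) mine (wm t) n%:R%:E)%E \is a fin_num.
    exact: integrable_fin_num.
  have le1 : (\int[mu]_(t in D) ((al * g t + be)%:E + mine (wm t) n%:R%:E) <= A)%E.
    apply: le_integral => //; first exact: integrableD.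
    move=> t tD; rewrite /= inE /= in tD.
    have hwt := hw t tD.
    have G : ((al * g t + be)%:E <= maxe (w t) (- n%:R%:E))%E.
      rewrite le_max; apply/orP.
      rewrite /g; case: (leP (cmod (h (E t))) (expR (- L))) => k.
        right; rewrite lee_fin expRK /L -lerBrDr mulrN mulrC divfK ?gt_eqF //; lra.
      left; apply: le_trans hwt; rewrite lne_EFin ?(lt_trans _ k) ?expR_gt0 //.
    rewrite /wp /wm funeposE funenegE; move: G; case: (w t) => [r| |].
    - rewrite -EFinN -!EFin_max -EFin_min -EFinD !lee_fin.
      have n0 : 0 <= n%:R :> R by [].
      case: (leP 0 r) => r0.
        have -> : Num.max r (- n%:R) = r by apply/max_idPl; lra.
        have -> : Num.max (- r) 0 = 0 by apply/max_idPr; lra.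
        by rewrite (min_idPl n0); lra.
      have -> : Num.max (- r) 0 = - r by apply/max_idPl; lra.
      case: (leP (- r) n%:R) => rn.
        have -> : Num.max r (- n%:R) = r by apply/max_idPl; lra.
        lra.
      have -> : Num.max r (- n%:R) = - n%:R by apply/max_idPr; lra.
      lra.
    - by rewrite (_ : maxe +oo 0 = +oo)%E ?leey //; apply/max_idPl; rewrite leey.
    - rewrite (_ : maxe -oo (- n%:R%:E) = - n%:R%:E)%E; last by apply/max_idPr; rewrite leNye.
      rewrite (_ : maxe -oo 0 = 0)%E; last by apply/max_idPr; rewrite leNye.
      rewrite (_ : maxe (- -oo) 0 = +oo)%E; last by apply/max_idPl; rewrite leey.
      rewrite (_ : mine +oo n%:R%:E = n%:R%:E)%E; last by apply/min_idPr; rewrite leey.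
      by rewrite -EFinN -EFinD !lee_fin; lra.
  have le2 : ((rint 0 I2 (fun t => al * g t + be))%:E + \int[mu]_(t in D) mine (wm t) n%:R%:E <= A)%E.
    apply: le_trans le1; rewrite integralD // le_eqVlt; apply/orP; left; apply/eqP; congr (_ + _)%E.
    by rewrite /rint /Rintegral fineK //; exact: integrable_fin_num.
  have le3 : u0 * I2 <= rint 0 I2 (fun t => al * g t + be).
    rewrite rint_add; [|exact: rcont_scale|exact: rcont_cst].
    rewrite rint_scale // (rint_cst _ (ltW I0)) subr0.
    have -> : u0 * I2 = al * (ln (cmod (h 0)) * I2) + be * I2 by rewrite /u0; ring.
    by apply: lerD => //; rewrite ler_pM2l.
  rewrite leeBrDr //; apply: le_trans le2; rewrite addeC leeD2r //.
(* The truncations of the negative part increase to it, and the bound [key] does not depend on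
   [n]. *)
have mc : (\int[mu]_(t in D) wm t <= A - (u0 * I2)%:E)%E.
  have -> : (\int[mu]_(t in D) wm t = \int[mu]_(t in D) limn (fun n : nat => mine (wm t) n%:R%:E))%E.
    apply: eq_integral => t _; apply/esym/cvg_lim => //.
    by apply: cvg_mine_nat; exact: funeneg_ge0.
  have m0 (n : nat) t : (0 <= mine (wm t) n%:R%:E)%E by rewrite le_min funeneg_ge0 lee_fin ler0n.
  have nd t : {homo (fun n : nat => mine (wm t) n%:R%:E) : i j / (i <= j)%N >-> (i <= j)%E}.
    by move=> i j ij; rewrite le_min !ge_min lexx /= lee_fin ler_nat ij orbT.
  have mm (n : nat) : measurable_fun D (fun t => mine (wm t) n%:R%:E) by exact: measurable_mine.
  rewrite monotone_convergence //.
  apply: lime_le; last by apply: nearW => n; exact: key.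
  apply: ereal_nondecreasing_is_cvgn => i j ij; apply: ge0_le_integral => //.
  - exact: (mm i).
  - exact: (mm j).
  - by move=> t _; exact: nd.
rewrite integralE -/wp -/wm -/A.
have mfin : (\int[mu]_(t in D) wm t)%E \is a fin_num.
  rewrite ge0_fin_numE; last by apply: integral_ge0 => t _; exact: funeneg_ge0.
  by apply: le_lt_trans mc _; rewrite -(fineK Afin) -EFinB ltry.
move: mc; rewrite -(fineK Afin) -(fineK mfin) -EFinB -EFinB -EFinM !lee_fin.
move=> mc; rewrite mulrC ler_pdivlMr //; lra.
Qed.

End submean.

(** * Functions of several complex variables *)

Section topology.
Variables (R : realType).

Lemma posC_real (e : R[i]) : 0 < e -> 0 < complex.Re e /\ e = (complex.Re e)%:C%C.
Proof.
by case: e => a b; rewrite ltcE /= => /andP[/eqP -> a0].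
Qed.

Lemma nbhs_complexP (z : R[i]) (P : set R[i]) : nbhs z P <->
  exists2 e : R, 0 < e & forall w, cmod (w - z) < e -> P w.
Proof.
split=> [/nbhs_ballP[e /= e0 eP]|[e e0 eP]].
  have [r0 eE] := posC_real e0; exists (complex.Re e) => // w wz; apply: eP.
  have : `|z - w| < e by rewrite cmodE eE ltcR cmodC.
  by rewrite -ball_normE.
apply/nbhs_ballP; exists e%:C%C; first by rewrite /= ltcR.
move=> w; rewrite -ball_normE /= => H; apply: eP.
have : `|z - w| < e%:C%C by [].
by rewrite cmodE ltcR cmodC.
Qed.

Section rV.
Variable n : nat.
Local Notation Cn := 'rV[R[i]]_n.
Implicit Types (z w u v : Cn).

(** A real-valued substitute for the [R[i]]-valued maximum norm of row vectors; [nbhs_vnorm] shows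
    that the neighbourhoods are the same. *)
Definition vnorm w : R := \sum_(j < n) cmod (w 0 j).

Lemma vnorm_ge0 w : 0 <= vnorm w.
Proof. by apply: sumr_ge0 => j _; exact: cmod_ge0. Qed.

Lemma cmod_le_vnorm w j : cmod (w 0 j) <= vnorm w.
Proof.
rewrite /vnorm (bigD1 j) //= lerDl; apply: sumr_ge0 => k _; exact: cmod_ge0.
Qed.

Lemma vnormD u v : vnorm (u + v) <= vnorm u + vnorm v.
Proof. by rewrite /vnorm -big_split; apply: ler_sum => j _; rewrite mxE cmodD. Qed.

Lemma vnormZ (k : R[i]) v : vnorm (k *: v) = cmod k * vnorm v.
Proof. by rewrite /vnorm mulr_sumr; apply: eq_bigr => j _; rewrite mxE cmodM. Qed.

Lemma vnormN v : vnorm (- v) = vnorm v.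
Proof. by apply: eq_bigr => j _; rewrite mxE cmodN. Qed.

Lemma vnorm0 : vnorm 0 = 0.
Proof. by rewrite /vnorm big1 // => j _; rewrite mxE cmod0. Qed.

Lemma vnorm_le w (e : R) : (forall j, cmod (w 0 j) <= e) -> vnorm w <= n%:R * e.
Proof.
move=> we; rewrite mulr_natl -[X in _ *+ X](card_ord n) -sumr_const.
by apply: ler_sum => j _.
Qed.

Lemma nbhs_vnorm z (P : set Cn) : nbhs z P <->
  exists2 e : R, 0 < e & forall w, vnorm (w - z) < e -> P w.
Proof.
split=> [/nbhs_ballP[e /= e0 eP]|[e e0 eP]].
  have [r0 eE] := posC_real e0; exists (complex.Re e) => // w wz; apply: eP.
  split=> // i j; rewrite (ord1 i).
  have : `|z 0 j - w 0 j| < e.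
    rewrite cmodE eE ltcR cmodC; apply: le_lt_trans wz.
    by have := cmod_le_vnorm (w - z) j; rewrite !mxE.
  by rewrite -ball_normE.
have e1 : 0 < e / n.+1%:R by rewrite divr_gt0.
apply/nbhs_ballP; exists (e / n.+1%:R)%:C%C; first by rewrite /= ltcR.
move=> w [_ zw]; apply: eP.
have H j : cmod ((w - z) 0 j) <= e / n.+1%:R.
  have := zw 0 j; rewrite -ball_normE /= => H.
  have : `|z 0 j - w 0 j| < (e / n.+1%:R)%:C%C by [].
  by rewrite cmodE ltcR cmodC !mxE => /ltW.
apply: le_lt_trans (vnorm_le H) _.
rewrite mulrCA gtr_pMr // ltr_pdivrMr // mul1r ltr_nat //.
Qed.

Lemma normc_vnorm w : `|w| <= (vnorm w)%:C%C.
Proof.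
have -> : `|w| = mx_norm w by [].
have [->|w0] := eqVneq (mx_norm w) 0; first by rewrite lecR vnorm_ge0.
have [[i j] /= ->] := mx_norm_neq0 w0.
rewrite (ord1 i).
have -> : `|w 0 j| = (cmod (w 0 j))%:C%C by exact: cmodE.
by rewrite lecR cmod_le_vnorm.
Qed.

Definition vcat (f : Cn -> R[i]) z := forall e : R, 0 < e -> exists2 d, 0 < d &
  forall w, vnorm (w - z) < d -> cmod (f w - f z) < e.

Lemma continuous_vcat (f : Cn -> R[i]) z : {for z, continuous f} <-> vcat f z.
Proof.
split=> [cf e e0|fz].
  have : nbhs (f z) [set w | cmod (w - f z) < e] by apply/nbhs_complexP; exists e.
  by move=> /cf /nbhs_vnorm[d d0 hd]; exists d.
move=> A /nbhs_complexP[e e0 hA]; have [d d0 hd] := fz e e0.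
by apply/nbhs_vnorm; exists d => // w wz; apply/hA/hd.
Qed.

Lemma differentiable_vnorm (W : normedModType R[i]) (F : Cn -> W) z : differentiable F z ->
  forall e : R, 0 < e -> exists2 d, 0 < d &
    forall w, vnorm (w - z) < d -> `|F w - F z - 'd F z (w - z)| <= (e * vnorm (w - z))%:C%C.
Proof.
move=> dF e e0.
have [_ /eqaddoP /(_ e%:C%C)] := (diff_locallyP _ _).1 dF.
rewrite ltcR => /(_ e0) /nbhs_vnorm[d d0 hd]; exists d => // w wz.
have := hd (w - z); rewrite subr0 => /(_ wz) /=.
rewrite !fctE /= subrK opprD addrA => /le_trans; apply.
rewrite rmorphM /=; apply: ler_wpM2l; first by rewrite lecR ltW.
exact: normc_vnorm.
Qed.

Lemma differentiable_cmod (f : Cn -> R[i]) z : differentiable f z ->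
  forall e : R, 0 < e -> exists2 d, 0 < d & forall w, vnorm (w - z) < d ->
    cmod (f w - f z - 'd f z (w - z)) <= e * vnorm (w - z).
Proof.
move=> dF e e0; have [d d0 hd] := differentiable_vnorm dF e0.
exists d => // w /hd H; rewrite -lecR.
have <- : `|f w - f z - 'd f z (w - z)| = (cmod (f w - f z - 'd f z (w - z)))%:C%C by exact: cmodE.
exact: H.
Qed.

Lemma differentiable_rV_coord m (F : Cn -> 'rV[R[i]]_m) z j : differentiable F z ->
  differentiable (fun w => F w 0 j : R[i]) z.
Proof.
move=> dF; apply: (@differentiable_comp _ _ _ _ F (fun M : 'rV[R[i]]_m => M 0 j : R[i])) => //.
exact: differentiable_coord.
Qed.

Lemma cderiv_unique (h : R[i] -> R[i]) (z l m : R[i]) : cderiv h z l -> cderiv h z m -> l = m.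
Proof.
move=> hl hm; apply/eqP; rewrite -subr_eq0 -cmod_eq0; apply/eqP/le_anti.
rewrite cmod_ge0 andbT leNgt; apply/negP => lm.
have e0 : 0 < cmod (l - m) / 4 by lra.
have [d d0 hd] := hl _ e0; have [d' d'0 hd'] := hm _ e0.
pose t := Num.min d d' / 2.
have t0 : 0 < t by rewrite divr_gt0 // lt_min d0.
have td : t < d /\ t < d'.
  have : Num.min d d' <= d by rewrite ge_min lexx.
  have : Num.min d d' <= d' by rewrite ge_min lexx orbT.
  by rewrite /t; move: t0; rewrite /t; lra.
pose y := z + t%:C%C.
have yz : y - z = t%:C%C by rewrite /y addrC addKr.
have ct : cmod (t%:C%C : R[i]) = t by rewrite cmodR gtr0_norm.
have := hd y; rewrite yz ct => /(_ td.1) k1.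
have := hd' y; rewrite yz ct => /(_ td.2) k2.
have := cmodB (h y - h z - m * t%:C%C) (h y - h z - l * t%:C%C).
rewrite (_ : _ - _ = (l - m) * t%:C%C); last by ring.
by rewrite cmodM ct; nra.
Qed.

Definition gderiv (f : Cn -> R[i]) z h l := cderiv (fun x : R[i] => f (z + x *: h)) 0 l.

(* Holomorphy in the sense of Gateaux, together with continuity. *)
Definition holn (W : set Cn) (f : Cn -> R[i]) :=
  forall z, W z -> vcat f z /\ forall h, exists l, gderiv f z h l.

Lemma differentiable_gderiv (f : Cn -> R[i]) z h : differentiable f z -> gderiv f z h ('d f z h).
Proof.
move=> df e e0; have h0 := vnorm_ge0 h.
have e1 : 0 < e / (vnorm h + 1) by rewrite divr_gt0 //; lra.
have [d d0 hd] := differentiable_cmod df e1.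
exists (d / (vnorm h + 1)); first by rewrite divr_gt0 //; lra.
move=> x; rewrite subr0 ltr_pdivlMr ?ltr_wpDl // => xd; have x0 := cmod_ge0 x.
have zz : z + x *: h - z = x *: h by rewrite addrC addKr.
have := hd (z + x *: h); rewrite zz vnormZ => /(_ ltac:(nra)).
rewrite linearZ scale0r addr0 /=.
rewrite (_ : x *: 'd f z h = 'd f z h * x); last by rewrite mulrC.
move=> /le_trans; apply.
rewrite mulrCA [leRHS]mulrC; apply: ler_wpM2l => //.
rewrite mulrAC ler_pdivrMr ?ltr_wpDl //; nra.
Qed.

Lemma differentiable_holn (W : set Cn) f : (forall z, W z -> differentiable f z) -> holn W f.
Proof.
move=> df z Wz; split; last by move=> h; eexists; apply: differentiable_gderiv; exact: df.
by apply/continuous_vcat; apply: differentiable_continuous; exact: df.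
Qed.

Lemma holn_line (W : set Cn) f a b : holn W f ->
  (forall x : R[i], cmod x <= 1 -> W (a + x *: b)) -> hol1 (fun x => f (a + x *: b)).
Proof.
move=> hf Wab x x1; have [_ /(_ b)[l hl]] := hf _ (Wab x x1); exists l => e e0.
have [d d0 hd] := hl e e0; exists d => // y yx.
have := hd (y - x); rewrite !subr0 => /(_ yx).
rewrite scale0r addr0 (_ : a + x *: b + (y - x) *: b = a + y *: b) //.
by rewrite -addrA -scalerDl addrCA subrr addr0.
Qed.

Lemma gderivZ f z h l (r : R[i]) : gderiv f z h l -> gderiv f z (r *: h) (r * l).
Proof.
move=> hl.
have := @cderiv_comp_scale R (fun x => f (z + x *: h)) r 0 l; rewrite mulr0 => /(_ hl).
rewrite mulrC /gderiv; congr cderiv; apply: funext => x.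
by rewrite scalerA mulrC.
Qed.

Section ball.
Variables (W : set Cn) (f : Cn -> R[i]) (z0 : Cn) (r0 M : R).
Hypotheses (hW : forall w, vnorm (w - z0) < r0 -> W w) (hf : holn W f)
  (fM : forall w, vnorm (w - z0) < r0 -> cmod (f w) <= M).

(** Cauchy's estimate on the disc of the points [w + x *: h] with [|x| <= 1], which the bounds on
    [w] and [h] keep inside the ball of radius [r0]. *)
Lemma line_second_order w h l : vnorm (w - z0) < r0 / 2 -> vnorm h <= r0 / 2 -> gderiv f w h l ->
  forall x : R[i], cmod x <= 1 / 2 ->
  cmod (f (w + x *: h) - f w - l * x) <= 2 * M * cmod x ^+ 2.
Proof.
move=> wz hr hl x x2.
have inb y : cmod y <= 1 -> vnorm (w + y *: h - z0) < r0.
  move=> y1; rewrite addrAC; apply: le_lt_trans (vnormD _ _) _; rewrite vnormZ.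
  have := vnorm_ge0 h; have := cmod_ge0 y; nra.
have hh : hol1 (fun y => f (w + y *: h)) by apply: (holn_line hf) => y /inb /hW.
have [|k1 k2] := crep_cderiv0 (M := M) (hol1_crep hh).
  by move=> t _; apply/fM/inb; rewrite cmod_expi.
rewrite (cderiv_unique hl k2); have := k1 x x2.
by rewrite scale0r addr0.
Qed.

End ball.

Lemma vcat_local_bound (W : set Cn) f z : open W -> W z -> vcat f z ->
  exists2 r, 0 < r & forall w, vnorm (w - z) < r -> W w /\ cmod (f w) <= cmod (f z) + 1.
Proof.
move=> oW Wz cf; have [r r0 hr] := (nbhs_vnorm _ _).1 (open_nbhs_nbhs (conj oW Wz)).
have [d d0 hd] := cf 1 ltr01; exists (Num.min r d); first by rewrite lt_min r0.
move=> w; rewrite lt_min => /andP[w1 w2]; split; first exact: hr.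
by have := hd w w2; have := cmodD (f w - f z) (f z); rewrite subrK; lra.
Qed.

Lemma second_order (W : set Cn) f z : open W -> W z -> (forall w, W w -> differentiable f w) ->
  exists r C, [/\ 0 < r, 0 <= C & forall w, vnorm w <= r ->
    W (z + w) /\ cmod (f (z + w) - f z - 'd f z w) <= C * vnorm w ^+ 2].
Proof.
move=> oW Wz df; have hf := differentiable_holn df.
have [r0 r0_gt0 hr] := vcat_local_bound oW Wz (hf z Wz).1.
set M := cmod (f z) + 1 in hr.
have M0 : 0 <= M by rewrite /M; have := cmod_ge0 (f z); lra.
exists (r0 / 4), (2 * M * (2 / r0) ^+ 2); split; first lra.
  by apply: mulr_ge0; [exact: mulr_ge0|exact: sqr_ge0].
move=> w wr; have w0 := vnorm_ge0 w; split.
  by have [] := hr (z + w) ltac:(rewrite addrC addKr; lra).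
have [v0|vn0] := eqVneq (vnorm w) 0.
  have -> : w = 0.
    apply/rowP => j; rewrite mxE; apply/eqP; rewrite -cmod_eq0; apply/eqP/le_anti.
    by rewrite cmod_ge0 andbT -v0 cmod_le_vnorm.
  by rewrite addr0 linear0 subrr subr0 cmod0 vnorm0 expr0n mulr0.
have vp : 0 < vnorm w by rewrite lt_def vn0.
(* Rescaling [w] to the fixed length [r0 / 2] makes the constant independent of its size and
   direction. *)
pose c := r0 / 2 / vnorm w; have c0 : 0 < c by rewrite !divr_gt0.
pose k := (c%:C%C : R[i]) *: w; pose x : R[i] := (c^-1)%:C%C.
have xk : x *: k = w by rewrite /x /k scalerA -rmorphM mulVf ?gt_eqF // scale1r.
have kr : vnorm k = r0 / 2 by rewrite vnormZ cmodR gtr0_norm // /c divfK.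
have cx : cmod x = 2 / r0 * vnorm w.
  by rewrite cmodR gtr0_norm ?invr_gt0 // /c; field; rewrite vn0 gt_eqF.
have x2 : cmod x <= 1 / 2 by rewrite cx mulrAC ler_pdivrMr //; lra.
have zz : vnorm (z - z) < r0 / 2 by rewrite subrr vnorm0; lra.
have := @line_second_order W f z r0 M (fun w h => (hr w h).1) hf (fun w h => (hr w h).2)
  z k _ zz _ (differentiable_gderiv k (df z Wz)) x x2.
rewrite kr => /(_ (lexx _)); rewrite xk cx exprMn mulrA.
have E : 'd f z (x *: k) = x *: 'd f z k by rewrite linearZ.
have -> : 'd f z k * x = 'd f z w by rewrite -xk E; exact: mulrC.
by [].
Qed.

(** Near each point the derivative is the uniform limit of the difference quotients [Q xi], which
    are holomorphic along lines; continuity and, by [crep_uniform_limit], Cauchy's formula pass to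
    the limit. The class [holn] is therefore stable under differentiation. *)
Lemma gderiv_holn (W : set Cn) f h : open W -> holn W f ->
  exists2 L : Cn -> R[i], (forall z, W z -> gderiv f z h (L z)) & holn W L.
Proof.
move=> oW hf.
have /choice[L hL] z : exists l, W z -> gderiv f z h l.
  have [Wz|nWz] := pselect (W z); last by exists 0.
  by have [_ /(_ h)[l hl]] := hf z Wz; exists l.
exists L => // z0 Wz0.
have [r0 r0_gt0 hr] := vcat_local_bound oW Wz0 (hf z0 Wz0).1.
set M := cmod (f z0) + 1 in hr.
have M0 : 0 <= M by rewrite /M; have := cmod_ge0 (f z0); lra.
have h0 := vnorm_ge0 h.
(* The direction is shortened first, so that the disc of parameters stays in the ball where [f] is
   bounded. *)
pose r := r0 / 2 / (vnorm h + 1); have rp : 0 < r by rewrite !divr_gt0 //; lra.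
have rh : vnorm ((r%:C%C : R[i]) *: h) <= r0 / 2.
  rewrite vnormZ cmodR gtr0_norm // /r mulrAC ler_pdivrMr ?ltr_wpDl //; nra.
pose Q (xi : R) w := (f (w + (xi%:C%C : R[i]) *: ((r%:C%C : R[i]) *: h)) - f w) / (xi * r)%:C%C.
have QL xi w : 0 < xi -> xi <= 1 / 2 -> vnorm (w - z0) < r0 / 2 ->
    cmod (Q xi w - L w) <= 2 * M * xi / r.
  move=> xi0 xi2 wz.
  have Ww : W w by have [] := hr w ltac:(lra).
  have cxi : cmod (xi%:C%C : R[i]) = xi by rewrite cmodR gtr0_norm.
  have := @line_second_order W f z0 r0 M (fun w h => (hr w h).1) hf (fun w h => (hr w h).2)
    w _ _ wz rh (gderivZ r%:C%C (hL w Ww)) xi%:C%C.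
  rewrite cxi => /(_ xi2) H.
  have xr0 : (xi * r)%:C%C != 0 :> R[i] by rewrite -cmod_gt0 cmodR normr_gt0 mulf_neq0 ?gt_eqF.
  have -> : Q xi w - L w = (f (w + (xi%:C%C : R[i]) *: ((r%:C%C : R[i]) *: h)) - f w -
      r%:C%C * L w * xi%:C%C) / (xi * r)%:C%C.
    rewrite /Q [RHS]mulrBl; congr (_ - _).
    have -> : r%:C%C * L w * xi%:C%C = L w * (xi * r)%:C%C.
      have -> : (xi * r)%:C%C = xi%:C%C * r%:C%C :> R[i] by exact: rmorphM.
      by ring.
    by rewrite mulfK.
  have xr : 0 < xi * r by exact: mulr_gt0.
  rewrite cmodM cmodV cmodR (gtr0_norm xr) ler_pdivrMr //.
  apply: le_trans H _; rewrite le_eqVlt; apply/orP; left; apply/eqP.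
  by rewrite expr2 mulrA [xi * r]mulrC mulrA divfK ?gt_eqF.
have small e : 0 < e -> exists xi, [/\ 0 < xi, xi <= 1 / 2 & 2 * M * xi / r <= e].
  move=> e0; pose xi := Num.min (1 / 2) (e * r / (2 * M + 1)).
  have er : 0 < e * r by rewrite mulr_gt0.
  exists xi; split; first by rewrite lt_min divr_gt0 //= divr_gt0 //; lra.
    by rewrite ge_min lexx.
  rewrite ler_pdivrMr //; apply: le_trans (_ : 2 * M * (e * r / (2 * M + 1)) <= _).
    by apply: ler_wpM2l; [rewrite mulr_ge0|rewrite ge_min lexx orbT].
  by rewrite mulrA ler_pdivrMr; nra.
have inb xi w : cmod xi <= 1 / 2 -> vnorm (w - z0) < r0 / 2 ->
    vnorm (w + xi *: ((r%:C%C : R[i]) *: h) - z0) < r0.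
  move=> xi1 wz; rewrite addrAC; apply: le_lt_trans (vnormD _ _) _; rewrite vnormZ.
  by have := vnorm_ge0 ((r%:C%C : R[i]) *: h); have := cmod_ge0 xi; nra.
have z00 : vnorm (z0 - z0) < r0 / 2 by rewrite subrr vnorm0; lra.
split.
  move=> e e0; have e8 : 0 < e / 8 by lra.
  have [xi [xi0 xi2 xie]] := small _ e8.
  have cxi : cmod (xi%:C%C : R[i]) <= 1 / 2 by rewrite cmodR gtr0_norm.
  have xr : 0 < xi * r by rewrite mulr_gt0.
  have e1 : 0 < e / 8 * (xi * r) by rewrite mulr_gt0.
  pose u := (xi%:C%C : R[i]) *: ((r%:C%C : R[i]) *: h).
  have Wu : W (z0 + u) by have [] := hr _ (inb _ _ cxi z00).
  have [d1 d10 hd1] := (hf _ Wu).1 _ e1; have [d2 d20 hd2] := (hf _ Wz0).1 _ e1.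
  exists (Num.min (r0 / 2) (Num.min d1 d2)); first by rewrite !lt_min d10 d20 divr_gt0.
  move=> w; rewrite !lt_min => /and3P[w0 w1 w2].
  have k1 := QL _ _ xi0 xi2 w0; have k2 := QL _ _ xi0 xi2 z00.
  have k3 : cmod (Q xi w - Q xi z0) <= e / 4.
    rewrite /Q -mulrBl cmodM cmodV cmodR gtr0_norm // ler_pdivrMr //.
    have := hd1 (w + u).
    rewrite (_ : w + u - (z0 + u) = w - z0); last by rewrite opprD addrACA subrr addr0.
    move=> /(_ w1) k4; have k5 := hd2 w w2; rewrite -/u.
    have := cmodB (f (w + u) - f (z0 + u)) (f w - f z0).
    rewrite (_ : f (w + u) - f (z0 + u) - _ = f (w + u) - f w - (f (z0 + u) - f z0)); last by ring.
    lra.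
  have := cmodB (Q xi w - Q xi z0 - (Q xi w - L w)) (- (Q xi z0 - L z0)).
  have := cmodB (Q xi w - Q xi z0) (Q xi w - L w); rewrite cmodN.
  rewrite (_ : _ - _ - _ - - _ = L w - L z0); last by ring.
  lra.
move=> k.
have k0 := vnorm_ge0 k.
pose s := r0 / 4 / (vnorm k + 1); have sp : 0 < s by rewrite !divr_gt0 //; lra.
pose k' := (s%:C%C : R[i]) *: k.
have kr : vnorm k' <= r0 / 4.
  rewrite vnormZ cmodR gtr0_norm // /s mulrAC ler_pdivrMr ?ltr_wpDl //; nra.
have inz x : cmod x <= 1 -> vnorm (z0 + x *: k' - z0) < r0 / 2.
  move=> x1; rewrite addrC addKr vnormZ; have := cmod_ge0 x; have := vnorm_ge0 k'; nra.
have cL : crep (fun x => L (z0 + x *: k')).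
  apply: crep_uniform_limit => eta eta0.
  have [xi [xi0 xi2 xie]] := small _ eta0.
  have cxi : cmod (xi%:C%C : R[i]) <= 1 / 2 by rewrite cmodR gtr0_norm.
  exists (fun x => Q xi (z0 + x *: k')); split; last first.
    by move=> x x1; apply: le_trans xie; apply: QL => //; exact: inz.
  apply: hol1_crep => x x1.
  pose u := (xi%:C%C : R[i]) *: ((r%:C%C : R[i]) *: h).
  have h1 : hol1 (fun x => f ((z0 + u) + x *: k')).
    apply: (holn_line hf) => y y1; rewrite addrAC.
    by have [] := hr _ (inb _ _ cxi (inz _ y1)).
  have h2 : hol1 (fun x => f (z0 + x *: k')).
    by apply: (holn_line hf) => y y1; have [] := hr (z0 + y *: k') ltac:(have := inz y y1; lra).
  have [l1 hl1] := h1 x x1; have [l2 hl2] := h2 x x1.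
  exists ((xi * r)%:C%C^-1 * (l1 - l2)).
  have := cderiv_scale (xi * r)%:C%C^-1 (cderiv_sub hl1 hl2).
  by congr cderiv; apply: funext => y; rewrite /Q -/u mulrC [z0 + u + _]addrAC.
have [B hB] := rcont_bounded (ltW (twopi_gt0 R)) (ccont_cmod cL.1).
have [|_ k2] := crep_cderiv0 (M := B) cL.
  by move=> t tI; apply: le_trans (hB t tI); exact: ler_norm.
exists (s%:C%C^-1 * taylor_coef (fun x => L (z0 + x *: k')) 1).
have <- : (s%:C%C : R[i])^-1 *: k' = k.
  by rewrite scalerA mulVf ?scale1r // -cmod_gt0 cmodR normr_gt0 gt_eqF.
exact: gderivZ.
Qed.

End rV.
End topology.

(** * A class of smooth functions *)

Section flat.
Variable R : realType.

Lemma is_derive_eps (f : R -> R) (x l : R) :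
  (forall e, 0 < e -> exists2 d, 0 < d & forall y, `|y - x| < d ->
     `|f y - f x - l * (y - x)| <= e * `|y - x|) -> is_derive x 1 f l.
Proof.
move=> H.
have C : (fun h : R => h^-1 *: ((f \o shift x) (h *: (1 : R)) - f x)) @ 0^' --> l.
  apply/cvgrPdist_le => e e0; have [d d0 hd] := H e e0.
  near=> h.
  have h0 : h != 0 by near: h; exact: nbhs_dnbhs_neq.
  have hd' : `|h| < d by near: h; apply: dnbhs0_lt.
  have := hd (h + x); rewrite addrK => /(_ hd').
  rewrite /= /shift /= [h *: 1]mulr1 => k.
  have -> : l - h^-1 *: (f (h + x) - f x) = - (h^-1 * (f (h + x) - f x - l * h)).
    have -> : h^-1 *: (f (h + x) - f x) = h^-1 * (f (h + x) - f x) by [].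
    by field.
  by rewrite normrN normrM normfV ler_pdivrMl ?normr_gt0 // [leRHS]mulrC.
split; first by apply/cvg_ex; exists l.
exact/cvg_lim.
Unshelve. all: by end_near. Qed.

(* All the derivatives of [exp (- 1 / x)] extended by [0] are combinations of these. *)
Definition flat (m : nat) (x : R) : R := if 0 < x then x^-1 ^+ m * expR (- x^-1) else 0.

Lemma flat_ge0 m x : 0 <= flat m x.
Proof.
rewrite /flat; case: ifP => // x0.
by rewrite mulr_ge0 ?expR_ge0 // exprn_ge0 // invr_ge0 ltW.
Qed.

Lemma flat_gt0 m x : 0 < x -> 0 < flat m x.
Proof. by move=> x0; rewrite /flat x0 mulr_gt0 ?expR_gt0 // exprn_gt0 // invr_gt0. Qed.

Lemma flat_le0 m x : x <= 0 -> flat m x = 0.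
Proof. by rewrite /flat ltNge => ->. Qed.

(** From [exp y >= y ^+ m.+1 / (m.+1)!] at [y = x^-1]. A linear bound is enough, since further
    factors [x] can be gained by raising [m]. *)
Lemma flat_bound m x : flat m x <= (m.+1)`!%:R * `|x|.
Proof.
rewrite /flat; case: ifP => [x0|_]; last by rewrite mulr_ge0.
rewrite gtr0_norm // expRN ler_pdivrMr ?expR_gt0 //.
have y0 : 0 <= x^-1 by rewrite invr_ge0 ltW.
have := expR_ge1Dxn m y0; set F := (m.+1)`!%:R.
have F0 : 0 < F by rewrite ltr0n fact_gt0.
move=> H; have {}H : x^-1 ^+ m.+1 / F <= expR x^-1 by lra.
move: H; rewrite ler_pdivrMr // => H.
have -> : x^-1 ^+ m = x * x^-1 ^+ m.+1.
  by rewrite exprS mulrA divff ?mul1r // gt_eqF.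
by rewrite -mulrA [_ * (x * _)]mulrCA ler_pM2l // mulrC.
Qed.

Lemma is_derive_flat m (x : R) : is_derive x 1 (flat m) (- m%:R * flat m.+1 x + flat m.+2 x).
Proof.
case: (ltrgtP x 0) => x0.
- apply: (near_eq_is_derive (f := fun=> 0)).
    by near=> y; rewrite flat_le0 // ltW //; near: y; exact: lt_nbhsl.
  rewrite !flat_le0 ?ltW // mulr0 add0r.
  apply: is_derive_eps => e e0; exists 1 => // y _.
  by rewrite subrr mul0r subrr normr0 mulr_ge0 // ltW.
- pose g (y : R) := y^-1 ^+ m * expR (- y^-1).
  apply: (near_eq_is_derive (f := g)).
    by near=> y; rewrite /flat ifT //; near: y; exact: lt_nbhsr.
  rewrite /flat x0 /g.
  have xn : x != 0 by rewrite gt_eqF.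
  have dV : is_derive x 1 (fun y : R => y^-1) (- x^-1 ^+ 2).
    have := @is_deriveV R id x 1 1 xn (is_derive_id _ _).
    by rewrite -exprVn [_ *: 1]mulr1.
  have dX := is_deriveX m dV.
  have dE : is_derive x 1 (fun y : R => expR (- y^-1)) (expR (- x^-1) * x^-1 ^+ 2).
    apply: (@is_derive1_comp _ expR (fun y => - y^-1)).
    by have := is_deriveN dV; rewrite opprK.
  have gE : (fun y : R => y^-1) ^+ m * (fun y : R => expR (- y^-1)) = g.
    by apply: funext => y; rewrite /g mulrfctE /= exprfctE.
  have := is_deriveM dX dE; rewrite gE => dg; apply: (is_derive_eq dg).
  have sE (a b : R) : a *: b = a * b by [].
  rewrite exprfctE /= !sE.
  case: m {g gE dg dX} => [|m] /=; first by rewrite !(expr0, exprS); ring.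
  by rewrite !exprS; ring.
- rewrite x0 !flat_le0 // mulr0 add0r.
  apply: is_derive_eps => e e0.
  have F0 : 0 < (m.+2)`!%:R :> R by rewrite ltr0n fact_gt0.
  exists (e / (m.+2)`!%:R); first by rewrite divr_gt0.
  move=> y; rewrite subr0 mul0r (flat_le0 m (lexx 0)) !subr0 ltr_pdivlMr // => ye.
  rewrite ger0_norm ?flat_ge0 //.
  (* One factor [|y|] is traded for a higher index; with [flat_bound] this makes [flat m] of second
     order at 0, so its derivative vanishes there. *)
  have -> : flat m y = `|y| * flat m.+1 y.
    rewrite /flat; case: ifP => y0; last by rewrite mulr0.
    by rewrite gtr0_norm // exprS !mulrA divff ?mul1r // gt_eqF.
  rewrite mulrC; apply: ler_wpM2r => //.
  by apply: le_trans (flat_bound _ _) _; rewrite mulrC ltW.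
Unshelve. all: by end_near. Qed.

Lemma continuous_flat m (x : R) : {for x, continuous (flat m)}.
Proof.
apply: differentiable_continuous; apply/derivable1_diffP.
by have [] := is_derive_flat m x.
Qed.

End flat.

Section smooth.
Variables (R : realType) (n : nat).
Local Notation Cn := 'rV[R[i]]_n.
Variable W : set Cn.
Hypothesis oW : open W.

(** A class closed under real directional derivatives, so that membership alone gives
    differentiability of every order. The holomorphic ingredients range over [holn], and [flat] over
    all indices, because each derivative has to stay in the class. *)
Inductive smooth_expr : (Cn -> R) -> Prop :=
| smooth_Re f : holn W f -> smooth_expr (fun z => complex.Re (f z))
| smooth_Im f : holn W f -> smooth_expr (fun z => complex.Im (f z))
| smooth_add u v : smooth_expr u -> smooth_expr v -> smooth_expr (fun z => u z + v z)
| smooth_mul u v : smooth_expr u -> smooth_expr v -> smooth_expr (fun z => u z * v z)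
| smooth_flat m u : smooth_expr u -> smooth_expr (fun z => flat m (u z))
| smooth_inv u : smooth_expr u -> (forall z, W z -> u z != 0) -> smooth_expr (fun z => (u z)^-1)
| smooth_ln u : smooth_expr u -> (forall z, W z -> 0 < u z) -> smooth_expr (fun z => ln (u z)).

Lemma holn_cst (k : R[i]) : holn W (fun=> k).
Proof.
move=> z _; split; last by move=> h; exists 0; exact: cderiv_cst.
by move=> e e0; exists 1 => // w _; rewrite subrr cmod0.
Qed.

Lemma smooth_cst (k : R) : smooth_expr (fun=> k).
Proof. exact: (smooth_Re (holn_cst k%:C%C)). Qed.

Lemma vcat_Re (f : Cn -> R[i]) z : vcat f z -> {for z, continuous (fun w => complex.Re (f w))}.
Proof.
move=> fz A /nbhs_ballP[e /= e0 hA]; have [d d0 hd] := fz e e0.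
apply/nbhs_vnorm; exists d => // w wz; apply: hA; rewrite -ball_normE /= distrC -ReB.
exact: le_lt_trans (cmod_ge_Re _) (hd w wz).
Qed.

Lemma vcat_Im (f : Cn -> R[i]) z : vcat f z -> {for z, continuous (fun w => complex.Im (f w))}.
Proof.
move=> fz A /nbhs_ballP[e /= e0 hA]; have [d d0 hd] := fz e e0.
apply/nbhs_vnorm; exists d => // w wz; apply: hA; rewrite -ball_normE /= distrC -ImB.
exact: le_lt_trans (cmod_ge_Im _) (hd w wz).
Qed.

Lemma smooth_continuous v z : smooth_expr v -> W z -> {for z, continuous v}.
Proof.
move=> sv Wz; elim: sv => [f hf|f hf|u w _ cu _ cw|u w _ cu _ cw|m u _ cu|u _ cu u0|u _ cu u0].
- by apply: vcat_Re; exact: (hf z Wz).1.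
- by apply: vcat_Im; exact: (hf z Wz).1.
- by apply: continuousD.
- by apply: continuousM.
- by apply: (@continuous_comp _ _ _ u (flat m)) => //; exact: continuous_flat.
- by apply: continuousV => //; exact: u0.
- by apply: (@continuous_comp _ _ _ u (@ln R)) => //; apply: continuous_ln; exact: u0.
Qed.

Definition rline (v : Cn -> R) (z h : Cn) (t : R) := v (z + (t%:C)%C *: h).

Lemma rline0 v z h : rline v z h 0 = v z.
Proof. by rewrite /rline scale0r addr0. Qed.

Lemma gderiv_Re (f : Cn -> R[i]) z h l : gderiv f z h l ->
  is_derive (0 : R) 1 (rline (fun w => complex.Re (f w)) z h) (complex.Re l).
Proof.
move=> fl; apply: is_derive_eps => e e0; have [d d0 hd] := fl e e0.
exists d => // t; rewrite subr0 => td; have := hd t%:C%C; rewrite subr0 cmodR => /(_ td).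
apply: le_trans; rewrite /rline.
set A := f _; set B := f _; apply: le_trans (cmod_ge_Re _).
by case: A => a1 a2; case: B => b1 b2; case: l {fl hd} => l1 l2 /=; rewrite mulr0 subr0.
Qed.

Lemma gderiv_Im (f : Cn -> R[i]) z h l : gderiv f z h l ->
  is_derive (0 : R) 1 (rline (fun w => complex.Im (f w)) z h) (complex.Im l).
Proof.
move=> fl; apply: is_derive_eps => e e0; have [d d0 hd] := fl e e0.
exists d => // t; rewrite subr0 => td; have := hd t%:C%C; rewrite subr0 cmodR => /(_ td).
apply: le_trans; rewrite /rline.
set A := f _; set B := f _; apply: le_trans (cmod_ge_Im _).
by case: A => a1 a2; case: B => b1 b2; case: l {fl hd} => l1 l2 /=; rewrite mulr0 add0r.
Qed.

Lemma smooth_deriv v h : smooth_expr v -> exists2 w, smooth_expr w &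
  forall z, W z -> is_derive (0 : R) 1 (rline v z h) (w z).
Proof.
move=> sv; elim: sv => [f hf|f hf|u w su [u' su' du] sw [w' sw' dw]|
  u w su [u' su' du] sw [w' sw' dw]|m u su [u' su' du]|u su [u' su' du] u0|u su [u' su' du] u0].
- have [L dL hL] := gderiv_holn h oW hf.
  by exists (fun z => complex.Re (L z)) => [|z Wz]; [exact: smooth_Re|apply: gderiv_Re; exact: dL].
- have [L dL hL] := gderiv_holn h oW hf.
  by exists (fun z => complex.Im (L z)) => [|z Wz]; [exact: smooth_Im|apply: gderiv_Im; exact: dL].
- exists (fun z => u' z + w' z) => [|z Wz]; first exact: smooth_add.
  by have := is_deriveD (du z Wz) (dw z Wz).
- exists (fun z => u z * w' z + w z * u' z) => [|z Wz].
    by apply: smooth_add; exact: smooth_mul.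
  apply: (is_derive_eq (is_deriveM (du z Wz) (dw z Wz))).
  by congr (_ * _ + _ * _); exact: rline0.
- exists (fun z => (- m%:R * flat m.+1 (u z) + flat m.+2 (u z)) * u' z) => [|z Wz].
    apply: smooth_mul => //; apply: smooth_add; last exact: smooth_flat.
    by apply: smooth_mul; [exact: smooth_cst|exact: smooth_flat].
  have H : is_derive (rline u z h 0) (1 : R) (flat m) (- m%:R * flat m.+1 (u z) + flat m.+2 (u z)).
    by rewrite rline0; exact: is_derive_flat.
  exact: (is_derive1_comp H (du z Wz)).
- exists (fun z => - 1 * ((u z)^-1 * (u z)^-1) * u' z) => [|z Wz].
    apply: smooth_mul => //; apply: smooth_mul; first exact: smooth_cst.
    by apply: smooth_mul; exact: smooth_inv.
  have uz : rline u z h 0 != 0 by rewrite rline0; exact: u0.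
  apply: (is_derive_eq (is_deriveV uz (du z Wz))).
  have sE (a b : R) : a *: b = a * b by [].
  by rewrite sE rline0 expr2 invfM mulN1r.
- exists (fun z => (u z)^-1 * u' z) => [|z Wz].
    by apply: smooth_mul => //; apply: smooth_inv => // z Wz; rewrite gt_eqF ?u0.
  have H : is_derive (rline u z h 0) (1 : R) (@ln R) (u z)^-1.
    by rewrite rline0; apply: is_derive1_ln; exact: u0.
  exact: (is_derive1_comp H (du z Wz)).
Qed.

Lemma near_within_open z : W z -> \forall w \near z, W w.
Proof. by move=> Wz; apply: open_nbhs_nbhs. Qed.

(** [smooth_deriv] describes derivatives on [W] only, whereas [differentiable_class] speaks of
    functions on the whole space; as [W] is open, values outside it do not influence derivatives at
    its points. *)
Lemma differentiable_class_eq k (u v : Cn -> R) : (forall z, W z -> u z = v z) ->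
  differentiable_class k W u -> differentiable_class k W v.
Proof.
have nl z h : W z -> \forall t \near (0 : R), W (z + (t%:C)%C *: h).
  move=> Wz; have [r r0 hr] := (nbhs_vnorm _ _).1 (near_within_open Wz).
  have h0 := vnorm_ge0 h.
  have r1 : 0 < r / (vnorm h + 1) by rewrite divr_gt0 //; lra.
  exists (r / (vnorm h + 1)) => //= t; rewrite /= sub0r normrN ltr_pdivlMr ?ltr_wpDl // => tr.
  apply: hr; rewrite addrC addKr vnormZ cmodR; have := normr_ge0 t; nra.
have ev z (u1 v1 : Cn -> R) : (forall z, W z -> u1 z = v1 z) -> W z ->
    {for z, continuous u1} -> {for z, continuous v1}.
  move=> uv Wz cu A vA; have := cu A; rewrite uv // => /(_ vA) /nbhs_vnorm[d d0 hd].
  have [r r0 hr] := (nbhs_vnorm _ _).1 (near_within_open Wz).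
  apply/nbhs_vnorm; exists (Num.min d r); first by rewrite lt_min d0.
  move=> w; rewrite lt_min => /andP[/hd Aw /hr Ww].
  by move: Aw; rewrite /= uv.
elim: k u v => [|k ih] u v uv /= [cu du]; split => //; try by move=> z Wz; exact: (ev z u v uv Wz (cu z Wz)).
move=> h; have [d1 d2] := du h.
have nr z : W z -> \forall t \near (0 : R), u (z + (t%:C)%C *: h) = v (z + (t%:C)%C *: h).
  by move=> Wz; have := nl z h Wz; apply: filterS => t /uv.
split=> [z Wz|]; first by apply: (near_eq_derivable _ (d1 z Wz)); exact: nr.
apply: ih d2 => z Wz /=.
by rewrite !derive1E; apply: near_eq_derive => //; exact: nr.
Qed.

Lemma smooth_differentiable_class v k : smooth_expr v -> differentiable_class k W v.
Proof.
elim: k v => [|k ih] v sv /=; split=> //; try by move=> z; apply: smooth_continuous.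
move=> h; have [w sw dw] := smooth_deriv h sv.
split=> [z Wz|]; first by have [] := dw z Wz.
apply: (@differentiable_class_eq k w) (ih w sw) => z Wz.
by have [_ e] := dw z Wz; rewrite derive1E.
Qed.

End smooth.

(** * Lebesgue measure on tuples and volumes in C^n *)

Section translation.
Variable R : realType.

Definition real_shift (a : R) (x : measurableTypeR R) : measurableTypeR R := x + a.

Lemma measurable_real_shift a : measurable_fun setT (real_shift a).
Proof. by apply: measurable_funD => //; exact: measurable_cst. Qed.

HB.instance Definition _ a := @isMeasurableFun.Build _ _ _ _ (real_shift a) (measurable_real_shift a).

Lemma lebesgue_measure_shift a (A : set (measurableTypeR R)) : measurable A ->
  lebesgue_measure (real_shift a @^-1` A) = lebesgue_measure A.
Proof.
move=> mA; apply/esym.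
apply: (@lebesgue_measure_unique R (pushforward lebesgue_measure (real_shift a))) => //= _ [[b c]] _ <-.
rewrite /pushforward.
have -> : real_shift a @^-1` `]b, c]%classic = `]b - a, c - a]%classic.
  by apply/seteqP; split => x; rewrite /real_shift /= !in_itv /= ltrBlDr lerBrDr.
rewrite !lebesgue_measure_itv /= !lte_fin ltrD2r.
case: ifP => // _; rewrite -!EFinB; congr EFin; ring.
Qed.

Definition tshift m (v t : m.-tuple R) : m.-tuple R := [tuple tnth t i + tnth v i | i < m].

Lemma tnth_tshift m (v t : m.-tuple R) i : tnth (tshift v t) i = tnth t i + tnth v i.
Proof. by rewrite tnth_mktuple. Qed.

Lemma measurable_tshift m (v : m.-tuple R) : measurable_fun setT (tshift v).
Proof.
apply/measurable_fun_tnthP => i.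
rewrite (_ : _ \o _ = fun t => tnth t i + tnth v i); last first.
  by apply: funext => t /=; rewrite tnth_tshift.
by apply: measurable_funD; [exact: measurable_tnth|exact: measurable_cst].
Qed.

HB.instance Definition _ m (v : m.-tuple R) :=
  @isMeasurableFun.Build _ _ _ _ (tshift v) (measurable_tshift v).

Section step.
Variables (m : nat) (mu : {sigma_finite_measure set (m.-tuple R) -> \bar R}) (a : R) (v : m.-tuple R).

Definition pshift (p : measurableTypeR R * m.-tuple R) := (real_shift a p.1, tshift v p.2).

Lemma measurable_pshift : measurable_fun setT pshift.
Proof.
apply/measurable_fun_pairP; split.
- by apply: (measurableT_comp (measurable_real_shift a)); exact: measurable_fst.
- by apply: (measurableT_comp (measurable_tshift v)); exact: measurable_snd.
Qed.

HB.instance Definition _ := @isMeasurableFun.Build _ _ _ _ pshift measurable_pshift.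

Lemma product_measure_shift (A : set (measurableTypeR R * m.-tuple R)) :
  (forall B, measurable B -> mu (tshift v @^-1` B) = mu B) -> measurable A ->
  (lebesgue_measure \x mu)%E (pshift @^-1` A) = (lebesgue_measure \x mu)%E A.
Proof.
move=> Hmu mA; apply/esym.
apply: (@product_measure_unique _ _ _ _ _ _ _ (pushforward (lebesgue_measure \x mu)%E pshift)) => //= B C mB mC.
rewrite /pushforward.
rewrite (_ : pshift @^-1` (B `*` C) = (real_shift a @^-1` B) `*` (tshift v @^-1` C)) //.
have m1 : measurable (real_shift a @^-1` B).
  by rewrite -[X in measurable X]setTI; exact: measurable_real_shift.
have m2 : measurable (tshift v @^-1` C).
  by rewrite -[X in measurable X]setTI; exact: measurable_tshift.
rewrite product_measure1E //; congr (_ * _)%E; [exact: lebesgue_measure_shift|exact: Hmu].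
Qed.

End step.

(** Induction on the dimension: a shift acts separately on head and tail, and a product measure is
    determined by its values on rectangles. *)
Lemma lebesgue_tuple_shift m (v : m.-tuple R) (A : set (m.-tuple R)) : measurable A ->
  lebesgue_tuple R m (tshift v @^-1` A) = lebesgue_tuple R m A.
Proof.
elim: m v A => [|m ih] v A mA.
  by congr (lebesgue_tuple R 0 _); apply/seteqP; split => t; rewrite /= (tuple0 (tshift v t)) (tuple0 t).
rewrite /= /lebesgue_step /pushforward.
have mA' : measurable (@tcons R m @^-1` A).
  by rewrite -[X in measurable X]setTI; exact: measurable_tcons.
pose w : m.-tuple R := [tuple of behead v].
apply: etrans _ (@product_measure_shift m (lebesgue_tuple R m) (thead v) w _ (fun B mB => ih w B mB) mA').
congr ((lebesgue_measure \x lebesgue_tuple R m)%E _).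
have E (p : measurableTypeR R * m.-tuple R) :
    tshift v (tcons p) = tcons (pshift (thead v) w p).
  apply: eq_from_tnth => i; rewrite tnth_tshift.
  case: (unliftP ord0 i) => [j|] ->.
    by rewrite !tnthS tnth_tshift; congr (_ + _); rewrite [in LHS](tuple_eta v) tnthS.
  by rewrite !tnth0.
by apply/seteqP; split => p; rewrite /preimage /= E.
Qed.

End translation.

Section box.
Variable R : realType.

Definition box m (l u : 'I_m -> R) : set (m.-tuple R) :=
  [set t | forall i, l i <= tnth t i <= u i].

Lemma measurable_box m (l u : 'I_m -> R) : measurable (box l u).
Proof.
have -> : box l u = \bigcap_(i in [set: 'I_m]) ((fun t : m.-tuple R => tnth t i) @^-1` `[l i, u i]%classic).
  apply/seteqP; split => t /= H i => [_|]; first by rewrite /= in_itv /=; exact: H.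
  by have := H i I; rewrite /= in_itv.
apply: fin_bigcap_measurable => // i _.
rewrite -[X in measurable X]setTI.
by apply: measurable_tnth.
Qed.

Lemma lebesgue_tuple_box m (l u : 'I_m -> R) : (forall i, l i <= u i) ->
  lebesgue_tuple R m (box l u) = (\prod_(i < m) (u i - l i))%:E.
Proof.
elim: m l u => [|m ih] l u lu.
  rewrite big_ord0 /= diracE mem_set //; by case.
rewrite /= /lebesgue_step /pushforward.
have -> : @tcons R m @^-1` box l u =
    `[l ord0, u ord0]%classic `*` box (fun i => l (lift ord0 i)) (fun i => u (lift ord0 i)).
  apply/seteqP; split => -[x t] /=.
    move=> H; split => [|i]; first by have := H ord0; rewrite /= in_itv /= tnth0.
    by have := H (lift ord0 i); rewrite tnthS.
  move=> [] /=; rewrite in_itv /= => H0 H1 i.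
  by case: (unliftP ord0 i) => [j|] ->; [rewrite tnthS; exact: H1|rewrite tnth0].
rewrite product_measure1E //; last exact: measurable_box.
by rewrite ih // big_ord_recl EFinM; congr (_ * _)%E; exact: measure_itv.
Qed.

Definition opent m (A : set (m.-tuple R)) := forall t, A t ->
  exists2 d : R, 0 < d & forall s, (forall i, `|tnth s i - tnth t i| < d) -> A s.

(* An open set is the countable union of the rational boxes it contains. *)
Lemma opent_measurable m (A : set (m.-tuple R)) : opent A -> measurable A.
Proof.
move=> oA.
pose B (p : m.-tuple rat * nat) := box (fun i => ratr (tnth p.1 i) - p.2.+1%:R^-1 : R)
  (fun i => ratr (tnth p.1 i) + p.2.+1%:R^-1 : R).
have -> : A = \bigcup_(p in [set p | B p `<=` A]) B p.
  apply/seteqP; split => [t At|t [p pA]]; last exact: pA.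
  have [d d0 hd] := oA t At.
  have [k hk] : exists k : nat, k.+1%:R^-1 < d / 2.
    exists (Num.truncn (d / 2)^-1); rewrite -[X in _ < X]invrK ltf_pV2 ?posrE ?invr_gt0 ?divr_gt0 ?ltr0n //.
    exact: truncnS_gt.
  have /choice[q hq] (i : 'I_m) : exists q : rat, `|ratr q - tnth t i| < k.+1%:R^-1 :> R.
    have k0 : 0 < k.+1%:R^-1 :> R by rewrite invr_gt0.
    have [|q] := @rat_in_itvoo R (tnth t i - k.+1%:R^-1) (tnth t i + k.+1%:R^-1).
      by rewrite ltrBlDr -addrA ltrDl addr_gt0.
    by rewrite in_itv /= => qi; exists q; rewrite ltr_distl.
  exists ([tuple q i | i < m], k) => /= [s hs|i]; last first.
    rewrite /= tnth_mktuple; have := hq i; rewrite ltr_norml.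
    by move: (k.+1%:R^-1) => e /andP[? ?]; apply/andP; split; lra.
  apply: hd => i; have := hs i; have := hq i; rewrite /= tnth_mktuple !ltr_norml.
  move: hk; move: (k.+1%:R^-1) => e hk.
  by move=> /andP[? ?] /andP[? ?]; apply/andP; split; lra.
rewrite bigcup_mkcond; apply: countable_bigcupT_measurable => // p.
by case: ifP => // _; exact: measurable_box.
Qed.

End box.

(** * Measure estimates by counting overlaps *)

Section multiplicity.
Variables (R : realType) (d : measure_display) (T : measurableType d) (mu : {measure set T -> \bar R}).
Local Open Scope ereal_scope.

(** The sum of the indicators of the [A v] is at most [N]; it is integrated over [U]. *)
Lemma measure_multiplicity (V : finType) (A : V -> set T) (U : set T) (N : nat) :
  (forall v, measurable (A v)) -> measurable U -> (forall v, A v `<=` U) ->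
  (forall t, (#|[pred v | `[< A v t >]]| <= N)%N) ->
  \sum_(v : V) mu (A v) <= N%:R%:E * mu U.
Proof.
move=> mA mU AU hN.
have -> : \sum_(v : V) mu (A v) = \int[mu]_(x in U) (\sum_(v : V) (\1_(A v) x)%:E).
  rewrite ge0_integral_sum //.
  - by apply: eq_bigr => v _; rewrite integral_indic // setIidl.
  - by move=> v; apply/measurable_EFinP; exact: measurable_indic.
have -> : N%:R%:E * mu U = \int[mu]_(x in U) (N%:R%:E).
  by rewrite integral_cst.
apply: ge0_le_integral => //.
- by move=> x _; apply: sume_ge0 => v _; rewrite lee_fin.
- by apply: emeasurable_sum => v; apply/measurable_EFinP; exact: measurable_indic.
move=> x _; rewrite sumEFin lee_fin.
have -> : (\sum_(v : V) \1_(A v) x = (#|[pred v | `[< A v x >]]|)%:R :> R)%R.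
  rewrite -sum1_card natr_sum [RHS]big_mkcond; apply: eq_bigr => v _.
  by rewrite indicE inE /=; case: (asboolP (A v x)) => h; [rewrite mem_set|rewrite memNset].
by rewrite ler_nat.
Qed.

Lemma measure_cover (V : finType) (A : V -> set T) (U : set T) (c : R) :
  (forall v, measurable (A v)) -> measurable U -> U `<=` (fun t => exists v, A v t) ->
  (forall v, mu (A v) <= c%:E) -> mu U <= (#|V|%:R * c)%:E.
Proof.
move=> mA mU UA hc.
have -> : mu U = \int[mu]_(x in U) (1%R%:E) by rewrite integral_cst // mul1e.
apply: (@le_trans _ _ (\int[mu]_(x in U) (\sum_(v : V) (\1_(A v) x)%:E))).
  apply: ge0_le_integral => //.
    by apply: emeasurable_sum => v; apply/measurable_EFinP; exact: measurable_indic.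
  move=> x Ux; have [v Av] := UA x Ux.
  rewrite (bigD1 v) //= indicE mem_set // leeDl //; apply: sume_ge0 => w _.
  by rewrite lee_fin.
rewrite ge0_integral_sum //; last by move=> v; apply/measurable_EFinP; exact: measurable_indic.
apply: (@le_trans _ _ (\sum_(v : V) c%:E)).
  apply: lee_sum => v _; rewrite integral_indic //; apply: le_trans (hc v).
  by apply: le_measure; rewrite ?inE //; exact: measurableI.
by rewrite sumEFin sumr_const mulr_natl.
Qed.

End multiplicity.

(** * Volumes of sets in complex space *)

Section volume.
Variables (R : realType) (n : nat).
Local Notation Cn := 'rV[R[i]]_n.
Implicit Types (w u v z : Cn) (t : (n + n).-tuple R).
Local Notation mu := (lebesgue_tuple R (n + n)).

Let splitl (j : 'I_n) : fintype.split (lshift n j) = inl j.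
Proof. exact: (unsplitK (inl j)). Qed.

Let splitr (j : 'I_n) : fintype.split (rshift n j) = inr j.
Proof. exact: (unsplitK (inr j)). Qed.

Definition ctuple w : (n + n).-tuple R :=
  [tuple match fintype.split i with inl j => complex.Re (w 0 j) | inr j => complex.Im (w 0 j) end | i < n + n].

Lemma ctuple_l w j : tnth (ctuple w) (lshift n j) = complex.Re (w 0 j).
Proof. by rewrite tnth_mktuple splitl. Qed.

Lemma ctuple_r w j : tnth (ctuple w) (rshift n j) = complex.Im (w 0 j).
Proof. by rewrite tnth_mktuple splitr. Qed.

Lemma cvec_shift t v : cvec (tshift (ctuple v) t) = cvec t + v.
Proof.
by apply/rowP => j; rewrite !mxE !tnth_tshift ctuple_l ctuple_r; case: (v 0 j).
Qed.

Lemma vnorm_cvec t s : vnorm (cvec s - cvec t) <=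
  \sum_(j < n) (`|tnth s (lshift n j) - tnth t (lshift n j)| + `|tnth s (rshift n j) - tnth t (rshift n j)|).
Proof.
apply: ler_sum => j _; rewrite !mxE; apply: le_trans (cmod_le_ReIm _) _.
by rewrite ReB ImB.
Qed.

Definition cpre (W : set Cn) : set ((n + n).-tuple R) := [set t | W (cvec t)].

Lemma open_measurable_cpre (W : set Cn) : open W -> measurable (cpre W).
Proof.
move=> oW; apply: opent_measurable => t Wt.
have [r r0 hr] := (nbhs_vnorm _ _).1 (open_nbhs_nbhs (conj oW Wt)).
have n0 : 0 < n%:R *+ 2 + 1 :> R by rewrite ltr_wpDl // mulrn_wge0.
exists (r / (n%:R *+ 2 + 1)); first by rewrite divr_gt0.
move=> s st; apply: hr; apply: le_lt_trans (vnorm_cvec _ _) _.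
set d := r / _ in st.
have d0 : 0 < d by rewrite divr_gt0.
apply: le_lt_trans (_ : \sum_(j < n) (d *+ 2) < _).
  by apply: ler_sum => j _; rewrite mulr2n; apply: lerD; apply: ltW; exact: st.
rewrite sumr_const card_ord.
have -> : r = d * (n%:R *+ 2 + 1) by rewrite /d divfK // gt_eqF.
have -> : d *+ 2 *+ n = d * (n%:R *+ 2) by rewrite mulrnAr mulr_natr mulrnAC.
by rewrite ltr_pM2l // ltrDl.
Qed.

(** Squares rather than discs in each coordinate, so that the preimage is a real box of known
    volume. *)
Definition cbox (c : Cn) (r : 'I_n -> R) : set Cn :=
  [set w | forall j, `|complex.Re (w 0 j - c 0 j)| <= r j /\ `|complex.Im (w 0 j - c 0 j)| <= r j].

Lemma cpre_cbox c r : cpre (cbox c r) =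
  box (fun i => tnth (ctuple c) i - match fintype.split i with inl j => r j | inr j => r j end)
      (fun i => tnth (ctuple c) i + match fintype.split i with inl j => r j | inr j => r j end).
Proof.
apply/seteqP; split => t /= H.
  move=> i; case: (split_ordP i) => j ->.
    rewrite ctuple_l; have [+ _] := H j.
    by rewrite ReB mxE /= ler_norml => /andP[? ?]; apply/andP; split; lra.
  rewrite ctuple_r; have [_ +] := H j.
  by rewrite ImB mxE /= ler_norml => /andP[? ?]; apply/andP; split; lra.
move=> j; have := H (lshift n j); have := H (rshift n j).
rewrite splitl splitr ctuple_l ctuple_r ReB ImB !mxE /= !ler_norml.
by move=> /andP[? ?] /andP[? ?]; split; apply/andP; split; lra.
Qed.

Lemma measurable_cbox c r : measurable (cpre (cbox c r)).
Proof. by rewrite cpre_cbox; exact: measurable_box. Qed.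

Lemma vol_cbox c r : (forall j, 0 <= r j) -> mu (cpre (cbox c r)) = (\prod_(j < n) (2 * r j) ^+ 2)%:E.
Proof.
move=> r0; rewrite cpre_cbox lebesgue_tuple_box; last first.
  by move=> i; case: (fintype.split i) => j; have := r0 j; lra.
congr EFin; rewrite big_split_ord /= -big_split /=; apply: eq_bigr => j _.
rewrite splitl splitr; ring.
Qed.

Lemma cpre_shift (A : set Cn) v : cpre [set w | A (w + v)] = tshift (ctuple v) @^-1` cpre A.
Proof. by apply/seteqP; split => t; rewrite /cpre /= cvec_shift. Qed.

Lemma measurable_cpre_shift (A : set Cn) v : measurable (cpre A) ->
  measurable (cpre [set w | A (w + v)]).
Proof.
move=> mA; rewrite cpre_shift -[X in measurable X]setTI; exact: measurable_tshift.
Qed.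

Lemma vol_shift (A : set Cn) v : measurable (cpre A) -> mu (cpre [set w | A (w + v)]) = mu (cpre A).
Proof. by move=> mA; rewrite cpre_shift lebesgue_tuple_shift. Qed.

Definition cdelta (k : 'I_n) : Cn := delta_mx 0 k.

Definition grid (d : R) K (p : 'I_K * 'I_K) : R[i] := Complex (d * p.1%:R) (d * p.2%:R).

Lemma grid_sep d K (p q : 'I_K * 'I_K) : 0 <= d -> p != q -> d <= cmod (grid d p - grid d q).
Proof.
move=> d0 pq.
have ne (a b : 'I_K) : a != b -> d <= `|d * a%:R - d * b%:R|.
  move=> ab; rewrite -mulrBr normrM ger0_norm // ler_peMr //.
  rewrite -[X in X <= _](normr1 int) -[X in X <= _](ler_int R) || idtac.
  have : (1 <= `|a%:Z - b%:Z|)%R.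
    by rewrite -gtz0_ge1 normr_gt0 subr_eq0; apply: contra ab => /eqP[/val_inj ->].
  by rewrite -(ler_int R) intr_norm rmorphB.
case: p q pq => [a b] [a' b'] pq.
have [ab|ab] := eqVneq a a'.
  have bb : b != b' by apply: contra pq => /eqP ->; rewrite ab.
  by apply: le_trans (ne _ _ bb) _; have := cmod_ge_Im (grid d (a, b) - grid d (a', b')); rewrite ImB.
by apply: le_trans (ne _ _ ab) _; have := cmod_ge_Re (grid d (a, b) - grid d (a', b')); rewrite ReB.
Qed.

(* Translates of [A] by a [d]-spaced grid in one complex direction overlap at most [N] times,
   which bounds the volume of [A] without slicing. *)
Lemma packing_upper (A : set Cn) c r k (d : R) (N : nat) : measurable (cpre A) ->
  (forall j, 0 <= r j) -> 0 < d -> d <= 1 -> A `<=` cbox c r ->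
  (forall w (xs : seq R[i]), (forall x, x \in xs -> A (w + x *: cdelta k)) ->
    separated d xs -> (size xs <= N)%N) ->
  (mu (cpre A) <= (N%:R * d ^+ 2 * ((2 * (r k + 2)) ^+ 2 * \prod_(j < n | j != k) (2 * r j) ^+ 2))%:E)%E.
Proof.
move=> mA r0 d0 d1 Ac hN.
(* Then [d * K%:R] lies between 1 and 2: the grid has at least [d ^- 2] points, and all its
   translations move real and imaginary parts by at most 2, whence [r k + 2]. *)
pose K := (Num.truncn d^-1).+1.
have Kd1 : d^-1 < K%:R by exact: truncnS_gt.
have Kd2 : d * K%:R <= 2.
  have := Num.Theory.truncn_le d^-1; rewrite invr_ge0 (ltW d0) => k1.
  have : d * (Num.truncn d^-1)%:R <= d * d^-1 by rewrite ler_pM2l.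
  by rewrite divff ?gt_eqF // /K -natr1 mulrDr mulr1; lra.
have K0 : 0 < K%:R :> R by rewrite ltr0n.
pose r' j := if j == k then r k + 2 else r j.
have r'0 j : 0 <= r' j by rewrite /r'; case: ifP => // _; have := r0 k; lra.
pose B (p : 'I_K * 'I_K) := cpre [set w | A (w + grid d p *: cdelta k)].
have mB p : measurable (B p) by exact: measurable_cpre_shift.
have muB p : mu (B p) = mu (cpre A) by rewrite /B vol_shift.
have gb (p : 'I_K * 'I_K) : 0 <= complex.Re (grid d p) <= 2 /\ 0 <= complex.Im (grid d p) <= 2.
  have aux (a : 'I_K) : 0 <= d * a%:R <= 2.
    apply/andP; split; first by rewrite mulr_ge0 // ltW.
    by apply: le_trans Kd2; rewrite ler_pM2l // ler_nat ltnW.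
  by split; exact: aux.
have BU p : B p `<=` cpre (cbox c r').
  move=> t /Ac H j; have [] := H j; rewrite !mxE eqxx /= /r'.
  have [-> |jk] := eqVneq j k.
    rewrite mulr1; have [/andP[? ?] /andP[? ?]] := gb p.
    rewrite !ReB !ImB !ReD !ImD !ler_norml => /andP[? ?] /andP[? ?].
    by split; apply/andP; split; lra.
  by rewrite mulr0 addr0.
(* The grid points whose translates cover a given point are [d]-separated parameters, on one line,
   of points of [A]. *)
have mult t : (#|[pred p | `[< B p t >]]| <= N)%N.
  set S := [pred p | _].
  have := hN (cvec t) [seq grid d p | p <- enum S]; rewrite size_map -cardE; apply.
    by move=> x /mapP[p]; rewrite mem_enum inE /= => /asboolP Bp ->; exact: (asboolW Bp).
  rewrite /separated pairwise_map.
  have := enum_uniq S; rewrite uniq_pairwise; apply: sub_pairwise => p q pq /=.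
  by apply: grid_sep => //; exact: ltW.
have mU := measurable_cbox c r'.
have := measure_multiplicity mu mB mU BU mult.
rewrite (eq_bigr (fun=> mu (cpre A)) (fun p _ => muB p)) [X in (_ <= _ * X)%E](vol_cbox c r'0).
have Afin : mu (cpre A) \is a fin_num.
  rewrite ge0_fin_numE //; apply: le_lt_trans (_ : mu (cpre (cbox c r)) < +oo)%E.
    by apply: le_measure; rewrite ?inE //; [exact: measurable_cbox|move=> t; exact: Ac].
  by rewrite vol_cbox // ltry.
rewrite -(fineK Afin) sumEFin sumr_const card_prod card_ord -EFinM !lee_fin.
rewrite (bigD1 k) //= {1}/r' eqxx.
rewrite (eq_bigr (fun j => (2 * r j) ^+ 2)); last by move=> j jk; rewrite /r' (negbTE jk).
set P := _ * \prod_(_ | _) _; set x := fine _ => H.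
have P0 : 0 <= P.
  by rewrite mulr_ge0 ?sqr_ge0 //; apply: prodr_ge0 => j _; exact: sqr_ge0.
have x0 : 0 <= x by apply: fine_ge0.
have KK : 1 <= d ^+ 2 * (K * K)%:R.
  have dK : 1 <= d * K%:R by rewrite -ler_pdivrMl // mulr1 ltW.
  by rewrite natrM expr2 mulrACA -[X in X <= _]mulr1; apply: ler_pM.
apply: le_trans (_ : d ^+ 2 * (x *+ (K * K)) <= _).
  by rewrite -mulr_natr mulrCA; nra.
have -> : N%:R * d ^+ 2 * P = d ^+ 2 * (N%:R * P) by ring.
by apply: ler_wpM2l => //; exact: sqr_ge0.
Qed.

Lemma linear_vnorm (L : Cn -> R[i]) : (forall u v, L (u + v) = L u + L v) ->
  (forall (k : R[i]) u, L (k *: u) = k * L u) ->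
  exists2 B : R, 0 < B & forall w, cmod (L w) <= B * vnorm w.
Proof.
move=> LD LZ; exists (\sum_(j < n) cmod (L (cdelta j)) + 1).
  by rewrite ltr_wpDl // sumr_ge0 // => j _; exact: cmod_ge0.
have L0 : L 0 = 0 by rewrite -(scale0r (0 : Cn)) LZ mul0r.
move=> w; rewrite {1}(row_sum_delta w) (big_morph L LD L0).
apply: le_trans (cmod_sum _ _ _) _.
rewrite mulrDl mul1r; apply: le_trans (_ : \sum_(j < n) cmod (L (cdelta j)) * vnorm w <= _).
  apply: ler_sum => j _; rewrite LZ cmodM mulrC.
  by apply: ler_wpM2l; [exact: cmod_ge0|exact: cmod_le_vnorm].
by rewrite -mulr_suml lerDl vnorm_ge0.
Qed.

Lemma open_slab (L : Cn -> R[i]) (B e d : R) : (forall u v, L (u - v) = L u - L v) ->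
  0 < B -> (forall w, cmod (L w) <= B * vnorm w) ->
  open [set w : Cn | vnorm w < e /\ cmod (L w) < d].
Proof.
move=> LB B0 hB; rewrite openE => w [we wd]; apply/nbhs_vnorm.
have e1 : 0 < e - vnorm w by lra.
have e2 : 0 < (d - cmod (L w)) / B by rewrite divr_gt0 //; lra.
exists (Num.min (e - vnorm w) ((d - cmod (L w)) / B)); first by rewrite lt_min e1.
move=> u; rewrite lt_min ltr_pdivlMr // => /andP[u1 u2]; split.
  by have := vnormD (u - w) w; rewrite subrK; lra.
have := hB (u - w); rewrite LB; have := cmodD (L u - L w) (L w); rewrite subrK; lra.
Qed.

(* The image of a cube under [L] is covered by few small squares; two points of the cube over
   the same square differ by an element of the slab, so translates of the slab cover the cube. *)
Lemma pigeonhole_lower (L : Cn -> R[i]) (B : R) : (forall u v, L (u - v) = L u - L v) ->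
  0 < B -> (forall w, cmod (L w) <= B * vnorm w) ->
  exists2 c : R, 0 < c & forall e q : R, 0 < e -> 0 < q -> q <= 1 ->
  ((c * (e ^+ 2) ^+ n * q ^+ 2)%:E <= mu (cpre [set w : Cn | (vnorm w < e)%R /\ (cmod (L w) < e * q)%R]))%E.
Proof.
move=> LB B0 hB.
(* Two points of a cube of side [e / m] are then closer than [e] in [vnorm]. *)
pose m : R := (2 * n%:R + 1); have m0 : 0 < m by rewrite ltr_wpDl // mulr_ge0.
exists ((m^-1 ^+ 2) ^+ n / (6 * B + 1) ^+ 2).
  by rewrite divr_gt0 ?exprn_gt0 ?invr_gt0 //; lra.
move=> e q e0 q0 q1; set S := [set w | _].
have mS : measurable (cpre S).
  by apply: open_measurable_cpre; exact: open_slab hB.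
have Sfin : mu (cpre S) \is a fin_num.
  rewrite ge0_fin_numE //; apply: le_lt_trans (_ : mu (cpre (cbox 0 (fun=> e))) < +oo)%E.
    apply: le_measure; rewrite ?inE //; first exact: measurable_cbox.
    move=> t [te _] j; rewrite !mxE subr0.
    have := cmod_le_vnorm (cvec t) j; rewrite mxE => k.
    by split; apply: le_trans (ltW te); apply: le_trans k; [exact: cmod_ge_Re|exact: cmod_ge_Im].
  by rewrite vol_cbox ?ltry // => j; exact: ltW.
pose eta := e / m; have eta0 : 0 < eta by rewrite divr_gt0.
pose Q := cbox (\row_j Complex (eta / 2) (eta / 2)) (fun=> eta / 2).
have QP w : Q w -> forall j, 0 <= complex.Re (w 0 j) <= eta /\ 0 <= complex.Im (w 0 j) <= eta.
  move=> Qw j; have [] := Qw j; rewrite !mxE ReB ImB /= !ler_norml.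
  by move=> /andP[? ?] /andP[? ?]; split; apply/andP; split; lra.
have small u : (forall j, `|complex.Re (u 0 j)| <= eta /\ `|complex.Im (u 0 j)| <= eta) -> vnorm u < e.
  move=> hu; apply: le_lt_trans (_ : n%:R * (2 * eta) < _).
    apply: vnorm_le => j; have [h1 h2] := hu j.
    by apply: le_trans (cmod_le_ReIm _) _; lra.
  have -> : e = eta * m by rewrite /eta divfK // gt_eqF.
  have -> : n%:R * (2 * eta) = eta * (2 * n%:R) by ring.
  by rewrite ltr_pM2l // /m ltrDl.
(* Over the same square the real and imaginary parts of [L] differ by at most [s], hence the values
   by at most [2 * s < e * q]. *)
pose s := e * q / 3; have s0 : 0 < s by rewrite divr_gt0 // mulr_gt0.
pose K := (Num.truncn (2 * (B * e) / s)).+1.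
have Be : 0 < B * e by rewrite mulr_gt0.
have LQ w : Q w -> cmod (L w) <= B * e.
  move=> Qw; apply: le_trans (hB w) _; rewrite ler_pM2l //; apply/ltW/small => j.
  have [/andP[? ?] /andP[? ?]] := QP w Qw j.
  by split; rewrite ger0_norm.
pose idx (x : R) := Num.truncn ((x + B * e) / s).
have idxK (x : R) : `|x| <= B * e -> (idx x < K)%N.
  rewrite ler_norml => /andP[x1 x2]; rewrite ltnS; apply: le_truncn.
  by rewrite ler_pM2r ?invr_gt0 //; lra.
have idxE (x y : R) : `|x| <= B * e -> `|y| <= B * e -> idx x = idx y -> `|x - y| <= s.
  rewrite !ler_norml => /andP[x1 x2] /andP[y1 y2] xy.
  have xs : 0 <= (x + B * e) / s by apply: divr_ge0; [lra|exact: ltW].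
  have ys : 0 <= (y + B * e) / s by apply: divr_ge0; [lra|exact: ltW].
  have /andP[a1 a2] := truncn_itv xs; have /andP[b1 b2] := truncn_itv ys.
  have xy' : Num.truncn ((x + B * e) / s) = Num.truncn ((y + B * e) / s) := xy.
  rewrite xy' -?natr1 in a1 a2; rewrite -natr1 in b2.
  move: a1 a2 b1 b2; move: (Num.truncn _)%:R => j.
  rewrite !(ler_pdivlMr _ _ s0) !(ltr_pdivrMr _ _ s0) !mulrDl !mul1r.
  by move: (j * s) => js *; apply/andP; split; lra.
pose cls w := (idx (complex.Re (L w)), idx (complex.Im (L w))).
(* One point of the cube is chosen over each square that is hit; over the other squares the value 0
   is arbitrary. *)
have /choice[rep hrep] (p : 'I_K * 'I_K) : exists w0, (exists w, Q w /\ cls w = (val p.1, val p.2)) ->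
    Q w0 /\ cls w0 = (val p.1, val p.2).
  have [[w hw]|nw] := pselect (exists w, Q w /\ cls w = (val p.1, val p.2)); first by exists w.
  by exists 0.
have cover : cpre Q `<=` (fun t => exists p : 'I_K * 'I_K, cpre [set w | S (w + - rep p)] t).
  move=> t Qt; set w := cvec t.
  have R1 : `|complex.Re (L w)| <= B * e by apply: le_trans (cmod_ge_Re _) (LQ w Qt).
  have I1 : `|complex.Im (L w)| <= B * e by apply: le_trans (cmod_ge_Im _) (LQ w Qt).
  pose p := (Ordinal (idxK _ R1), Ordinal (idxK _ I1)).
  exists p; have [] := hrep p; first by exists w.
  set w0 := rep p => Q0 [c1 c2]; rewrite /cpre /=; split.
    apply: small => j; have [/andP[? ?] /andP[? ?]] := QP w Qt j.
    have [/andP[? ?] /andP[? ?]] := QP w0 Q0 j.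
    have -> : (w + - w0) 0 j = w 0 j - w0 0 j by rewrite [in LHS]mxE [X in _ + X]mxE.
    by rewrite ReB ImB !ler_norml; split; apply/andP; split; lra.
  rewrite LB; have R0 : `|complex.Re (L w0)| <= B * e by apply: le_trans (cmod_ge_Re _) (LQ w0 Q0).
  have I0 : `|complex.Im (L w0)| <= B * e by apply: le_trans (cmod_ge_Im _) (LQ w0 Q0).
  have k1 := idxE _ _ R1 R0 (esym c1); have k2 := idxE _ _ I1 I0 (esym c2).
  apply: le_lt_trans (cmod_le_ReIm _) _; rewrite ReB ImB.
  have : e * q = 3 * s by rewrite /s; field.
  lra.
have := @measure_cover R _ _ mu _ _ (cpre Q) (fine (mu (cpre S)))
  (fun p => measurable_cpre_shift (- rep p) mS) (measurable_cbox _ _) cover.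
have vS p : (mu (cpre [set w | S (w + - rep p)%R]) <= (fine (mu (cpre S)))%:E)%E.
  by rewrite vol_shift // fineK.
move=> /(_ vS).
rewrite [X in (X <= _)%E](@vol_cbox _ (fun=> eta / 2)); last by move=> j; lra.
rewrite lee_fin card_prod card_ord prodr_const card_ord.
move=> H; rewrite -[X in (_ <= X)%E](fineK Sfin) lee_fin; move: H.
set x := fine _.
have x0 : 0 <= x by apply: fine_ge0.
have -> : 2 * (eta / 2) = eta by field.
have Kq : K%:R * q <= 6 * B + 1.
  have k0 : 0 <= 2 * (B * e) / s by rewrite divr_ge0 ?ltW // mulr_gt0.
  have := truncn_itv k0 => /andP[k1 _].
  rewrite /K -natr1 mulrDl mul1r.
  have -> : 6 * B = 2 * (B * e) / s * q by rewrite /s; field; rewrite !gt_eqF.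
  have : (Num.truncn (2 * (B * e) / s))%:R * q <= 2 * (B * e) / s * q by rewrite ler_pM2r.
  lra.
have Kq0 : 0 <= K%:R * q by rewrite mulr_ge0 // ltW.
have B6 : 0 < 6 * B + 1 by lra.
move=> H.
have {H} H : (eta ^+ 2) ^+ n * q ^+ 2 <= (6 * B + 1) ^+ 2 * x.
  apply: le_trans (_ : (K * K)%:R * x * q ^+ 2 <= _); first by apply: ler_wpM2r => //; exact: sqr_ge0.
  have -> : (K * K)%:R * x * q ^+ 2 = (K%:R * q) ^+ 2 * x by rewrite natrM; ring.
  apply: ler_wpM2r => //; rewrite !expr2; apply: ler_pM => //.
rewrite -(ler_pM2l (exprn_gt0 2 B6)); apply: le_trans H.
rewrite le_eqVlt; apply/orP; left; apply/eqP.
have -> : eta ^+ 2 = e ^+ 2 * m^-1 ^+ 2 by rewrite /eta exprMn.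
rewrite [(e ^+ 2 * _) ^+ n]exprMn; move: ((e ^+ 2) ^+ n) ((m^-1 ^+ 2) ^+ n) => u v.
by field; rewrite gt_eqF.
Qed.

End volume.

(** * Volume of sublevel sets *)

Section sublevel.
Variables (R : realType) (n : nat).
Local Notation Cn := 'rV[R[i]]_n.
Local Notation mu := (lebesgue_tuple R (n + n)).

Lemma vnorm_delta (k : 'I_n) : vnorm (cdelta R k) = 1.
Proof.
rewrite /vnorm (bigD1 k) //= mxE !eqxx cmod1 big1 ?addr0 // => j /negPf jk.
by rewrite mxE jk cmod0.
Qed.

(** Compactness of the circle: a radius found at one parameter also serves nearby parameters, as
    [cexpi] is Lipschitz. *)
Lemma circle_uniform (g : Cn -> R[i]) p b e : 0 < e ->
  (forall t, 0 <= t <= 2 * pi -> vcat g (p + cexpi t *: b)) ->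
  exists2 d, 0 < d & forall w, vnorm (w - p) < d -> forall t, 0 <= t <= 2 * pi ->
    cmod (g (w + cexpi t *: b) - g (p + cexpi t *: b)) <= e.
Proof.
move=> e0 cg.
apply: (@interval_induction R (fun u v => exists2 d, 0 < d & forall w, vnorm (w - p) < d ->
  forall t, u <= t <= v -> cmod (g (w + cexpi t *: b) - g (p + cexpi t *: b)) <= e)).
- exact: ltW (twopi_gt0 R).
- move=> u m v _ um mv _ [d1 d10 h1] [d2 d20 h2]; exists (Num.min d1 d2); first by rewrite lt_min d10.
  move=> w; rewrite lt_min => /andP[w1 w2] t /andP[ut tv].
  by case: (leP t m) => tm; [apply: h1|apply: h2] => //; rewrite ?ut ?tm // ltW.
- move=> t0 t0I; have [|d d0 hd] := cg t0 t0I (e / 2); first by rewrite divr_gt0.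
  have B0 := vnorm_ge0 b; have b0 : 0 < vnorm b + 1 by lra.
  exists (d / 2 / (vnorm b + 1)); first by rewrite !divr_gt0.
  move=> u v u0 ut tv v2 vu; exists (d / 2); first by rewrite divr_gt0.
  move=> w wp t /andP[ut' tv'].
  have near y : vnorm (y - p) < d / 2 -> cmod (g (y + cexpi t *: b) - g (p + cexpi t0 *: b)) < e / 2.
    move=> yp; apply: hd.
    have -> : y + cexpi t *: b - (p + cexpi t0 *: b) = (y - p) + (cexpi t - cexpi t0) *: b.
      by rewrite scalerBl opprD addrACA.
    apply: le_lt_trans (vnormD _ _) _; rewrite vnormZ.
    have : cmod (cexpi t - cexpi t0) * vnorm b <= d / 2.
      apply: le_trans (_ : d / 2 / (vnorm b + 1) * (vnorm b + 1) <= _); last by rewrite divfK // gt_eqF.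
      apply: ler_pM => //; [exact: cmod_ge0| |by lra].
      apply: le_trans (cexpi_lip _ _) _; apply: ltW; apply: le_lt_trans vu.
      by rewrite ler_norml; apply/andP; split; lra.
    lra.
  have n1 := near w wp; have n2 : cmod (g (p + cexpi t *: b) - g (p + cexpi t0 *: b)) < e / 2.
    by apply: near; rewrite subrr vnorm0 divr_gt0.
  have -> : g (w + cexpi t *: b) - g (p + cexpi t *: b) = (g (w + cexpi t *: b) - g (p + cexpi t0 *: b)) - (g (p + cexpi t *: b) - g (p + cexpi t0 *: b)) by ring.
  apply: le_trans (cmodB _ _) _; lra.
Qed.

(** If all coefficients below [i] vanish, then at [x = exp (- u)] the sum of squares is
    [O(exp (- 2 i u))]. The hypothesis, with [s] equal to [2 kappa i u] up to a constant, then
    bounds [exp (- u)] by a multiple of [exp (- 2 kappa i wt u)], and large [u] forces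
    [2 kappa i wt <= 1]. The least order of a non-zero coefficient is the [i] sought. *)
Lemma axis_order N (h : 'I_N -> R[i] -> R[i]) (kappa wt r C : R) :
  (forall l, hol1 (h l)) -> 0 < kappa -> 0 < wt -> 0 < r -> 0 < C ->
  (forall x s, cmod x <= 1 -> 0 <= s ->
     \sum_(l < N) cmod (h l x) ^+ 2 < expR (- (s / kappa)) -> r * cmod x <= C * expR (- (wt * s))) ->
  exists i l, taylor_coef (h l) i != 0 /\ 2 * kappa * i%:R * wt <= 1.
Proof.
move=> hh k0 wt0 r0 C0 H.
have [M hM] : exists M, forall l t, 0 <= t <= 2 * pi -> cmod (h l (cexpi t)) <= M.
  have /choice[M hM] l : exists M, forall t, 0 <= t <= 2 * pi -> cmod (h l (cexpi t)) <= M.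
    have [M hM] := rcont_bounded (ltW (twopi_gt0 R)) (ccont_cmod (@hol1_circle _ _ 0 (2 * pi) (hh l))).
    by exists M => t /hM; rewrite ger0_norm ?cmod_ge0.
  exists (\sum_l `|M l|) => l t tI; apply: le_trans (hM l t tI) _.
  by rewrite (bigD1 l) //=; apply: ler_wpDr; [exact: sumr_ge0|exact: ler_norm].
pose Q := N%:R * (2 * M) ^+ 2 + 1.
have Q0 : 0 < Q by rewrite ltr_wpDl // mulr_ge0 // sqr_ge0.
have low i : (forall j l, (j < i)%N -> taylor_coef (h l) j = 0) -> 2 * kappa * i%:R * wt <= 1.
  move=> z; rewrite leNgt; apply/negP => big.
  (* Large enough for [exp (- u) <= 1 / 2], for [s >= 0], and for the term linear in [u] to beat all
     constants. *)
  pose u := 1 + `|ln Q| + `|ln C - ln r + kappa * wt * ln Q| / (2 * kappa * i%:R * wt - 1).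
  have big' : 0 < 2 * kappa * i%:R * wt - 1 by rewrite subr_gt0.
  have u1 : 1 + `|ln Q| <= u by rewrite lerDl divr_ge0 // ltW.
  have u1' : 1 <= u by apply: le_trans u1; rewrite lerDl.
  have i1 : 1 <= i%:R :> R.
    by case: (i) big => [|j _]; [rewrite mulr0 mul0r ltr10|rewrite ler1n].
  have cx : cmod ((expR (- u))%:C%C) = expR (- u) by rewrite cmodR ger0_norm // expR_ge0.
  have x2 : expR (- u) <= 1 / 2.
    rewrite expRN div1r lef_pV2 ?posrE ?expR_gt0 //.
    by have := expR_ge1Dx u; lra.
  (* Chosen so that [exp (- (s / kappa))] is [Q * exp (- 2 i u)], just above the bound on the sum of
     squares. *)
  pose s := kappa * (2 * i%:R * u - ln Q).
  have s0 : 0 <= s.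
    apply: mulr_ge0; first exact: ltW.
    have := ler_norm (ln Q); have : u <= i%:R * u by rewrite ler_peMl //; lra.
    lra.
  have := H (expR (- u))%:C%C s; rewrite cx; have -> : expR (- u) <= 1 by lra.
  move=> /(_ isT s0).
  have sk : expR (- (s / kappa)) = Q * expR (- u) ^+ i ^+ 2.
    rewrite /s mulrAC mulfV ?gt_eqF // mul1r opprB expRD lnK ?posrE //; congr (_ * _).
    by rewrite -!expRM_natl; congr expR; ring.
  have -> : \sum_l cmod (h l (expR (- u))%:C%C) ^+ 2 < expR (- (s / kappa)).
    rewrite sk; apply: le_lt_trans (_ : N%:R * (2 * M) ^+ 2 * expR (- u) ^+ i ^+ 2 < _); last first.
      by rewrite ltr_pM2r ?exprn_gt0 ?expR_gt0 // ltrDl.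
    rewrite -mulrA -exprMn mulr_natl -[X in _ *+ X](card_ord N) -sumr_const.
    apply: ler_sum => l _; rewrite ler_pXn2r ?nnegrE ?cmod_ge0 //; last first.
      by rewrite mulr_ge0 ?exprn_ge0 ?expR_ge0 // mulr_ge0 //; apply: le_trans (cmod_ge0 _) (hM l 0 _); rewrite lexx ltW // twopi_gt0.
    have := taylor_rem i (hol1_crep (hh l)) (hM l) (_ : cmod (expR (- u))%:C%C <= 1 / 2).
    rewrite cx => /(_ x2); rewrite big1 ?subr0 // => j _.
    by rewrite z ?mul0r.
  move=> /(_ isT).
  rewrite -(ler_ln (mulr_gt0 r0 (expR_gt0 _)) (mulr_gt0 C0 (expR_gt0 _))).
  rewrite !lnM ?posrE ?expR_gt0 // !expRK /s.
  have -> : wt * (kappa * (2 * i%:R * u - ln Q)) = (2 * kappa * i%:R * wt - 1) * u + u - kappa * wt * ln Q by ring.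
  have : `|ln C - ln r + kappa * wt * ln Q| < (2 * kappa * i%:R * wt - 1) * u.
    by rewrite [ltRHS]mulrC -ltr_pdivrMr // /u ltrDr ltr_wpDr.
  have := ler_norm (ln C - ln r + kappa * wt * ln Q); lra.
(* If every coefficient vanished, [low] would hold for arbitrarily large [i]. *)
have ex : exists i, `[< exists l, taylor_coef (h l) i != 0 >].
  apply: contrapT => /forallNP nex.
  have all i : 2 * kappa * i%:R * wt <= 1.
    apply: low => j l _; apply/eqP; apply: contraT => c0; case: (nex j); apply/asboolP; by exists l.
  have a0 : 0 < 2 * kappa * wt by rewrite !mulr_gt0.
  have := all (Num.truncn (2 * kappa * wt)^-1).+1.
  have /andP[_ t2] : (Num.truncn (2 * kappa * wt)^-1)%:R <= (2 * kappa * wt)^-1 < (Num.truncn (2 * kappa * wt)^-1).+1%:R.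
    by apply: truncn_itv; rewrite invr_ge0 ltW.
  rewrite mulrAC mulrC -ler_pdivlMr // div1r => t3.
  by move: (lt_le_trans t2 t3); rewrite ltxx.
case: (ex_minnP ex) => i /asboolP[l cl] mn; exists i, l; split=> //; apply: low => j l' ji.
apply/eqP; apply: contraT => c0; have := mn j; rewrite leqNgt ji => /(_ _).
by apply; apply/asboolP; exists l'.
Qed.

Lemma line_separated (d r : R) (x0 : R[i]) (xs : seq R[i]) : 0 < r -> separated d xs ->
  separated (d / r) [seq (x - x0) / r%:C%C | x <- xs].
Proof.
move=> r0; rewrite /separated pairwise_map; apply: sub_pairwise => x y /= xy.
rewrite -mulrBl opprB addrA subrK cmodM cmodV cmodR ger0_norm ?(ltW r0) //.
by rewrite ler_pM2r // invr_gt0.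
Qed.

(* On a line, [i + 1] separated points where [g l] is small make the divided difference of order
   [i] small, while near [p] it is close to the Taylor coefficient. *)
Lemma line_points N (g : 'I_N -> Cn -> R[i]) (W : set Cn) (p : Cn) (k : 'I_n) (i : nat) (l : 'I_N) (r theta sigma : R) :
  0 < r -> r <= 1 -> 0 < theta -> 0 < sigma ->
  (forall z, W z -> differentiable (g l) z) ->
  (forall w x, vnorm (w - p) < r -> cmod x <= 1 -> W (w + x *: (r%:C%C *: cdelta R k))) ->
  taylor_coef (fun x => g l (p + x *: (r%:C%C *: cdelta R k))) i != 0 ->
  exists d s0, [/\ 0 < d, 0 <= s0 & forall s, s0 <= s -> forall w (xs : seq R[i]),
    (forall x, x \in xs -> vnorm (w + x *: cdelta R k - p) < d /\
       cmod (g l (w + x *: cdelta R k)) <= expR (- (i%:R * sigma + theta) * s)) ->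
    separated (expR (- sigma * s)) xs -> (size xs <= i)%N].
Proof.
move=> r0 r1 t0 sg0 dg rW; set b := r%:C%C *: cdelta R k; set h0 := fun x => _ => c0.
have hg := differentiable_holn dg.
have hl w : vnorm (w - p) < r -> hol1 (fun x => g l (w + x *: b)).
  by move=> wr; apply: (holn_line hg) => x; exact: rW.
have hh0 : hol1 h0 by apply: hl; rewrite subrr vnorm0.
have [M hM] := rcont_bounded (ltW (twopi_gt0 R)) (ccont_cmod (@hol1_circle _ _ 0 (2 * pi) hh0)).
have hM' t : 0 <= t <= 2 * pi -> cmod (h0 (cexpi t)) <= M.
  by move=> /hM; rewrite ger0_norm ?cmod_ge0.
have c0' : 0 < cmod (taylor_coef h0 i) by rewrite cmod_gt0.
have [||dl /andP[dl0 dl2] hdl] := @divdiff_near R h0 i M (cmod (taylor_coef h0 i) / 2) _ hM'.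
- exact: hol1_circle.
- by rewrite divr_gt0.
have [t tI|d1 d10 hd1] := @circle_uniform (g l) p b dl dl0.
  by have [] := hg _ (rW p (cexpi t) _ _); rewrite ?subrr ?vnorm0 // cmod_expi.
(* [d1] limits how far the line may be moved, [dl * r / 2] keeps the rescaled nodes below [dl], and
   [r] keeps the disc inside [W]. *)
pose d := Num.min d1 (Num.min (dl * r / 2) r).
have d0 : 0 < d by rewrite !lt_min d10 r0 divr_gt0 // mulr_gt0.
have dd1 : d <= d1 by rewrite ge_min lexx.
have ddl : d <= dl * r / 2 by rewrite !ge_min lexx orbT.
have ddr : d <= r by rewrite !ge_min lexx !orbT.
(* From [s0] on, [theta * s], and all the more [exp (theta * s)], outweighs the ratio of [2 ^+ i] to
   half of the Taylor coefficient. *)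
pose s0 := 2 ^+ i / (cmod (taylor_coef h0 i) / 2) / theta.
have s00 : 0 <= s0 by apply/ltW; rewrite !divr_gt0 // exprn_gt0.
exists d, s0; split=> // s s0s w xs hxs sep; rewrite leqNgt; apply/negP => isz.
case: xs => [//|x0 xs] in hxs sep isz *.
pose v := w + x0 *: cdelta R k.
have vp : vnorm (v - p) < d by case: (hxs x0); rewrite ?mem_head.
pose f x := g l (v + x *: b).
have hf : hol1 f by apply: hl; apply: lt_le_trans ddr.
(* Exactly [i + 1] nodes are kept; they are recentred at the first one, which becomes 0, and
   rescaled by [r]. *)
pose ys := [seq (x - x0) / r%:C%C | x <- x0 :: take i xs].
have rC : r%:C%C != 0 :> R[i] by apply: contraTneq r0 => /(congr1 (@complex.Re R)) /= ->; rewrite ltxx.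
have fE x : f ((x - x0) / r%:C%C) = g l (w + x *: cdelta R k).
  by rewrite /f /v /b scalerA divfK // -addrA -scalerDl [x0 + _]addrC subrK.
have sub x : x \in x0 :: take i xs -> x \in x0 :: xs.
  by rewrite !inE => /orP[->//|/mem_take ->]; rewrite orbT.
have small : all (fun x => cmod x <= dl) ys.
  apply/allP => _ /mapP[x /sub xin ->].
  have [xp _] := hxs x xin; have [xp0 _] := hxs x0 (mem_head _ _).
  rewrite cmodM cmodV cmodR ger0_norm ?(ltW r0) // ler_pdivrMr //.
  have -> : cmod (x - x0) = vnorm ((w + x *: cdelta R k - p) - (w + x0 *: cdelta R k - p)).
    rewrite (_ : _ - _ = (x - x0) *: cdelta R k) ?vnormZ ?vnorm_delta ?mulr1 //.
    by apply/rowP => j; rewrite !mxE; ring.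
  apply: le_trans (vnormD _ _) _; rewrite vnormN; lra.
have sepy : separated (expR (- sigma * s) / r) ys.
  by apply: line_separated => //; apply: subseq_pairwise sep; rewrite /= eqxx take_subseq.
have szt : size (take i xs) = i by rewrite size_takel.
have := hdl f (behead ys) (head 0 ys) (hol1_circle hf).
rewrite /= size_map szt => /(_ _ erefl small) near.
have := @divdiff_upper R f (behead ys) (head 0 ys) (expR (- sigma * s) / r) (expR (- (i%:R * sigma + theta) * s)).
have dr0 : 0 < expR (- sigma * s) / r by rewrite divr_gt0 ?expR_gt0.
move=> /(_ dr0 (hol1_crep hf) _ sepy) up.
have {}near := near (fun t tI => hd1 v (lt_le_trans vp dd1) t tI).
have {}up : cmod (divdiff f (behead ys) (head 0 ys)) <= (2 / (expR (- sigma * s) / r)) ^+ i * expR (- (i%:R * sigma + theta) * s).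
  have sz : size (behead ys) = i by rewrite size_map szt.
  rewrite sz in up; apply: up.
    by apply: sub_all small => x; lra.
  suff : all (fun x => cmod (f x) <= expR (- (i%:R * sigma + theta) * s)) ys by [].
  apply/allP => _ /mapP[x /sub xin ->]; rewrite fE; by case: (hxs x xin).
(* The [i] factors [exp (sigma * s)] lost to the separation are paid for by the term [i%:R * sigma]
   in the smallness of [g l]; the surplus [theta] decides. *)
have upE : (2 / (expR (- sigma * s) / r)) ^+ i * expR (- (i%:R * sigma + theta) * s) <= 2 ^+ i * expR (- (theta * s)).
  have -> : expR (- (i%:R * sigma + theta) * s) = expR (- sigma * s) ^+ i * expR (- (theta * s)).
    by rewrite -expRM_natl -expRD; congr expR; ring.
  rewrite mulrA -exprMn ler_pM2r ?expR_gt0 //.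
  rewrite invfM invrK mulrCA mulrA [_^-1 * _]mulrC mulrAC divfK ?gt_eqF ?expR_gt0 //.
  have r0' : 0 <= r by exact: ltW.
  by rewrite lerXn2r ?nnegrE ?mulr_ge0 // ler_piMr.
have last : 2 ^+ i * expR (- (theta * s)) < cmod (taylor_coef h0 i) / 2.
  rewrite expRN ltr_pdivrMr ?expR_gt0 // mulrC -ltr_pdivrMr ?divr_gt0 //.
  have k1 : 2 ^+ i / (cmod (taylor_coef h0 i) / 2) <= theta * s.
    by rewrite [leRHS]mulrC -ler_pdivrMr.
  by apply: le_lt_trans k1 _; have := expR_ge1Dx (theta * s); lra.
have := cmod_revB (taylor_coef h0 i) (taylor_coef h0 i - divdiff f (behead ys) (head 0 ys)).
by rewrite subKr; move: near; rewrite -cmodN opprB => near; lra.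
Qed.

End sublevel.

Section sublevel_volume.
Variables (R : realType) (n : nat).
Local Notation Cn := 'rV[R[i]]_n.
Local Notation mu := (lebesgue_tuple R (n + n)).

Lemma smooth_sumsq (I : Type) (r : seq I) (g : I -> Cn -> R[i]) (W : set Cn) :
  (forall l, holn W (g l)) -> smooth_expr W (fun w => \sum_(l <- r) cmod (g l w) ^+ 2).
Proof.
move=> hg; elim: r => [|l r ih].
  rewrite (_ : (fun _ => _) = (fun=> 0 : R)); first exact: smooth_cst.
  by apply/funext => w; rewrite big_nil.
rewrite (_ : (fun _ => _) = (fun w => complex.Re (g l w) * complex.Re (g l w) +
  complex.Im (g l w) * complex.Im (g l w) + \sum_(l <- r) cmod (g l w) ^+ 2)); last first.
  by apply/funext => w; rewrite big_cons cmod_sqr !expr2.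
apply: smooth_add => //; apply: smooth_add; apply: smooth_mul;
  by [exact: smooth_Re|exact: smooth_Im].
Qed.

Lemma open_sublevel (v : Cn -> R) (W : set Cn) (c : R) : open W ->
  (forall z, W z -> {for z, continuous v}) -> open (W `&` [set w | v w < c]).
Proof.
move=> oW cv; rewrite openE => z [Wz zc].
have [e1 e10 h1] := (nbhs_vnorm _ _).1 (open_nbhs_nbhs (conj oW Wz)).
have zc' : nbhs (v z) [set x | x < c] by exact: lt_nbhsl.
have [e2 e20 h2] := (nbhs_vnorm _ _).1 (cv z Wz _ zc').
apply/nbhs_vnorm; exists (Num.min e1 e2); first by rewrite lt_min e10.
by move=> w; rewrite lt_min => /andP[w1 w2]; split; [exact: h1|exact: h2].
Qed.

Lemma vball_open (p : Cn) r : open [set w : Cn | vnorm (w - p) < r].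
Proof.
rewrite openE => w wr; apply/nbhs_vnorm; exists (r - vnorm (w - p)); first by rewrite subr_gt0.
by move=> u; have := vnormD (u - w) (w - p); rewrite addrA subrK /=; lra.
Qed.

(** The polydisc containing the sublevel set would by itself give the exponent [\sum_j wt j];
    counting points on the lines of one direction [k] replaces [wt k] by a larger number. *)
Lemma sublevel_volume N (g : 'I_N -> Cn -> R[i]) (W : set Cn) (p : Cn) (kappa C : R) (wt : 'I_n -> R) i0 i1 :
  open W -> W p -> (forall l z, W z -> differentiable (g l) z) -> 0 < kappa -> 0 < C ->
  (forall j, 1 <= wt j) -> wt i1 = 1 -> (forall a b : nat, (0 < b)%N -> wt i0 * b%:R != a%:R) ->
  (forall w s, W w -> 0 <= s -> \sum_l cmod (g l w) ^+ 2 < expR (- (s / kappa)) ->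
    forall j, cmod (w 0 j - p 0 j) <= C * expR (- (wt j * s))) ->
  exists c1 C' (W' : set Cn), [/\ \sum_j wt j < c1, open W', W' p, W' `<=` W &
    forall s, 0 <= s -> (mu (cpre (W' `&` [set w | (\sum_l cmod (g l w) ^+ 2 < expR (- (s / kappa)))%R]))
      <= (C' * expR (- (2 * c1 * s)))%:E)%E].
Proof.
move=> oW Wp dg k0 C0 wt1 wti1 irr H.
have [r0 r00 hr0] := (nbhs_vnorm _ _).1 (open_nbhs_nbhs (conj oW Wp)).
pose r := Num.min (r0 / 3) 1; have rp : 0 < r by rewrite lt_min ltr01 divr_gt0.
have rr0 : r <= r0 / 3 by rewrite ge_min lexx.
have r1 : r <= 1 by rewrite ge_min lexx orbT.
have WL k w x : vnorm (w - p) < r -> cmod x <= 1 -> W (w + x *: (r%:C%C *: cdelta R k)).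
  move=> wr x1; apply: hr0; rewrite addrAC; apply: le_lt_trans (vnormD _ _) _.
  rewrite !vnormZ vnorm_delta cmodR mulr1 ger0_norm ?(ltW rp) //.
  have : cmod x * r <= 1 * r by rewrite ler_pM2r.
  lra.
have hg l := differentiable_holn (dg l).
have pr : vnorm (p - p) < r by rewrite subrr vnorm0.
have order k : exists i l, taylor_coef (fun x => g l (p + x *: (r%:C%C *: cdelta R k))) i != 0 /\
    2 * kappa * i%:R * wt k <= 1.
  apply: (@axis_order R N (fun l x => g l (p + x *: (r%:C%C *: cdelta R k))) kappa (wt k) r C) => //.
  - by move=> l; apply: (holn_line (hg l)) => x; exact: WL.
  - by apply: lt_le_trans (wt1 k).
  - move=> x s x1 s0 small; have := H _ s (WL k p x pr x1) s0 small k.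
    by rewrite !mxE !eqxx mulr1 [p 0 k + _]addrC addrK cmodM cmodR mulrC ger0_norm ?(ltW rp).
have [k [i [l [ci ik]]]] : exists k i l,
    taylor_coef (fun x => g l (p + x *: (r%:C%C *: cdelta R k))) i != 0 /\ 2 * kappa * i%:R * wt k < 1.
  have [a [l [ca ka]]] := order i0; have [b [l' [cb kb]]] := order i1.
  have [lta|gea] := ltP (2 * kappa * a%:R * wt i0) 1; first by exists i0, a, l.
  have [ltb|geb] := ltP (2 * kappa * b%:R * wt i1) 1; first by exists i1, b, l'.
  have ea : 2 * kappa * a%:R * wt i0 = 1 by apply/eqP; rewrite eq_le ka.
  have eb : 2 * kappa * b%:R * wt i1 = 1 by apply/eqP; rewrite eq_le kb.
  have a0 : (0 < a)%N by case: (a) ea => // ea; move: (@oner_neq0 R); rewrite -ea mulr0 mul0r eqxx.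
  (* Equality on both axes would make [wt i0] rational. *)
  case/eqP: (irr b a a0); apply: (@mulfI _ (2 * kappa)); first by rewrite mulf_neq0 ?gt_eqF.
  have -> : 2 * kappa * (wt i0 * a%:R) = 2 * kappa * a%:R * wt i0 by ring.
  by move: eb; rewrite wti1 mulr1 => ->; exact: ea.
(* Chosen so that [2 * kappa * i%:R * (wt k + del) < 1] still holds; the added 1 keeps the
   denominator positive when [i = 0]. *)
pose del := (1 - 2 * kappa * i%:R * wt k) / (2 * kappa * i%:R + 1).
have ki0 : 0 <= 2 * kappa * i%:R by apply: mulr_ge0 => //; apply: mulr_ge0 => //; exact: ltW.
have del0 : 0 < del by apply: divr_gt0; lra.
pose sigma := wt k + del.
have wtk := wt1 k.
have sigma0 : 0 < sigma by rewrite /sigma; lra.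
(* This makes [i%:R * sigma + theta] equal to [1 / (2 * kappa)], the rate at which [|g l|] is small
   on the sublevel set. *)
pose theta := (1 / (2 * kappa) - i%:R * sigma).
have theta0 : 0 < theta.
  rewrite /theta subr_gt0 ltr_pdivlMr ?mulr_gt0 //.
  have -> : i%:R * sigma * (2 * kappa) = 2 * kappa * i%:R * wt k + 2 * kappa * i%:R * del by rewrite /sigma; ring.
  have : 2 * kappa * i%:R * del < (2 * kappa * i%:R + 1) * del by rewrite ltr_pM2r //; lra.
  by rewrite [X in _ < X]mulrC /del divfK ?gt_eqF; lra.
have [d [s0 [d0 s00 hd]]] := line_points rp r1 theta0 sigma0 (dg l) (WL k) ci.
pose d' := Num.min d r; have d'0 : 0 < d' by rewrite lt_min d0.
pose W' := [set w : Cn | vnorm (w - p) < d'].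
have W'W : W' `<=` W.
  move=> w; rewrite /W' /= lt_min => /andP[_ wr]; apply: hr0; lra.
pose c1 := \sum_j wt j + del.
have oA s : open (W' `&` [set w | \sum_l cmod (g l w) ^+ 2 < expR (- (s / kappa))]).
  apply: open_sublevel; first exact: vball_open.
  move=> z /W'W Wz; apply: (@smooth_continuous R n W _ _ _ Wz); apply: smooth_sumsq.
  exact: hg.
pose V := \prod_(j < n) (2 * d') ^+ 2.
have V0 : 0 <= V by apply: prodr_ge0 => j _; exact: sqr_ge0.
have sub s : W' `&` [set w | \sum_l cmod (g l w) ^+ 2 < expR (- (s / kappa))] `<=` cbox p (fun=> d').
  move=> w [] + _ j => /ltW wd.
  have jd : cmod (w 0 j - p 0 j) <= d'.
    by apply: le_trans wd; have := cmod_le_vnorm (w - p) j; rewrite !mxE.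
  by split; apply: le_trans jd; [exact: cmod_ge_Re|exact: cmod_ge_Im].
pose V2 := i%:R * ((2 * (C + 2)) ^+ 2 * \prod_(j < n | j != k) (2 * C) ^+ 2).
have V20 : 0 <= V2.
  by apply: mulr_ge0 => //; apply: mulr_ge0; [exact: sqr_ge0|apply: prodr_ge0 => j _; exact: sqr_ge0].
have c10 : 0 < c1 by rewrite /c1 ltr_wpDl // sumr_ge0 // => j _; apply: le_trans (wt1 j).
exists c1, (V * expR (2 * c1 * s0) + V2), W'; split => //.
- by rewrite ltrDl.
- exact: vball_open.
- by rewrite /W' /= subrr vnorm0.
move=> s sge0; set A := (W' `&` _).
have mA : measurable (cpre A) by apply: open_measurable_cpre; exact: oA.
(* For bounded [s] a fixed box suffices, at the price of the constant [expR (2 * c1 * s0)]. *)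
have [ss0|s0s] := ltP s s0.
  apply: le_trans (_ : V%:E <= _)%E.
    rewrite -[V%:E](@vol_cbox R n p (fun=> d')); last by move=> _; exact: ltW.
    apply: le_measure; rewrite ?inE //; first exact: measurable_cbox.
    by move=> t; exact: sub.
  rewrite lee_fin mulrDl -[V * _ * _]mulrA -expRD; apply: ler_wpDr; first by apply: mulr_ge0 => //; exact: expR_ge0.
  rewrite ler_peMr // -expR0 ler_expR -mulrBr mulr_ge0 //; last by lra.
  by rewrite mulr_ge0 // ltW.
have hbox : A `<=` cbox p (fun j => C * expR (- (wt j * s))).
  move=> w [W'w ws] j; have jd := H w s (W'W _ W'w) sge0 ws j.
  by split; apply: le_trans jd; [exact: cmod_ge_Re|exact: cmod_ge_Im].
have e0 : 0 < expR (- sigma * s) by exact: expR_gt0.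
have e1 : expR (- sigma * s) <= 1.
  by rewrite -expR0 ler_expR mulNr oppr_le0 mulr_ge0 // ltW.
(* Packing at the spacing [exp (- sigma * s)] contributes the square of that spacing in direction
   [k]; the other directions keep the sides of the polydisc. *)
apply: le_trans (packing_upper mA _ e0 e1 hbox (N := i) (k := k) _) _.
- by move=> j; apply: mulr_ge0; [exact: ltW|exact: expR_ge0].
- move=> w xs hxs; apply: (hd s s0s w) => x /hxs [W'x small]; split.
    by move: W'x; rewrite /W' /= lt_min => /andP[].
  have s2 : cmod (g l (w + x *: cdelta R k)) ^+ 2 < expR (- (i%:R * sigma + theta) * s) ^+ 2.
    have -> : expR (- (i%:R * sigma + theta) * s) ^+ 2 = expR (- (s / kappa)).
      rewrite -expRM_natl; congr expR; rewrite /theta; field; exact: lt0r_neq0.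
    apply: le_lt_trans small; rewrite (bigD1 l) //= lerDl.
    by apply: sumr_ge0 => j _; exact: sqr_ge0.
  by move: s2; rewrite ltr_pXn2r ?nnegrE ?cmod_ge0 ?expR_ge0 //; exact: ltW.
rewrite lee_fin.
have -> : expR (- (2 * c1 * s)) = expR (- sigma * s) ^+ 2 * \prod_(j < n | j != k) expR (- (wt j * s)) ^+ 2.
  rewrite prodrXl -exprMn -expR_sum -expRD -expRM_natl; congr expR.
  rewrite sumrN -mulr_suml /c1 (bigD1 k) //= /sigma; ring.
have P0 : 0 <= \prod_(j < n | j != k) expR (- (wt j * s)) ^+ 2 by apply: prodr_ge0 => j _; exact: sqr_ge0.
rewrite [leRHS]mulrDl; apply: ler_wpDl.
  by apply: mulr_ge0; [apply: mulr_ge0 => //; exact: expR_ge0|apply: mulr_ge0 => //; exact: sqr_ge0].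
have -> : \prod_(j < n | j != k) (2 * (C * expR (- (wt j * s)))) ^+ 2 =
    \prod_(j < n | j != k) (2 * C) ^+ 2 * \prod_(j < n | j != k) expR (- (wt j * s)) ^+ 2.
  by rewrite -big_split; apply: eq_bigr => j _; rewrite mulrA exprMn.
have k3 : (2 * (C * expR (- (wt k * s)) + 2)) ^+ 2 <= (2 * (C + 2)) ^+ 2.
  have k1 : expR (- (wt k * s)) <= 1.
    by rewrite -expR0 ler_expR oppr_le0 mulr_ge0 //; lra.
  have k2 : 0 <= C * expR (- (wt k * s)) by apply: mulr_ge0; [exact: ltW|exact: expR_ge0].
  have k3 : C * expR (- (wt k * s)) <= C by rewrite ger_pMr.
  by rewrite lerXn2r ?nnegrE; lra.
rewrite /V2; move: k3 P0; set E := expR (- sigma * s) ^+ 2.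
have E0 : 0 <= E by exact: sqr_ge0.
have D0 : 0 <= \prod_(j < n | j != k) (2 * C) ^+ 2 by apply: prodr_ge0 => j _; exact: sqr_ge0.
move: (\prod_(j < n | j != k) (2 * C) ^+ 2) (\prod_(j < n | j != k) expR (- (wt j * s)) ^+ 2) D0 => D P D0 k3 P0.
have -> : i%:R * ((2 * (C + 2)) ^+ 2 * D) * (E * P) = i%:R * E * ((2 * (C + 2)) ^+ 2 * (D * P)) by ring.
by apply: ler_wpM2l; [exact: mulr_ge0|apply: ler_wpM2r => //; exact: mulr_ge0].
Qed.

End sublevel_volume.

(** * Integrability from the volumes of layers *)

Section layers.
Context d (T : measurableType d) (R : realType) (mu : {measure set T -> \bar R}).

Lemma geometric_sum_le (q : R) m : 0 <= q -> q < 1 -> \sum_(0 <= k < m) q ^+ k <= (1 - q)^-1.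
Proof.
move=> q0 q1; have q1' : 0 < 1 - q by rewrite subr_gt0.
rewrite big_mkord -[leRHS]mul1r ler_pdivlMr // mulrC.
have := subrX1 q m; have : 0 <= q ^+ m by exact: exprn_ge0.
by move: (\sum_(i < m) q ^+ i) (q ^+ m) => u v v0 e; lra.
Qed.

(** [h] is dominated by [Q * (1 + \sum_k b ^+ k * \1_(A k))], whose integral is controlled by a
    geometric series of ratio [a * b]. The third alternative admits points where [h] is infinite: as
    [b >= 1], the series diverges there as well. *)
Lemma integrable_layers (D : set T) (h : T -> \bar R) (A : nat -> set T) (C a b Q : R) :
  measurable D -> (mu D < +oo)%E -> measurable_fun D h -> (forall x, D x -> 0 <= h x)%E ->
  (forall k, measurable (A k)) -> (forall k, mu (A k) <= (C * a ^+ k)%:E)%E ->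
  0 <= C -> 0 < Q -> 0 <= a -> 1 <= b -> a * b < 1 ->
  (forall x, D x -> [\/ h x <= Q%:E, exists k, A k x /\ h x <= (Q * b ^+ k)%:E | forall k, A k x]%E) ->
  mu.-integrable D h.
Proof.
move=> mD Dfin mh h0 mA hA C0 Q0 a0 b1 ab H.
have b0 : 0 <= b by lra.
have Q0' : 0 <= Q by exact: ltW.
pose s k x : \bar R := ((b ^+ k)%:E * (\1_(A k) x)%:E)%E.
have s0 k x : (0 <= s k x)%E by rewrite /s -EFinM lee_fin mulr_ge0 // exprn_ge0.
have ms k : measurable_fun D (s k).
  by apply: measurable_funeM; apply/measurable_EFinP; exact: measurable_indic.
pose S x := (\sum_(0 <= k <oo) s k x)%E.
have S0 x : (0 <= S x)%E by exact: nneseries_ge0.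
have mS : measurable_fun D S by apply: ge0_emeasurable_sum => // k x _ _; exact: s0.
have s1 k x : A k x -> s k x = (b ^+ k)%:E by move=> Ax; rewrite /s indicE mem_set // mule1.
have partial m x : ((\sum_(0 <= k < m) s k x)%R <= S x)%E by exact: nneseries_lim_ge.
have hF x : D x -> (h x <= Q%:E * (1 + S x))%E.
  move=> Dx; have Q1 : (Q%:E <= Q%:E * (1 + S x))%E.
    by rewrite -{1}[Q%:E]mule1; apply: lee_pmul => //; rewrite leeDl.
  case: (H x Dx) => [hQ|[k [Ax hk]]|Ax].
  - exact: le_trans Q1.
  - apply: le_trans hk _; rewrite EFinM; apply: lee_pmul => //; first by rewrite lee_fin exprn_ge0.
    apply: le_trans (_ : S x <= _)%E; last by rewrite leeDr.
    apply: le_trans (partial k.+1 x); rewrite big_nat_recr //= s1 // leeDr //.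
    by apply: sume_ge0 => j _.
  - have Soo : S x = +oo%E.
      apply/eqyP => B B0; have [m _ Bm] : exists2 m : nat, true & B <= m%:R.
        by exists (Num.truncn B).+1 => //; have /andP[_ /ltW] := truncn_itv (ltW B0).
      apply: le_trans (partial m x); apply: le_trans (_ : m%:R%:E <= _)%E; first by rewrite lee_fin.
      have -> : m%:R%:E = (\sum_(0 <= k < m) (1 : \bar R))%E :> \bar R.
        by rewrite big_mkord sumEFin sumr_const card_ord.
      by apply: lee_sum => k _; rewrite s1 // lee_fin; exact: exprn_ege1.
    by rewrite Soo addey // gt0_muley ?lte_fin // leey.
have IS : (\int[mu]_(x in D) S x < +oo)%E.
  rewrite integral_nneseries //; apply: le_lt_trans (ltry (C * (1 - a * b)^-1)).
  apply: lime_le; first by apply: is_cvg_nneseries => k _ _; apply: integral_ge0 => x _.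
  apply: nearW => m; apply: le_trans (_ : (\sum_(0 <= k < m) (C * (a * b) ^+ k)%:E)%R <= _)%E.
    apply: lee_sum => k _; rewrite /s.
    rewrite ge0_integralZl ?lee_fin ?exprn_ge0 //; last first.
      by apply/measurable_EFinP; exact: measurable_indic.
    rewrite integral_indic // exprMn [X in (_ <= X%:E)%E](_ : _ = b ^+ k * (C * a ^+ k)); last by ring.
    rewrite EFinM lee_pmul // ?lee_fin ?exprn_ge0 //; apply: le_trans (hA k).
    by apply: le_measure; rewrite ?inE //; exact: measurableI.
  rewrite sumEFin lee_fin -mulr_sumr; apply: ler_wpM2l => //; apply: geometric_sum_le => //.
  exact: mulr_ge0.
apply/integrableP; split => //.
apply: le_lt_trans (_ : \int[mu]_(x in D) (Q%:E * (1 + S x)) < +oo)%E.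
  apply: ge0_le_integral => //.
  - exact: measurableT_comp.
  - by apply: measurable_funeM; apply: emeasurable_funD.
  - by move=> x Dx; rewrite gee0_abs ?h0 // hF.
rewrite ge0_integralZl // ?lee_fin //; first last.
- by move=> x _; rewrite adde_ge0.
- by apply: emeasurable_funD.
rewrite ge0_integralD // integral_cst // mul1e.
by apply: lte_mul_pinfty => //; exact: lte_add_pinfty.
Qed.

(** The integral would be at least [c ^+ 2 * expR ((b - a) * s)] for all large [s]. *)
Lemma not_integrable_layers (D : set T) (h : T -> \bar R) (A : R -> set T) (c K a b : R) :
  measurable D -> (forall x, D x -> 0 <= h x)%E -> 0 < c -> a < b ->
  (forall s, K <= s -> [/\ measurable (A s), A s `<=` D, ((expR (- (a * s)) * c)%:E <= mu (A s))%E &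
     forall x, A s x -> ((c * expR (b * s))%:E <= h x)%E]) ->
  ~ mu.-integrable D h.
Proof.
move=> mD h0 c0 ab H ih.
have ifin : (\int[mu]_(x in D) h x \is a fin_num)%E by exact: integrable_fin_num.
have mh := measurable_int _ ih.
set I := fine (\int[mu]_(x in D) h x)%E.
pose s := Num.max K (I / (c * c) / (b - a)).
have sK : K <= s by rewrite le_max lexx.
have [mA AD vA hA] := H s sK.
have : ((c * expR (b * s))%:E * mu (A s) <= I%:E)%E.
  rewrite fineK // -integral_cst //.
  apply: le_trans (_ : \int[mu]_(x in A s) h x <= _)%E.
    apply: ge0_le_integral => //.
    - by move=> x _; rewrite lee_fin mulr_ge0 ?expR_ge0 // ltW.
    - by apply: measurable_funS mh.
  by apply: ge0_subset_integral.
apply/negP; rewrite -ltNge; apply: lt_le_trans (_ : ((c * expR (b * s))%:E * (expR (- (a * s)) * c)%:E <= _)%E); last first.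
  by apply: lee_pmul => //; rewrite lee_fin !mulr_ge0 ?expR_ge0 ?ltW.
rewrite -EFinM lte_fin.
have -> : c * expR (b * s) * (expR (- (a * s)) * c) = expR ((b - a) * s) * (c * c).
  by rewrite mulrBl expRD; ring.
rewrite -ltr_pdivrMr ?mulr_gt0 //; have := expR_ge1Dx ((b - a) * s).
have : I / (c * c) <= (b - a) * s.
  by rewrite [leRHS]mulrC -ler_pdivrMr ?subr_gt0 // le_max lexx orbT.
lra.
Qed.

End layers.

(** * Singularity exponents *)

Section charts.
Variables (R : realType) (n : nat) (T : topologicalType).
Local Notation Cn := 'rV[R[i]]_n.

Lemma chart_image (e : chart R n T) (V : set T) y :
  (coord e @` (V `&` dom e)) y <-> (coord e @` dom e) y /\ V (icoord e y).
Proof.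
split=> [[x [Vx ex] <-]|[[x ex <-]]]; first by split; [exists x|rewrite chartK].
by rewrite chartK // => Vx; exists x.
Qed.

Lemma chart_image_open (e : chart R n T) (V : set T) : open V -> open (coord e @` (V `&` dom e)).
Proof.
move=> oV; rewrite openE => y /chart_image[ey Vy]; apply/nbhs_vnorm.
have [e1 e10 h1] := (nbhs_vnorm _ _).1 (open_nbhs_nbhs (conj (@chart_open_img _ _ _ e) ey)).
have [e2 e20 h2] := (nbhs_vnorm _ _).1 (@chart_icontinuous _ _ _ e y ey _ (open_nbhs_nbhs (conj oV Vy))).
exists (Num.min e1 e2); first by rewrite lt_min e10.
move=> w; rewrite lt_min => /andP[w1 w2]; apply/chart_image; split; [exact: h1|exact: h2].
Qed.

End charts.

(** * Upper bound of an exponent, in an arbitrary chart *)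

Section exponent_upper.
Variables (R : realType) (n : nat) (M : complexManifold R n) (z0 : M).
Local Notation Cn := 'rV[R[i]]_n.
Local Notation mu := (lebesgue_tuple R (n + n)).

Lemma finite_second_order (F : Cn -> Cn) (W : set Cn) q : open W -> W q ->
  (forall z, W z -> differentiable F z) ->
  exists r C (L : 'I_n -> Cn -> R[i]), [/\ 0 < r, 0 <= C,
    forall j u v, L j (u + v) = L j u + L j v, forall j (k : R[i]) u, L j (k *: u) = k * L j u &
    forall w, vnorm w <= r -> W (q + w) /\ forall j,
      cmod (F (q + w) 0 j - F q 0 j - L j w) <= C * vnorm w ^+ 2].
Proof.
move=> oW Wq dF.
have /choice[r /choice[C h]] j : exists r C, [/\ 0 < r, 0 <= C & forall w, vnorm w <= r -> W (q + w) /\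
    cmod (F (q + w) 0 j - F q 0 j - 'd (fun z => F z 0 j : R[i]) q w) <= C * vnorm w ^+ 2].
  have [z Wz|r [C [r0 C0 h]]] := @second_order R n W (fun z => F z 0 j) q oW Wq.
    by apply: (@differentiable_rV_coord R n _ F z j); exact: dF.
  by exists r, C.
have [r0 r00 hr0] := (nbhs_vnorm _ _).1 (open_nbhs_nbhs (conj oW Wq)).
have rr0 : 0 < r0 / 2 by rewrite divr_gt0.
exists (\big[Num.min/r0 / 2]_j r j), (\sum_j C j), (fun j w => 'd (fun z => F z 0 j : R[i]) q w); split.
- by apply: lt_bigmin => // j _; have [] := h j.
- by apply: sumr_ge0 => j _; have [] := h j.
- by move=> j u v; exact: linearD.
- by move=> j k u; rewrite linearZ.
move=> w wr; split=> [|j].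
  apply: hr0; rewrite addrC addKr; apply: le_lt_trans wr _; apply: le_lt_trans (bigmin_le_id _ _ _ _) _; lra.
have [_ C0 hj] := h j; have [|_ hw] := hj w; first by apply: le_trans wr _; exact: bigmin_le_cond.
apply: le_trans hw _; apply: ler_wpM2r; first exact: sqr_ge0.
by rewrite (bigD1 j) //= lerDl; apply: sumr_ge0 => k _; have [] := h k.
Qed.

Lemma one_germ : holomorphic_germs z0 (fun=> 1 : R[i]).
Proof.
exists setT => //; split; first exact: openT.
by move=> e _ y _; exact: differentiable_cst.
Qed.

Lemma expR_small (d s : R) : 0 < d -> - ln d <= s -> expR (- s) <= d.
Proof. by move=> d0 ds; rewrite -[leRHS]lnK ?posrE // ler_expR lerNl. Qed.

(** The constant 1 has to be integrable against the weight in some chart [e], not necessarily [e0].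
    There, the points closer than [exp (- s)] to the centre at which the linear part of coordinate
    [i0] is below [exp (- wt i0 * s)] fill a volume of order at least [exp (- 2 (\sum_j wt j) s)],
    and the transition map sends them into the polydisc of [hphi] up to the factor [K]. *)
Lemma exponent_upper (e0 : chart R n M) (phi : M -> \bar R) (wt : 'I_n -> R) i0 (C r c : R) :
  atlas e0 -> dom e0 z0 -> 0 < r -> 1 <= wt i0 -> wt i0 <= 2 -> (forall j, j != i0 -> wt j = 1) ->
  (forall x s, dom e0 x -> vnorm (coord e0 x - coord e0 z0) < r -> 
     (forall j, cmod (coord e0 x 0 j - coord e0 z0 0 j) <= expR (- (wt j * s))) ->
     (phi x <= (C - s)%:E)%E) ->
  0 <= c -> multiplier_ideal (fun z => c%:E * phi z)%E z0 = holomorphic_germs z0 ->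
  c <= \sum_j wt j.
Proof.
move=> ae0 e0z r0 wt1 wt2 wtE hphi c0 mE.
rewrite leNgt; apply/negP => cw.
have : multiplier_ideal (fun z => c%:E * phi z)%E z0 (fun=> 1 : R[i]) by rewrite mE; exact: one_germ.
move=> [_ [e [W [[ae ez oW Wq WD]]]]].
set q := coord e z0 in Wq *; pose p := coord e0 z0.
pose F w := coord e0 (icoord e w).
pose W1 := W `&` coord e @` (dom e0 `&` dom e).
have oW1 : open W1 by apply: openI => //; apply: chart_image_open; exact: chart_open_dom.
have W1q : W1 q by split => //; exists z0.
have Fq : F q = p by rewrite /F chartK.
have dF z : W1 z -> differentiable F z.
  move=> [_ Wz]; apply: (@cm_holomorphic _ _ M e e0) => //.
  by move: Wz; rewrite setIC.
have [r1 [C1 [L [r10 C10 LD LZ h1]]]] := finite_second_order oW1 W1q dF.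
have LB j u v : L j (u - v) = L j u - L j v by rewrite LD -scaleN1r LZ mulN1r.
have /choice[B hB] j : exists B, 0 < B /\ forall w, cmod (L j w) <= B * vnorm w.
  by have [B B0 hB] := linear_vnorm (LD j) (LZ j); exists B.
have [B00 hB0] := hB i0.
have [c1 c10 vol] := pigeonhole_lower (LB i0) B00 hB0.
pose K := 1 + C1 + \sum_j B j.
have SB0 : 0 <= \sum_j B j by apply: sumr_ge0 => j _; apply: ltW; have [] := hB j.
have K1 : 1 <= K by rewrite /K; lra.
have K0 : 0 < K by lra.
have BK j : B j + C1 <= K.
  have : B j <= \sum_j B j.
    by rewrite [leRHS](bigD1 j) //= lerDl; apply: sumr_ge0 => k _; apply: ltW; have [] := hB k.
  rewrite /K; lra.
(* Below this scale the expansion is valid and the image stays in the ball of radius [r] where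
   [hphi] applies. *)
pose dl := Num.min r1 (r / (2 * (n%:R * K + 1))).
have nK : 0 < n%:R * K + 1 by rewrite ltr_wpDl // mulr_ge0 // ltW.
have dl0 : 0 < dl by rewrite lt_min r10 divr_gt0 // mulr_gt0.
pose S s := [set w : Cn | vnorm w < expR (- s) /\ cmod (L i0 w) < expR (- s) * expR (- ((wt i0 - 1) * s))].
pose A s := cpre [set w | S s (w + - q)].
have key s w : Num.max 0 (- ln dl) <= s -> S s (w - q) ->
    W1 w /\ (phi (icoord e w) <= (C - (s - ln K))%:E)%E.
  rewrite ge_max => /andP[s0 sd] [w1 w2].
  have ed := expR_small dl0 sd.
  have e1 : expR (- s) <= 1 by rewrite -expR0 ler_expR oppr_le0.
  have wdl : vnorm (w - q) <= dl by apply: le_trans (ltW w1) ed.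
  have wr1 : vnorm (w - q) <= r1 by apply: le_trans wdl _; rewrite ge_min lexx.
  have [W1w h2] := h1 _ wr1; rewrite addrC subrK Fq in W1w h2.
  split=> //.
  have v0 := vnorm_ge0 (w - q).
  have Fj j : cmod (F w 0 j - p 0 j) <= K * expR (- (wt j * s)).
    have h3 := h2 j.
    have h4 : cmod (F w 0 j - p 0 j) <= C1 * vnorm (w - q) ^+ 2 + cmod (L j (w - q)).
      have := cmodD (F w 0 j - p 0 j - L j (w - q)) (L j (w - q)); rewrite subrK; lra.
    have [ji|ji] := eqVneq j i0.
      rewrite ji in h4 *; apply: le_trans h4 _; apply: le_trans (_ : (1 + C1) * expR (- (wt i0 * s)) <= _); last first.
        by apply: ler_wpM2r; [exact: expR_ge0|rewrite /K; lra].
      (* This is where [wt i0 <= 2] enters: the quadratic error, of size [exp (- 2 s)], is absorbed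
         by the required decay. *)
      have h5 : vnorm (w - q) ^+ 2 <= expR (- (wt i0 * s)).
        apply: le_trans (_ : expR (- s) ^+ 2 <= _).
          by rewrite lerXn2r ?nnegrE ?expR_ge0 // ltW.
        by rewrite -expRM_natl ler_expR mulrN lerN2 ler_wpM2r.
      have h6 : expR (- s) * expR (- ((wt i0 - 1) * s)) = expR (- (wt i0 * s)).
        by rewrite -expRD; congr expR; ring.
      rewrite h6 in w2; have := ler_wpM2l C10 h5; lra.
    rewrite wtE // mul1r; apply: le_trans h4 _.
    have h5 : cmod (L j (w - q)) <= B j * expR (- s).
      apply: le_trans ((hB j).2 _) _; apply: ler_wpM2l; [exact: ltW (hB j).1|exact: ltW].
    have h6 : C1 * vnorm (w - q) ^+ 2 <= C1 * expR (- s).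
      apply: ler_wpM2l => //; apply: le_trans (ltW w1); rewrite expr2 ler_piMl //; lra.
    apply: le_trans (_ : (B j + C1) * expR (- s) <= _); last by apply: ler_wpM2r; [exact: expR_ge0|].
    lra.
  have sl : forall j, cmod (F w 0 j - p 0 j) <= expR (- s) * K.
    move=> j; apply: le_trans (Fj j) _; rewrite [leRHS]mulrC ler_pM2l // ler_expR lerN2.
    have [->|ji] := eqVneq j i0; first by rewrite ler_peMl.
    by rewrite wtE // mul1r.
  have [x [ex0 ex] xw] := W1w.2; have xE : icoord e w = x by rewrite -xw chartK.
  apply: hphi.
  - by rewrite xE.
  - apply: le_lt_trans (_ : n%:R * (expR (- s) * K) < _).
      by apply: vnorm_le => j; rewrite !mxE; exact: sl.
    have e2 : expR (- s) <= r / (2 * (n%:R * K + 1)) by apply: le_trans ed _; rewrite ge_min lexx orbT.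
    rewrite ler_pdivlMr ?mulr_gt0 // in e2.
    have -> : n%:R * (expR (- s) * K) = expR (- s) * (n%:R * K) by ring.
    have := expR_gt0 (- s); move: e2; move: (n%:R * K) (expR (- s)) => u v; lra.
  (* The factor [K] is traded for a shift of [s] by [ln K], which is enough in every coordinate
     because all weights are at least 1. *)
  - move=> j; apply: le_trans (Fj j) _.
    rewrite -{1}(@lnK R K) ?posrE // -expRD ler_expR.
    have lnK0 : 0 <= ln K by exact: ln_ge0.
    have wj : 1 <= wt j by have [->//|ji] := eqVneq j i0; rewrite wtE.
    have : ln K <= wt j * ln K by rewrite ler_peMl.
    lra.
(* The rates are [2 * \sum_j wt j] for the decay of the volume and [2 * c] for the growth of the
   integrand; the assumption [cw] makes the second one larger. *)
apply: (@not_integrable_layers _ _ R mu (cpre W) _ A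
  (Num.min c1 (expR (- (2 * c * (C + ln K))))) (Num.max 0 (- ln dl)) (2 * \sum_j wt j) (2 * c)).
- exact: open_measurable_cpre.
- by move=> x _; apply: mule_ge0; rewrite ?lee_fin ?exprn_ge0 ?cmod_ge0 ?expeR_ge0.
- by rewrite lt_min c10 expR_gt0.
- by rewrite ltr_pM2l.
move=> s sK.
have oS : open (S s).
  exact: open_slab (LB i0) B00 hB0.
have mA : measurable (cpre (S s)) by exact: open_measurable_cpre.
split.
- exact: measurable_cpre_shift.
- by move=> t /(key _ _ sK)[[]].
- have vA := vol_shift (- q) mA.
  apply: le_trans (_ : mu (cpre (S s)) <= _)%E; last by rewrite -vA.
  apply: le_trans (vol _ _ (expR_gt0 _) (expR_gt0 _) _); last first.
    rewrite -[leRHS]expR0 ler_expR oppr_le0 mulr_ge0 //; first by lra.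
    by move: sK; rewrite ge_max => /andP[].
  rewrite lee_fin [leLHS]mulrC -[leRHS]mulrA.
  have -> : (expR (- s) ^+ 2) ^+ n * expR (- ((wt i0 - 1) * s)) ^+ 2 = expR (- (2 * (\sum_j wt j) * s)).
    rewrite -!expRM_natl -expRD; congr expR.
    have -> : \sum_j wt j = wt i0 + (n%:R - 1).
      rewrite (bigD1 i0) //=; congr (_ + _); rewrite (eq_bigr (fun=> 1)) //.
      by rewrite sumr_const cardC1 card_ord -subn1 natrB //; exact: leq_ltn_trans (ltn_ord i0).
    ring.
  by apply: ler_wpM2r; [exact: expR_ge0|rewrite ge_min lexx].
- move=> t /(key _ _ sK)[_ hx]; rewrite cmod1 expr1n mul1e.
  apply: le_trans (_ : (expR (2 * c * (s - ln K - C)))%:E <= _)%E.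
    rewrite lee_fin; apply: le_trans (_ : expR (- (2 * c * (C + ln K))) * expR (2 * c * s) <= _).
      by apply: ler_wpM2r; [exact: expR_ge0|rewrite ge_min lexx orbT].
    by rewrite -expRD ler_expR; lra.
  rewrite -/(expeR (2 * c * (s - ln K - C))%:E) lee_expeR.
  have h1' : (2%:E * (c%:E * phi (icoord e (cvec t))) <= (2 * (c * (C - (s - ln K))))%:E)%E.
    by rewrite !EFinM; apply: lee_wpmul2l; rewrite ?lee_fin //; apply: lee_wpmul2l; rewrite ?lee_fin.
  rewrite leeNr; apply: le_trans h1' _; rewrite -EFinN lee_fin; lra.
Qed.
End exponent_upper.

Section measurability.
Variables (R : realType) (n : nat).
Local Notation Cn := 'rV[R[i]]_n.

Lemma measurable_expeR : measurable_fun setT (@expeR R).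
Proof.
apply: (measurability _ (ErealGenCInfty.measurableE R)) => _ [_ [r ->] <-]; rewrite setTI.
have [r0|r0] := leP r 0.
  rewrite (_ : _ @^-1` _ = setT) //; apply/seteqP; split => // x _ /=.
  by rewrite in_itv /= andbT (le_trans _ (expeR_ge0 x)) // lee_fin.
rewrite (_ : _ @^-1` _ = `[(ln r)%:E, +oo[%classic); first exact: emeasurable_itv.
apply/seteqP; split => x; rewrite /= !in_itv /= !andbT.
  by rewrite -{1}(@lnK R r) ?posrE // -/(expeR (ln r)%:E) lee_expeR.
by rewrite -{2}(@lnK R r) ?posrE // -/(expeR (ln r)%:E) lee_expeR.
Qed.

Lemma usc_measurable (W : set Cn) (u : Cn -> \bar R) : open W ->
  (forall z, W z -> forall a : R, (u z < a%:E)%E ->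
    exists2 d, 0 < d & forall w, vnorm (w - z) < d -> (u w < a%:E)%E) ->
  measurable_fun (cpre W) (fun t => u (cvec t)).
Proof.
move=> oW usc; apply: (measurability _ (ErealGenCInfty.measurableE R)) => _ [_ [r ->] <-].
have -> : cpre W `&` (fun t => u (cvec t)) @^-1` `[r%:E, +oo[%classic =
    cpre W `\` cpre (W `&` [set w | (u w < r%:E)%E]).
  apply/seteqP; split => t; rewrite /cpre /= in_itv /= andbT => -[Wt].
    by rewrite leNgt => /negP h; split=> // -[].
  by move=> h; split=> //; rewrite leNgt; apply/negP => k; apply: h.
apply: measurableD; first exact: open_measurable_cpre.
apply: open_measurable_cpre; rewrite openE => z [Wz zr]; apply/nbhs_vnorm.
have [e1 e10 h1] := (nbhs_vnorm _ _).1 (open_nbhs_nbhs (conj oW Wz)).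
have [d d0 hd] := usc z Wz r zr.
exists (Num.min e1 d); first by rewrite lt_min e10.
by move=> w; rewrite lt_min => /andP[w1 w2]; split; [exact: h1|exact: hd].
Qed.

Lemma vcat_measurable (W : set Cn) (f : Cn -> R[i]) : open W -> (forall z, W z -> vcat f z) ->
  measurable_fun (cpre W) (fun t => (cmod (f (cvec t)) ^+ 2)%:E).
Proof.
move=> oW cf; apply: (@usc_measurable W (fun w => (cmod (f w) ^+ 2)%:E)) => // z Wz a.
rewrite lte_fin => za; have m0 := cmod_ge0 (f z).
have sa : cmod (f z) < Num.sqrt a.
  by rewrite -(@ltr_pXn2r _ 2) ?nnegrE ?sqrtr_ge0 // sqr_sqrtr // ltW // (le_lt_trans _ za) // sqr_ge0.
have [d d0 hd] := cf z Wz (Num.sqrt a - cmod (f z)) ltac:(lra).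
exists d => // w /hd h; rewrite lte_fin.
have a0 : 0 <= a by apply: ltW; apply: le_lt_trans za; exact: sqr_ge0.
rewrite -[ltRHS]sqr_sqrtr // ltr_pXn2r ?nnegrE ?cmod_ge0 ?sqrtr_ge0 //.
by have := cmod_revB (f w) (f z); lra.
Qed.

End measurability.

(** * Lower bound of an exponent, in the chosen chart *)

Section exponent_lower.
Variables (R : realType) (n : nat) (M : complexManifold R n) (z0 : M).
Local Notation Cn := 'rV[R[i]]_n.
Local Notation mu := (lebesgue_tuple R (n + n)).
Variable e0 : chart R n M.
Hypotheses (ae0 : atlas e0) (e0z : dom e0 z0).
Let p := coord e0 z0.

Lemma chart_near (P : M -> Prop) : (\forall z \near z0, P z) ->
  exists2 r, 0 < r & forall w, vnorm (w - p) < r -> (coord e0 @` dom e0) w /\ P (icoord e0 w).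
Proof.
move=> nP; have pe : (coord e0 @` dom e0) p by exists z0.
have [e1 e10 h1] := (nbhs_vnorm _ _).1 (open_nbhs_nbhs (conj (@chart_open_img _ _ _ e0) pe)).
have nP' : nbhs (icoord e0 p) P by rewrite /p chartK.
have [e2 e20 h2] := (nbhs_vnorm _ _).1 (@chart_icontinuous _ _ _ e0 p pe _ nP').
exists (Num.min e1 e2); first by rewrite lt_min e10.
by move=> w; rewrite lt_min => /andP[w1 w2]; split; [exact: h1|exact: h2].
Qed.

Lemma germ_differentiable (f : M -> R[i]) : holomorphic_germs z0 f ->
  \forall z \near z0, dom e0 z -> differentiable (f \o icoord e0) (coord e0 z).
Proof.
move=> [V Vz [oV hf]]; apply: filterS (open_nbhs_nbhs (conj oV Vz)) => z Vz' ez.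
by apply: (hf e0 ae0); exists z.
Qed.

Lemma germ_vball (f : M -> R[i]) : holomorphic_germs z0 f ->
  exists2 r, 0 < r & forall w, vnorm (w - p) < r -> differentiable (f \o icoord e0) w.
Proof.
move=> /germ_differentiable /chart_near[r r0 hr]; exists r => // w /hr[[x ex <-]].
by rewrite chartK // => /(_ ex).
Qed.

(** A germ is bounded near the point, so only the weight matters: at the points assigned to the
    layer [A k] it is at most of order [exp (2 c k)], against a volume at most of order
    [exp (- 2 c1 k)]. *)
Lemma integrable_weight (V : set M) (u : M -> \bar R) (W : set Cn) (A : nat -> set Cn) (C K c c1 : R) :
  V z0 -> psh_on V u -> open W -> W p -> W `<=` coord e0 @` (V `&` dom e0) ->
  (forall k, measurable (cpre (A k))) -> 0 <= C -> 0 <= c -> c < c1 ->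
  (forall k, (mu (cpre (A k)) <= (C * expR (- (2 * c1)) ^+ k)%:E)%E) ->
  (forall w, W w -> [\/ (- K)%:E <= u (icoord e0 w),
     exists k, A k w /\ (- (k%:R + K))%:E <= u (icoord e0 w) | forall k, A k w]%E) ->
  multiplier_ideal (fun z => c%:E * u z)%E z0 = holomorphic_germs z0.
Proof.
move=> Vz [oV uoo usc _ _] oW Wp WV mA C0 c0 cc1 hA hW.
apply/seteqP; split=> f; first by case.
move=> hf; split=> //; have [r r0 hr] := germ_vball hf.
have [r1 r10 hr1] := (nbhs_vnorm _ _).1 (open_nbhs_nbhs (conj oW Wp)).
have cf w : vnorm (w - p) < r -> vcat (f \o icoord e0) w.
  by move=> /hr df; apply/continuous_vcat; exact: differentiable_continuous.
have pp : vnorm (p - p) < r by rewrite subrr vnorm0.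
have [r2 r20 hr2] := vcat_local_bound (@vball_open R n p r) pp (cf p pp).
set B := cmod _ + 1 in hr2.
pose rho := Num.min (Num.min r1 1) r2.
have rho0 : 0 < rho by rewrite !lt_min r10 ltr01.
pose W' := [set w : Cn | vnorm (w - p) < rho].
have W'E w : W' w -> [/\ W w, vnorm (w - p) < r, cmod (f (icoord e0 w)) <= B & vnorm (w - p) <= 1].
  rewrite /W' /= !lt_min => /andP[/andP[w1 w2] w3]; have [w4 w5] := hr2 _ w3.
  by split=> //; [exact: hr1|exact: ltW].
have oW' : open W' by exact: vball_open.
exists e0, W'; split.
  by split=> //; [rewrite /W' /= subrr vnorm0|move=> w /W'E[/WV [x [_ ex] <-] _ _ _]; exists x].
have cexp x : (0 <= expeR x)%E by exact: expeR_ge0.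
have mW' : measurable (cpre W') by exact: open_measurable_cpre.
pose Q := (B ^+ 2 + 1) * expR (2 * c * K).
have Q0 : 0 < Q by rewrite mulr_gt0 ?expR_gt0 // ltr_wpDl // sqr_ge0.
apply: (@integrable_layers _ _ R mu (cpre W') _ (fun k => cpre (A k)) C (expR (- (2 * c1))) (expR (2 * c)) Q) => //.
- apply: le_lt_trans (_ : mu (cpre (cbox p (fun=> 1%R))) < +oo)%E; last by rewrite vol_cbox ?ltry.
  apply: le_measure; rewrite ?inE //; first exact: measurable_cbox.
  move=> t /W'E[_ _ _ wd] j.
  have jd : cmod (cvec t 0 j - p 0 j) <= 1.
    by apply: le_trans wd; have := cmod_le_vnorm (cvec t - p) j; rewrite !mxE.
  by split; apply: le_trans jd; [exact: cmod_ge_Re|exact: cmod_ge_Im].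
- apply: emeasurable_funM.
    by apply: (@vcat_measurable _ _ W' (f \o icoord e0)) => // z /W'E[_ zr _ _]; exact: cf.
  have mu' : measurable_fun (cpre W') (fun t => u (icoord e0 (cvec t))).
    apply: (@usc_measurable _ _ W' (fun w => u (icoord e0 w))) => // z /W'E[/WV /chart_image[ez Vz'] _ _ _] a za.
    apply/(nbhs_vnorm _ _).1.
    exact: (@chart_icontinuous _ _ _ e0 z ez _ (usc _ Vz' a za)).
  have mu2 : measurable_fun (cpre W') (fun t => (2%:E * (c%:E * u (icoord e0 (cvec t))))%E).
    by do 2 apply: measurable_funeM.
  have mu3 := measurableT_comp (@oppe_measurable R setT) mu2.
  have mu4 := measurableT_comp (@measurable_expeR R) mu3.
  exact: mu4.
- by move=> t _; apply: mule_ge0 => //; rewrite lee_fin sqr_ge0.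
- by rewrite -[leLHS]expR0 ler_expR mulr_ge0.
- by rewrite -expRD -[ltRHS]expR0 ltr_expR; lra.
have bound w y : W' w -> ((- y)%:E <= u (icoord e0 w))%E ->
    ((cmod (f (icoord e0 w)) ^+ 2)%:E * expeR (- (2%:E * (c%:E * u (icoord e0 w)))) <= ((B ^+ 2 + 1) * expR (2 * c * y))%:E)%E.
  move=> /W'E[_ _ fB _] hy; rewrite [leRHS]EFinM; apply: lee_pmul => //; rewrite ?lee_fin ?sqr_ge0 //.
    by exact: expeR_ge0.
    apply: ler_wpDr => //; have c1' := cmod_ge0 (f (icoord e0 w)).
    by rewrite lerXn2r ?nnegrE // (le_trans c1').
  rewrite -/(expeR (2 * c * y)%:E) lee_expeR leeNl.
  have -> : (- (2 * c * y)%:E = 2%:E * (c%:E * (- y)%:E))%E by rewrite -!EFinM -EFinN; congr EFin; ring.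
  by apply: lee_wpmul2l; rewrite ?lee_fin //; apply: lee_wpmul2l; rewrite ?lee_fin.
move=> t W't; have [Wt _ _ _] := W'E _ W't.
case: (hW _ Wt) => [hk|[k [Ak hk]]|Ak]; first by apply: Or31; exact: bound.
  apply: Or32; exists k; split=> //; apply: le_trans (bound _ _ W't hk) _.
  rewrite lee_fin /Q -[leRHS]mulrA; apply: ler_wpM2l; first by rewrite addr_ge0 // sqr_ge0.
  by rewrite -expRM_natl -expRD ler_expR; lra.
by apply: Or33.
Qed.

Lemma le_of_lne (x wt C K s : R) : 0 <= x -> 0 < wt ->
  ((wt^-1)%:E * lne x%:E - C%:E <= (K - s)%:E)%E -> x <= expR (wt * (C + K)) * expR (- (wt * s)).
Proof.
move=> x0 w0; have [->|xn0] := eqVneq x 0; first by rewrite mulr_ge0 ?expR_ge0.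
have x1 : 0 < x by rewrite lt_def xn0.
rewrite lne_EFin // -EFinM -EFinN -EFinD lee_fin => h.
rewrite -expRD -[leLHS](@lnK R x) ?posrE // ler_expR.
have : wt^-1 * ln x <= K + C - s by lra.
by rewrite mulrC ler_pdivrMr // => h'; lra.
Qed.

Lemma exponent_lower (phi phiA : M -> \bar R) (V : set M) (wt : 'I_n -> R) i0 i1 (C r : R) : 0 < r ->
  (forall j, 1 <= wt j) -> wt i1 = 1 -> (forall a b : nat, (0 < b)%N -> wt i0 * b%:R != a%:R) ->
  (forall x j, dom e0 x -> vnorm (coord e0 x - p) < r ->
     (((wt j)^-1)%:E * lne (cmod (coord e0 x 0 j - p 0 j))%:E - C%:E <= phi x)%E) ->
  V z0 -> psh_on V phiA -> log_poles phiA z0 -> (\forall z \near z0, (phi z <= phiA z)%E) ->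
  exists2 c1, \sum_j wt j < c1 & forall c, 0 <= c -> c < c1 ->
    multiplier_ideal (fun z => c%:E * phiA z)%E z0 = holomorphic_germs z0.
Proof.
move=> r0 wt1 wti1 irr hphi Vz pA [kap [N [g [b [K [hg hlog]]]]]] hle.
have oV : open V by case: pA.
have [r1 r10 hr1] : exists2 r1, 0 < r1 & forall w, vnorm (w - p) < r1 -> (coord e0 @` dom e0) w /\
    [/\ V (icoord e0 w), `|b (icoord e0 w)| <= K /\
      phiA (icoord e0 w) = (kap%:E * lne (\sum_(k < N) cmod (g k (icoord e0 w)) ^+ 2)%:E + (b (icoord e0 w))%:E)%E,
      (phi (icoord e0 w) <= phiA (icoord e0 w))%E &
      forall l, dom e0 (icoord e0 w) -> differentiable (g l \o icoord e0) (coord e0 (icoord e0 w))].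
  apply: (chart_near (P := fun z => [/\ V z, `|b z| <= K /\
    phiA z = (kap%:E * lne (\sum_(k < N) cmod (g k z) ^+ 2)%:E + (b z)%:E)%E, (phi z <= phiA z)%E &
    forall l, dom e0 z -> differentiable (g l \o icoord e0) (coord e0 z)])).
  have hd := filter_forall (nbhs_filter z0) (fun l => germ_differentiable (hg l)).
  near=> z; split.
  - by near: z; exact: open_nbhs_nbhs.
  - by near: z; exact: hlog.
  - by near: z; exact: hle.
  - by near: z; exact: hd.
pose g' l := g l \o icoord e0.
pose G w := \sum_l cmod (g' l w) ^+ 2.
pose W := [set w : Cn | vnorm (w - p) < Num.min r1 r].
have oW : open W by exact: vball_open.
have Wp : W p by rewrite /W /= subrr vnorm0 lt_min r10.
have WE w : W w -> [/\ (coord e0 @` dom e0) w, V (icoord e0 w), `|b (icoord e0 w)| <= K,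
    phiA (icoord e0 w) = (kap%:E * lne (G w)%:E + (b (icoord e0 w))%:E)%E &
    (phi (icoord e0 w) <= phiA (icoord e0 w))%E].
  by rewrite /W /= lt_min => /andP[/hr1 [? [? [? ?] ? _]] _].
have WV : W `<=` coord e0 @` (V `&` dom e0).
  by move=> w /WE[wd wV _ _ _]; apply/chart_image.
have dg l z : W z -> differentiable (g' l) z.
  rewrite /W /= lt_min => /andP[/hr1 [[x ex <-] [_ _ _ h]] _].
  by move: (h l); rewrite chartK // => /(_ ex).
have K0 : 0 <= K by have [_ _ h _ _] := WE p Wp; apply: le_trans h.
have G0 w : 0 <= G w by apply: sumr_ge0 => l _; exact: sqr_ge0.
have cG z : W z -> {for z, continuous G}.
  move=> Wz; apply: (@smooth_continuous R n W _ _ _ Wz); apply: smooth_sumsq => l.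
  by apply: differentiable_holn => w; exact: dg.
(* For [kap <= 0] the function is bounded below near [z0], so every [c] is admissible. The number
   [\sum_j wt j + 1] is just some larger bound, and all layers are empty. *)
have [kap0|kap0] := leP kap 0.
  exists (\sum_j wt j + 1); first by rewrite ltrDl.
  have cpre0 : cpre (set0 : set Cn) = set0 by apply/seteqP; split.
  move=> c c0 cc1; pose W0 := W `&` [set w | G w < G p + 1].
  have m0 : 0 <= ln (G p + 1) by apply: ln_ge0; rewrite lerDr.
  apply: (@integrable_weight V phiA W0 (fun=> set0) 0 (K - kap * ln (G p + 1)) c (\sum_j wt j + 1)) => //.
  - exact: open_sublevel.
  - by split=> //=; rewrite ltrDl.
  - by move=> w [Ww _]; exact: WV.
  - by move=> k; rewrite cpre0.
  - by move=> k; rewrite cpre0 measure0 mul0r.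
  - move=> w [Ww /= Gw]; apply: Or31; have [_ _ bK -> _] := WE w Ww.
    have bK' : - K <= b (icoord e0 w) by move: bK; rewrite ler_norml => /andP[].
    (* By the convention [0 * -oo = 0], zeros of [G] do no harm when [kap = 0]. *)
    have [->|kn0] := eqVneq kap 0.
      by rewrite mul0e add0e mul0r subr0 lee_fin.
    have [Gz|Gp] := leP (G w) 0.
      by rewrite le0_lneNy ?lee_fin // lt0_muleNy ?lte_fin ?addye ?leey // lt_def eq_sym kn0.
    rewrite lne_EFin // -EFinM -EFinD lee_fin.
    have : kap * ln (G p + 1) <= kap * ln (G w).
      have gp : 0 < G p + 1 by rewrite ltr_wpDl.
      by rewrite ler_wnM2l // ler_ln ?posrE //; exact: ltW.
    lra.
pose C' := \sum_j expR (wt j * (C + K)).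
have C'0 j : expR (wt j * (C + K)) <= C'.
  by rewrite /C' (bigD1 j) //= lerDl sumr_ge0 // => k _; exact: expR_ge0.
(* On this set [phi <= phiA <= K - s], and the lower bound of [phi] by the logarithm of each
   coordinate turns this into smallness of the coordinates. *)
have H w s : W w -> 0 <= s -> G w < expR (- (s / kap)) ->
    forall j, cmod (w 0 j - p 0 j) <= C' * expR (- (wt j * s)).
  move=> Ww s0 Gs j; have [[x ex xw] _ bK pE ple] := WE w Ww.
  apply: le_trans (_ : expR (wt j * (C + K)) * expR (- (wt j * s)) <= _); last first.
    by apply: ler_wpM2r; [exact: expR_ge0|].
  apply: le_of_lne; [exact: cmod_ge0|exact: lt_le_trans (wt1 j)|].
  have xE : icoord e0 w = x by rewrite -xw chartK.
  have := hphi x j ex; rewrite xw => hx.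
  apply: le_trans (hx _) _; first by move: Ww; rewrite /W /= lt_min => /andP[].
  rewrite -xE; apply: le_trans ple _; rewrite pE.
  have bK' : b (icoord e0 w) <= K by move: bK; rewrite ler_norml => /andP[].
  have [Gz|Gp] := leP (G w) 0.
    by rewrite le0_lneNy ?lee_fin // gt0_muleNy ?lte_fin // addNye leNye.
  rewrite lne_EFin // -EFinM -EFinD lee_fin.
  have : kap * ln (G w) < - s.
    by rewrite mulrC -ltr_pdivlMr // mulNr -[ltRHS]expRK ltr_ln ?posrE ?expR_gt0.
  lra.
have C'p : 0 < C' by apply: lt_le_trans (C'0 i0); exact: expR_gt0.
have [c1 [C2 [W' [c1w oW' W'p W'W vol]]]] := sublevel_volume oW Wp dg kap0 C'p wt1 wti1 irr H.
exists c1 => // c c0 cc1.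
pose A k := W' `&` [set w | G w < expR (- (k%:R / kap))].
apply: (@integrable_weight V phiA W' A `|C2| (K + 2) c c1) => //.
- by move=> w /W'W; exact: WV.
- move=> k; apply: open_measurable_cpre; apply: open_sublevel => // z /W'W; exact: cG.
- move=> k; apply: le_trans (vol k%:R (ler0n _ k)) _; rewrite lee_fin.
  rewrite -expRM_natl; have -> : - (2 * c1 * k%:R) = k%:R * - (2 * c1) by ring.
  by apply: ler_wpM2r; [exact: expR_ge0|exact: ler_norm].
move=> w W'w; have [_ _ bK pE _] := WE w (W'W w W'w).
have bK' : - K <= b (icoord e0 w) by move: bK; rewrite ler_norml => /andP[].
(* Common zeros of the germs lie in every layer; there [phiA] is [-oo]. *)
have [Gz|Gp] := leP (G w) 0.
  by apply: Or33 => k; split=> //=; apply: le_lt_trans Gz (expR_gt0 _).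
have [Gb|Gb] := leP (- 2) (kap * ln (G w)).
  by apply: Or31; rewrite pE lne_EFin // -EFinM -EFinD lee_fin; lra.
apply: Or32; have y0 : 0 <= - (kap * ln (G w)) - 1 by lra.
have /andP[t1 t2] := truncn_itv y0.
(* The shift by 1 makes the inequality defining [A k] strict, and rounding loses at most another 1;
   together they account for the 2 in [K + 2]. *)
exists (Num.truncn (- (kap * ln (G w)) - 1)); move: t1 t2; rewrite -natr1; move: (Num.truncn _) => k t1 t2.
split.
  split=> //=; rewrite -[ltLHS](@lnK R (G w)) ?posrE // ltr_expR -mulNr ltr_pdivlMr // mulrC; lra.
by rewrite pE lne_EFin // -EFinM -EFinD lee_fin; lra.
Unshelve. all: by end_near. Qed.

End exponent_lower.

(** * The weight *)

Section lne_facts.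
Variable R : realType.

Lemma measurable_lne : measurable_fun setT (@lne R).
Proof.
apply: (measurability _ (ErealGenCInfty.measurableE R)) => _ [_ [r ->] <-]; rewrite setTI.
rewrite (_ : _ @^-1` _ = `[(expR r)%:E, +oo[%classic); first exact: emeasurable_itv.
apply/seteqP; split => x; rewrite /= !in_itv /= !andbT; case: x => [x| |] //=.
- case: ifP => [|/negbT]; rewrite ?leeNy_eq // -ltNge => x0.
  by rewrite !lee_fin -{2}(@lnK R x) ?posrE // ler_expR.
- by rewrite ?leeNy_eq ?leey.
- rewrite lee_fin => rx; have x0 : 0 < x by apply: lt_le_trans rx; exact: expR_gt0.
  by rewrite [x <= 0]leNgt x0 /= lee_fin -ler_expR lnK.
- by rewrite ?leeNy_eq ?leey.
Qed.

Lemma lne_aff_lt (k x D c : R) : 0 < k ->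
  (k%:E * lne x%:E - D%:E < c%:E)%E = (x < expR ((c + D) / k)).
Proof.
move=> k0; have [x0|x0] := leP x 0.
  by rewrite le0_lneNy ?lee_fin // gt0_muleNy ?lte_fin // addNye ltNyr (le_lt_trans x0) // expR_gt0.
rewrite lne_EFin // -EFinM -EFinN -EFinD lte_fin -{2}(@lnK R x) ?posrE // ltr_expR.
by rewrite ltr_pdivlMr // [ln x * k]mulrC ltrBlDr.
Qed.

Lemma lne_aff_le (k x y : R) : 0 < k -> x <= y -> 0 < y -> (k%:E * lne x%:E <= (k * ln y)%:E)%E.
Proof.
move=> k0 xy y0; have [x0|x0] := leP x 0.
  by rewrite le0_lneNy ?lee_fin // gt0_muleNy ?lte_fin // leNye.
by rewrite lne_EFin // -EFinM lee_fin ler_pM2l // ler_ln.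
Qed.

Lemma lne_aff_ge (k x y : R) : 0 < k -> x <= y -> (k%:E * lne x%:E <= k%:E * lne y%:E)%E.
Proof.
move=> k0 xy; have [y0|y0] := leP y 0.
  by rewrite !le0_lneNy ?lee_fin // (le_trans xy).
by rewrite [leRHS](_ : _ = (k * ln y)%:E) ?lne_aff_le // lne_EFin.
Qed.

End lne_facts.

Section sums.
Variable R : realType.

Lemma conjcM_cmod (z : R[i]) : z^*%C * z = (cmod z ^+ 2)%:C%C.
Proof.
by rewrite cmod_sqr; case: z => x y; apply/eqP; rewrite eq_complex /=; apply/andP; split; apply/eqP; ring.
Qed.

Lemma cmod_conj (z : R[i]) : cmod z^*%C = cmod z.
Proof. by rewrite !cmod_sqrt; case: z => x y /=; rewrite sqrrN. Qed.

Lemma hol1_lincomb (I : Type) (r : seq I) (k : I -> R[i]) (h : I -> R[i] -> R[i]) :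
  (forall j, hol1 (h j)) -> hol1 (fun x => \sum_(j <- r) k j * h j x).
Proof.
move=> hh x x1; elim: r => [|j r [m hm]].
  rewrite (_ : (fun _ => _) = (fun=> 0 : R[i])); first by exists 0; exact: cderiv_cst.
  by apply/funext => y; rewrite big_nil.
have [l hl] := hh j x x1; exists (k j * l + m).
rewrite (_ : (fun _ => _) = (fun y => k j * h j y + \sum_(i <- r) k i * h i y)).
  by apply: cderiv_add => //; exact: cderiv_scale.
by apply/funext => y; rewrite big_cons.
Qed.

Lemma rcont_sumsq (I : Type) (r : seq I) (h : I -> R[i] -> R[i]) a b : (forall j, hol1 (h j)) ->
  rcont a b (fun t => \sum_(j <- r) cmod (h j (cexpi t)) ^+ 2).
Proof.
move=> hh; elim: r => [|j r ih].
  rewrite (_ : (fun _ => _) = (fun=> 0 : R)); first exact: rcont_cst.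
  by apply/funext => y; rewrite big_nil.
rewrite (_ : (fun _ => _) = (fun t => cmod (h j (cexpi t) * h j (cexpi t)) + \sum_(i <- r) cmod (h i (cexpi t)) ^+ 2)).
  by apply: rcont_add => //; apply: ccont_cmod; apply: ccont_mul; exact: hol1_circle.
by apply/funext => y; rewrite big_cons cmodM expr2.
Qed.

End sums.

(** * The local weight and its sub-mean value inequality *)

Section model_weight.
Variables (R : realType) (n : nat).
Local Notation Cn := 'rV[R[i]]_n.
Variables (p : Cn) (i0 : 'I_n) (tau D a : R).
Hypotheses (tau1 : 1 < tau) (a0 : 0 < a) (Da : `|ln a| <= D).

Definition rho (w : Cn) : R := \sum_j cmod (w 0 j - p 0 j) ^+ 2.

Definition psi (w : Cn) : \bar R :=
  maxe ((tau^-1)%:E * lne (cmod (w 0 i0 - p 0 i0))%:E - D%:E)%E ((2^-1)%:E * lne (rho w)%:E)%E.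

(* The flat term vanishes for [rho >= a] and keeps the argument of the logarithm positive at [p]. *)
Definition corr (w : Cn) : R := - 2^-1 * ln (rho w + flat 0 (a + -1 * rho w)).

Lemma rho_ge0 w : 0 <= rho w.
Proof. by apply: sumr_ge0 => j _; exact: sqr_ge0. Qed.

Lemma cmod_le_rho (w : Cn) j : cmod (w 0 j - p 0 j) ^+ 2 <= rho w.
Proof. by rewrite /rho (bigD1 j) //= lerDl sumr_ge0 // => k _; exact: sqr_ge0. Qed.

Lemma rho_flat_gt0 w : 0 < rho w + flat 0 (a + -1 * rho w).
Proof.
have := rho_ge0 w; rewrite le_eqVlt => /orP[/eqP <-|r0].
  by rewrite mulr0 addr0 add0r flat_gt0 // a0.
by rewrite ltr_wpDr // flat_ge0.
Qed.

Lemma half_lne_rho w : 0 < rho w -> ((2^-1)%:E * lne (rho w)%:E = (ln (Num.sqrt (rho w)))%:E)%E.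
Proof.
move=> r0; rewrite lne_EFin // -EFinM; congr EFin.
by rewrite -{1}(sqr_sqrtr (ltW r0)) lnXn ?sqrtr_gt0 // [X in _ * X]mulr2n; lra.
Qed.

(** Where [rho >= a], the choice [D >= |ln a|] makes the logarithm of the distance the larger branch
    of the maximum, and [corr] is exactly its negative. *)
Lemma weight_outside w : a <= rho w -> (psi w + (corr w)%:E = 0)%E.
Proof.
move=> aw; have r0 : 0 < rho w by apply: lt_le_trans aw.
have D0 : 0 <= D by apply: le_trans Da.
have tau0 : 0 < tau by apply: lt_trans tau1.
rewrite /corr flat_le0 ?addr0; last by rewrite mulN1r subr_le0.
suff -> : psi w = (2^-1 * ln (rho w))%:E by rewrite -EFinD mulNr subrr.
rewrite /psi [X in maxe _ X](_ : _ = (2^-1 * ln (rho w))%:E); last by rewrite lne_EFin.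
apply/max_idPr.
have sl : cmod (w 0 i0 - p 0 i0) <= Num.sqrt (rho w).
  by rewrite -(@ler_pXn2r _ 2) ?nnegrE ?cmod_ge0 ?sqrtr_ge0 // sqr_sqrtr ?rho_ge0 // cmod_le_rho.
have t0 : 0 < tau^-1 by rewrite invr_gt0.
have t1 : tau^-1 <= 1 by rewrite invf_le1 // ltW.
apply: le_trans (_ : (tau^-1 * ln (Num.sqrt (rho w)) - D)%:E <= _)%E.
  by rewrite EFinB; apply: leeB => //; apply: lne_aff_le => //; rewrite sqrtr_gt0.
have lr : ln (rho w) = 2 * ln (Num.sqrt (rho w)).
  by rewrite -{1}(sqr_sqrtr (ltW r0)) lnXn ?sqrtr_gt0 // mulr2n; lra.
have la : ln a <= 2 * ln (Num.sqrt (rho w)) by rewrite -lr ler_ln.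
have := ler_norm (- ln a); rewrite normrN => na; have Da' := Da.
rewrite lee_fin lr mulKf //; move: (ln (Num.sqrt (rho w))) la => y la.
have : 0 <= (1 - tau^-1) * (2 * y - ln a) by apply: mulr_ge0; lra.
have : 0 <= (1 - tau^-1) * (ln a + D) by apply: mulr_ge0; lra.
have : 0 <= tau^-1 * D by apply: mulr_ge0 => //; exact: ltW.
move: (tau^-1) => q; nra.
Qed.

Lemma psi_lt (w : Cn) c : (psi w < c%:E)%E <->
  cmod (w 0 i0 - p 0 i0) < expR ((c + D) * tau) /\ rho w < expR (c * 2).
Proof.
have t0 : 0 < tau^-1 by rewrite invr_gt0; apply: lt_trans tau1.
have h0 : 0 < (2^-1 : R) by rewrite invr_gt0.
have e2 := @lne_aff_lt R 2^-1 (rho w) 0 c h0; rewrite sube0 addr0 in e2.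
by rewrite /psi gt_max lne_aff_lt // e2 !invrK; split => /andP.
Qed.

Lemma psi_Ny w : psi w = -oo%E -> w = p.
Proof.
move=> pN; apply/rowP => j; apply/eqP; rewrite -subr_eq0 -cmod_eq0 -sqrf_eq0.
have [rz|rp] := leP (rho w) 0; last first.
  have : ((2^-1)%:E * lne (rho w)%:E <= psi w)%E by rewrite /psi le_max lexx orbT.
  by rewrite pN lne_EFin // -EFinM leeNy_eq.
by rewrite eq_le sqr_ge0 andbT (le_trans (cmod_le_rho w j)).
Qed.

(** [h] collects the coordinates, relative to [p], of a disc that is affine in another chart and
    hence merely holomorphic in this one. Each branch of the maximum is reduced to the logarithm of
    a single holomorphic function. *)
Lemma psi_submean (h : 'I_n -> R[i] -> R[i]) (F : R[i] -> Cn) : (forall j, hol1 (h j)) ->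
  (forall x j, F x 0 j - p 0 j = h j x) ->
  (psi (F 0%R) <= ((2 * pi)^-1)%:E * \int[lebesgue_measure]_(t in `[0%R, (2 * pi)%R]) psi (F (cexpi t)))%E.
Proof.
move=> hh FE; have tau0 : 0 < tau by apply: lt_trans tau1.
have t0 : 0 < tau^-1 by rewrite invr_gt0.
have h20 : 0 < (2^-1 : R) by rewrite invr_gt0.
have I0 := ltW (twopi_gt0 R).
have cA : rcont 0 (2 * pi) (fun t => cmod (h i0 (cexpi t))).
  by apply: ccont_cmod; exact: hol1_circle.
have rhoE x : rho (F x) = \sum_j cmod (h j x) ^+ 2.
  by apply: eq_bigr => j _; rewrite FE.
have cB : rcont 0 (2 * pi) (fun t => rho (F (cexpi t))).
  rewrite (_ : (fun _ => _) = (fun t => \sum_j cmod (h j (cexpi t)) ^+ 2)); last by apply/funext => t; exact: rhoE.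
  exact: rcont_sumsq.
have mr (f : R -> R) : rcont 0 (2 * pi) f -> measurable_fun `[0%R, (2 * pi)%R] (EFin \o f).
  move=> cf; apply/measurable_EFinP.
  by apply: subspace_continuous_measurable_fun => //; exact: rcont_within.
pose w t := psi (F (cexpi t)).
have mw : measurable_fun `[0%R, (2 * pi)%R] w.
  have m1 := measurableT_comp (@measurable_lne R) (mr _ cA).
  have m2 := measurableT_comp (@measurable_lne R) (mr _ cB).
  rewrite /w /psi; apply: measurable_maxe.
    apply: emeasurable_funB => //; apply: measurable_funeM.
    by apply: eq_measurable_fun m1 => t _ /=; rewrite FE.
  exact: measurable_funeM m2.
have [C hC] : exists C, forall t, `[0%R, (2 * pi)%R]%classic t -> (w t <= C%:E)%E.
  have [A hA] := rcont_bounded I0 cA; have [B hB] := rcont_bounded I0 cB.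
  exists (Num.max (tau^-1 * ln (A + 1) - D) (2^-1 * ln (B + 1))) => t; rewrite /= in_itv /= => tI.
  have hA' := hA t tI; have hB' := hB t tI.
  rewrite ger0_norm ?cmod_ge0 // in hA'; rewrite ger0_norm ?rho_ge0 // in hB'.
  have A1 := cmod_ge0 (h i0 (cexpi t)); have B1 := rho_ge0 (F (cexpi t)).
  rewrite EFin_max; apply: le_max2; last by apply: lne_aff_le => //; lra.
  rewrite EFinB; apply: leeB => //; rewrite FE; apply: lne_aff_le => //; lra.
rewrite {1}/psi ge_max; apply/andP; split.
  rewrite FE; apply: (@jensen_submean R (h i0) tau^-1 (- D) C w) => // t _.
  by rewrite /w /psi FE le_max lexx.
have [rz|rp] := leP (rho (F 0)) 0.
  by rewrite le0_lneNy ?lee_fin // gt0_muleNy ?lte_fin // leNye.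
pose s := Num.sqrt (rho (F 0)).
have s0 : 0 < s by rewrite sqrtr_gt0.
have s2 : s ^+ 2 = \sum_j cmod (h j 0) ^+ 2 by rewrite sqr_sqrtr ?rho_ge0 // rhoE.
(* By Cauchy-Schwarz [|H|^2 <= rho] along the disc, with equality at its centre. *)
pose H x := \sum_j (h j 0)^*%C / s%:C%C * h j x.
have hH : hol1 H.
  exact: hol1_lincomb.
have H0 : cmod (H 0) = s.
  have -> : H 0 = s%:C%C.
    rewrite /H (eq_bigr (fun j => (cmod (h j 0) ^+ 2)%:C%C / s%:C%C)); last first.
      by move=> j _; rewrite mulrAC conjcM_cmod.
    have e : \sum_j (cmod (h j 0) ^+ 2)%:C%C = s%:C%C * s%:C%C :> R[i].
      by rewrite -(raddf_sum (real_complex R)) -s2 expr2; exact: rmorphM.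
    rewrite -mulr_suml e.
    by rewrite mulfK // -cmod_eq0 cmodR ger0_norm ?gt_eqF // ltW.
  by rewrite cmodR ger0_norm // ltW.
rewrite half_lne_rho // -/s.
have := @jensen_submean R H 1 0 C w hH ltr01 mw hC.
rewrite H0 lne_EFin // mul1e adde0; apply => t _.
rewrite mul1e adde0 /w /psi le_max; apply/orP; right.
have [z|pos] := leP (cmod (H (cexpi t))) 0; first by rewrite le0_lneNy ?lee_fin // leNye.
set q := cexpi t in pos *.
have Hq : cmod (H q) <= Num.sqrt (rho (F q)).
  set x := cmod (H q) in pos *.
  (* The weights of this arithmetic-geometric inequality are such that summing over [j] gives
     [x <= (x + rho / x) / 2], that is [x ^+ 2 <= rho]. *)
  have AM j : cmod ((h j 0)^*%C / s%:C%C * h j q) <= 2^-1 * (x / s ^+ 2 * cmod (h j 0) ^+ 2 + x^-1 * cmod (h j q) ^+ 2).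
    rewrite !cmodM cmodV cmodR [`|s|]ger0_norm ?(ltW s0) // cmod_conj.
    have : 0 <= x^-1 * (x / s * cmod (h j 0) - cmod (h j q)) ^+ 2.
      by apply: mulr_ge0; [rewrite invr_ge0 ltW|exact: sqr_ge0].
    rewrite (_ : x^-1 * _ = x / s ^+ 2 * cmod (h j 0) ^+ 2 + x^-1 * cmod (h j q) ^+ 2 - 2 * (cmod (h j 0) / s * cmod (h j q))).
      by lra.
    by field; rewrite !gt_eqF.
  have xle : x <= 2^-1 * (x + x^-1 * rho (F q)).
    apply: le_trans (cmod_sum _ _ _) _; apply: le_trans (ler_sum _ (fun j _ => AM j)) _.
    rewrite -mulr_sumr big_split /= -!mulr_sumr -s2 -rhoE divfK //.
    by rewrite expf_neq0 // gt_eqF.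
  have x2 : x ^+ 2 <= rho (F q).
    have : x <= x^-1 * rho (F q) by lra.
    by rewrite mulrC ler_pdivlMr // -expr2.
  by rewrite -(@ler_pXn2r _ 2) ?nnegrE ?sqrtr_ge0 ?(ltW pos) // sqr_sqrtr ?rho_ge0.
have rq : 0 < rho (F q) by rewrite -sqrtr_gt0; apply: lt_le_trans Hq.
by rewrite half_lne_rho // lne_EFin // lee_fin ler_ln ?posrE // sqrtr_gt0.
Qed.

End model_weight.

Section model_regularity.
Variables (R : realType) (n : nat).
Local Notation Cn := 'rV[R[i]]_n.

Lemma compact_cbox (p : Cn) (s : R) : compact (cbox p (fun=> s)).
Proof.
have := @rV_compact R[i] n (fun j => [set z | `|complex.Re (z - p 0 j)| <= s /\ `|complex.Im (z - p 0 j)| <= s]).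
apply => j.
pose f (xy : R * R) : R[i] := Complex (complex.Re (p 0 j) + xy.1) (complex.Im (p 0 j) + xy.2).
rewrite (_ : [set z | _] = f @` (`[- s, s]%classic `*` `[- s, s]%classic)); last first.
  apply/seteqP; split => [z [zr zi]|_ [[x y] [/= xs ys] <-]] /=.
    exists (complex.Re (z - p 0 j), complex.Im (z - p 0 j)).
      by rewrite /= !in_itv /= -!ler_norml.
    by rewrite /f /= ReB ImB !subrKC; case: (z).
  rewrite !in_itv /= -!ler_norml in xs ys.
  by rewrite ReB ImB /f /= [_ + x]addrC [_ + y]addrC !addrK.
apply: continuous_compact; last by apply: compact_setX; exact: segment_compact.
apply: continuous_subspaceT => -[x y] P /nbhs_complexP[e e0 hP].
have e2 : 0 < e / 2 by rewrite divr_gt0.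
exists (ball x (e / 2), ball y (e / 2)); first by split; exact: nbhsx_ballx.
move=> [u v] [/= xu yv]; apply: hP; apply: le_lt_trans (cmod_le_ReIm _) _.
rewrite ReB ImB /f /=; move: xu yv; rewrite -!ball_normE /= => xu yv.
have h (c k l : R) : c + k - (c + l) = - (l - k) by ring.
by rewrite !h !normrN; lra.
Qed.

Lemma holn_coordB (p : Cn) (F : Cn -> Cn) (W : set Cn) j : (forall z, W z -> differentiable F z) ->
  holn W (fun w => F w 0 j - p 0 j).
Proof.
move=> dF; apply: differentiable_holn => z Wz; apply: differentiableB; last exact: differentiable_cst.
by apply: differentiable_rV_coord; exact: dF.
Qed.

Lemma smooth_rho (p : Cn) (F : Cn -> Cn) (W : set Cn) : (forall z, W z -> differentiable F z) ->
  smooth_expr W (fun w => rho p (F w)).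
Proof. by move=> dF; apply: smooth_sumsq => j; exact: holn_coordB. Qed.

Lemma smooth_corr (p : Cn) (a : R) (F : Cn -> Cn) (W : set Cn) : 0 < a ->
  (forall z, W z -> differentiable F z) -> smooth_expr W (fun w => corr p a (F w)).
Proof.
move=> a0 dF; apply: smooth_mul; first exact: smooth_cst.
apply: smooth_ln; last by move=> z _; exact: rho_flat_gt0.
apply: smooth_add; first exact: smooth_rho.
apply: smooth_flat; apply: smooth_add; first exact: smooth_cst.
by apply: smooth_mul; [exact: smooth_cst|exact: smooth_rho].
Qed.

Lemma open_psi_lt (p : Cn) i0 tau D c : 1 < tau -> open [set w : Cn | (psi p i0 tau D w < c%:E)%E].
Proof.
move=> t1.
have dI z : setT z -> differentiable (id : Cn -> Cn) z by move=> _; apply: ex_diff.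
have o2 : open (setT `&` [set w : Cn | rho p w < expR (c * 2)]).
  apply: open_sublevel; first exact: openT.
  by move=> z _; apply: (@smooth_continuous R n setT _ _ _ I); exact: (@smooth_rho p id setT dI).
rewrite openE => z /(psi_lt _ _ _ t1)[h1 h2]; apply/nbhs_vnorm.
have [e e0 he] := (nbhs_vnorm _ _).1 (open_nbhs_nbhs (conj o2 (conj I h2))).
exists (Num.min e (expR ((c + D) * tau) - cmod (z 0 i0 - p 0 i0))); first by rewrite lt_min e0 subr_gt0.
move=> w; rewrite lt_min => /andP[w1 w2]; apply/(psi_lt _ _ _ t1); split; last exact: (he w w1).2.
have := cmodD (w 0 i0 - z 0 i0) (z 0 i0 - p 0 i0); rewrite addrA subrK.
have := cmod_le_vnorm (w - z) i0; rewrite !mxE; lra.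
Qed.

Lemma psi_lty (p : Cn) i0 tau D (w : Cn) : 1 < tau -> (psi p i0 tau D w < +oo)%E.
Proof.
move=> t1; have A0 := cmod_ge0 (w 0 i0 - p 0 i0); have B0 := rho_ge0 p w.
apply: lt_trans (_ : psi p i0 tau D w < (cmod (w 0 i0 - p 0 i0) + rho p w + `|D|)%:E)%E _; last exact: ltry.
apply/(psi_lt _ _ _ t1).
have D0 : 0 <= `|D| + D by have := ler_norm (- D); rewrite normrN; lra.
have D1 : 0 <= `|D| by [].
split; [apply: lt_le_trans (expR_ge1Dx _)|apply: lt_le_trans (expR_ge1Dx _)]; last by lra.
have : 0 <= (cmod (w 0 i0 - p 0 i0) + rho p w + (`|D| + D)) * (tau - 1) by apply: mulr_ge0; lra.
lra.
Qed.

End model_regularity.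

(** * The weight on the manifold *)

Section weight.
Variables (R : realType) (n : nat) (M : complexManifold R n) (z0 : M).
Local Notation Cn := 'rV[R[i]]_n.
Variables (e0 : chart R n M) (i0 : 'I_n) (tau : R).
Hypotheses (ae0 : atlas e0) (e0z : dom e0 z0) (tau1 : 1 < tau).
Let p := coord e0 z0.

Lemma transition_differentiable e y : atlas e -> (coord e @` (dom e0 `&` dom e)) y ->
  differentiable (coord e0 \o icoord e) y.
Proof. by move=> ae; rewrite setIC; exact: cm_holomorphic. Qed.

Lemma psh_psi (D : R) : psh_on (dom e0) (fun x => psi p i0 tau D (coord e0 x)).
Proof.
split.
- exact: chart_open_dom.
- by move=> x _; exact: psi_lty.
- move=> x ex c xc.
  exact: (@chart_continuous _ _ _ e0 x ex _ (open_nbhs_nbhs (conj (@open_psi_lt R n p i0 tau D c tau1) xc))).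
- move=> e ae b v hv; pose F x := coord e0 (icoord e (b + x *: v)).
  have hl j : hol1 (fun x => F x 0 j - p 0 j).
    have hf : holn (coord e @` (dom e0 `&` dom e)) (fun w => (coord e0 \o icoord e) w 0 j - p 0 j).
      by apply: holn_coordB => z; exact: transition_differentiable.
    by apply: (holn_line hf) => x x1; apply: hv; rewrite normc_le1.
  have := @psi_submean R n p i0 tau D tau1 _ F hl (fun _ _ => erefl).
  by rewrite /F scale0r addr0.
- move=> x ex; have [xz|xz] := pselect (psi p i0 tau D (coord e0 x) = -oo%E); last first.
    by exists x => //; exact: connected_component_refl.
  have xp := psi_Ny xz.
  have pe : (coord e0 @` dom e0) p by exists z0.
  have [r r0 hr] := (nbhs_vnorm _ _).1 (open_nbhs_nbhs (conj (@chart_open_img _ _ _ e0) pe)).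
  (* [psi] is [-oo] at [p] only; a segment of length [r / 2] in direction [i0] leads from [p] to
     another point without leaving the chart. *)
  pose c (t : R) : Cn := p + (t * (r / 2))%:C%C *: cdelta R i0.
  have cE (t u : R) : vnorm (c u - c t) = `|u - t| * (r / 2).
    rewrite /c opprD addrACA subrr add0r -scalerBl vnormZ vnorm_delta mulr1.
    rewrite (_ : _ - _ = ((u - t) * (r / 2))%:C%C); last by rewrite mulrBl; exact: esym (rmorphB _ _ _).
    by rewrite cmodR normrM [`|r / 2|]ger0_norm // divr_ge0 // ltW.
  have c0 : c 0 = p by rewrite /c mul0r scale0r addr0.
  have cW t : 0 <= t <= 1 -> (coord e0 @` dom e0) (c t).
    move=> /andP[t0 t1]; apply: hr; rewrite -c0 cE subr0 ger0_norm //.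
    have : t * (r / 2) <= 1 * (r / 2) by rewrite ler_pM2r // divr_gt0.
    lra.
  have K : connected ((icoord e0 \o c) @` `[0%R, 1%R]%classic).
    apply: connected_continuous_connected; first exact: segment_connected.
    apply/subspace_continuousP => t; rewrite /= in_itv /= => tI.
    apply: cvg_within_filter => P nP.
    have := @chart_icontinuous _ _ _ e0 (c t) (cW t tI) P nP => /nbhs_vnorm[e e1 he].
    have r2 : 0 < r / 2 by rewrite divr_gt0.
    apply/nbhs_ballP; exists (e / (r / 2)); first by rewrite /= divr_gt0.
    move=> u; rewrite -ball_normE /= distrC ltr_pdivlMr // => ue.
    by apply: he; rewrite cE.
  exists (icoord e0 (c 1)).
    exists ((icoord e0 \o c) @` `[0%R, 1%R]%classic); last by exists 1 => //=; rewrite in_itv /= lexx ler01.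
    split=> //; first by exists 0; rewrite /= ?in_itv /= ?lexx ?ler01 // c0 -xp chartK.
    move=> _ [t + <-]; rewrite /= in_itv /= => tI.
    by have [y ey <-] := cW t tI; rewrite chartK.
  have [y ey yc] := cW 1 (introT andP (conj ler01 (lexx _))).
  rewrite -yc chartK // => /psi_Ny yp.
  have := cE 0 1; rewrite -yc c0 yp subrr vnorm0 subr0 normr1 mul1r => r2.
  have : 0 < r / 2 by rewrite divr_gt0.
  by rewrite -r2 ltxx.
Qed.

Lemma smooth_on_corr (a : R) : 0 < a -> smooth_on (dom e0) (fun x => corr p a (coord e0 x)).
Proof.
move=> a0; split; first exact: chart_open_dom.
move=> e ae k; apply: smooth_differentiable_class.
  exact: chart_image_open (chart_open_dom e0).
by apply: (smooth_corr _ a0) => z; exact: transition_differentiable.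
Qed.

Lemma psh_zero (V : set M) : open V -> psh_on V (fun=> 0%E).
Proof.
move=> oV; split=> //.
- by move=> x _ c c0; exact: nearW.
- by move=> e _ b v _; rewrite [X in (_ * X)%E]integral0 mule0.
- by move=> x Vx; exists x => //; exact: connected_component_refl.
Qed.

Lemma smooth_zero (V : set M) : open V -> smooth_on V (fun=> 0 : R).
Proof.
move=> oV; split=> // e ae k; apply: smooth_differentiable_class.
  exact: chart_image_open.
exact: (smooth_cst _ 0).
Qed.

Lemma weight_exists : exists (phi : M -> \bar R) (C r : R), [/\ quasi_psh phi, 0 < r,
  forall x, dom e0 x -> vnorm (coord e0 x - p) < r -> forall j,
    ((if j == i0 then tau else 1)^-1%:E * lne (cmod (coord e0 x 0 j - p 0 j))%:E - C%:E <= phi x)%E &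
  forall x s, dom e0 x -> vnorm (coord e0 x - p) < r ->
    (forall j, cmod (coord e0 x 0 j - p 0 j) <= expR (- ((if j == i0 then tau else 1) * s))) ->
    (phi x <= (C - s)%:E)%E].
Proof.
have pe : (coord e0 @` dom e0) p by exists z0.
have [r0 r00 hr0] := (nbhs_vnorm _ _).1 (open_nbhs_nbhs (conj (@chart_open_img _ _ _ e0) pe)).
have n21 : 0 < 2 * n%:R + 1 :> R by rewrite ltr_wpDl // mulr_ge0.
(* Points of the closed box of radius [s0] are within [2 * n%:R * s0 < r0] of [p] in [vnorm], so the
   box fits into the chart. *)
pose s0 := r0 / (2 * n%:R + 1); have s00 : 0 < s0 by rewrite divr_gt0.
pose a := s0 ^+ 2; have a0 : 0 < a by rewrite exprn_gt0.
pose D := `|ln a|.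
pose u := psi p i0 tau D; pose v := corr p a.
have boxW w : cbox p (fun=> s0) w -> (coord e0 @` dom e0) w.
  move=> hw; apply: hr0; apply: le_lt_trans (_ : n%:R * (2 * s0) < _).
    apply: vnorm_le => j; rewrite !mxE; have [h1 h2] := hw j.
    by apply: le_trans (cmod_le_ReIm _) _; lra.
  have -> : r0 = s0 * (2 * n%:R + 1) by rewrite /s0 divfK // gt_eqF.
  lra.
(* A compact subset of a Hausdorff space is closed, so the complement of [K] is an open set that
   contains all points outside the chart and on which [phi] vanishes. *)
pose K := icoord e0 @` cbox p (fun=> s0).
have cK : closed K.
  apply: compact_closed; first exact: cm_hausdorff.
  apply: continuous_compact; last exact: compact_cbox.
  apply/subspace_continuousP => w hw; apply: cvg_within_filter => P nP.
  exact: (@chart_icontinuous _ _ _ e0 w (boxW w hw) P nP).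
pose phi x := if asbool (dom e0 x) then (u (coord e0 x) + (v (coord e0 x))%:E)%E else 0%E.
have phiE x : dom e0 x -> phi x = (u (coord e0 x) + (v (coord e0 x))%:E)%E.
  by move=> ex; rewrite /phi asboolT.
have phi0 x : ~ K x -> phi x = 0%E.
  rewrite /phi; case: asboolP => // ex nK; apply: weight_outside => //.
  rewrite leNgt; apply/negP => ra; apply: nK; exists (coord e0 x); last exact: chartK.
  move=> j; have js : cmod (coord e0 x 0 j - p 0 j) <= s0.
    rewrite -(@ler_pXn2r _ 2) ?nnegrE ?cmod_ge0 ?(ltW s00) //.
    by apply: le_trans (cmod_le_rho _ _ _) (ltW ra).
  by split; apply: le_trans js; [exact: cmod_ge_Re|exact: cmod_ge_Im].
have vc : {for p, continuous v}.
  apply: (@smooth_continuous R n setT _ _ _ I).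
  by apply: (@smooth_corr R n p a id) => // z _; apply: ex_diff.
have [r1 r10 hr1] : exists2 r1, 0 < r1 & forall w, vnorm (w - p) < r1 -> `|v w - v p| < 1.
  have nb : nbhs (v p) [set y | `|y - v p| < 1].
    by apply/nbhs_ballP; exists 1 => //= y; rewrite -ball_normE /= distrC.
  exact: (nbhs_vnorm _ _).1 (vc _ nb).
have vb w : vnorm (w - p) < r1 -> `|v w| <= `|v p| + 1.
  by move=> /hr1 h; have := ler_normD (v w - v p) (v p); rewrite subrK; lra.
have D0 : 0 <= D by exact: normr_ge0.
have n0 : 1 <= n%:R :> R by rewrite ler1n; exact: leq_ltn_trans (ltn_ord i0).
have ln0 : 0 <= ln n%:R :> R by exact: ln_ge0.
(* Collects the offset [D], the bound for the correction near [p], and the loss of passing from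
   [rho] to its largest term. *)
pose C := D + `|v p| + 1 + 2^-1 * ln n%:R.
have h20 : 0 < (2^-1 : R) by rewrite invr_gt0.
have l20 : 0 <= 2^-1 * ln n%:R :> R by rewrite mulr_ge0 // ltW.
exists phi, C, (Num.min r1 1); split.
- move=> x; have [ex|ex] := pselect (dom e0 x).
    exists (dom e0), (fun x => u (coord e0 x)), (fun x => v (coord e0 x)); split=> //.
    + exact: psh_psi.
    + exact: smooth_on_corr.
  have oK : open (~` K) by exact: closed_openC.
  exists (~` K), (fun=> 0%E), (fun=> 0); split.
  + by move=> [w /boxW[y ey <-] xw]; apply: ex; rewrite -xw chartK.
  + exact: psh_zero.
  + exact: smooth_zero.
  + by move=> y nK; rewrite phi0 // adde0.
- by rewrite lt_min r10 ltr01.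
- move=> x ex; rewrite lt_min => /andP[/vb vx _] j; rewrite phiE //.
  have vx' : - (`|v p| + 1) <= v (coord e0 x) by move: vx; rewrite ler_norml => /andP[].
  have [ji|ji] := eqVneq j i0.
    rewrite ji; apply: le_trans (_ : (tau^-1)%:E * lne (cmod (coord e0 x 0 i0 - p 0 i0))%:E - D%:E + (v (coord e0 x))%:E <= _)%E; last first.
      by apply: leeD => //; rewrite /u /psi le_max lexx.
    rewrite -addeA -EFinN -EFinD; apply: leeD => //; rewrite lee_fin /C; lra.
  apply: le_trans (_ : (2^-1)%:E * lne (rho p (coord e0 x))%:E + (v (coord e0 x))%:E <= _)%E; last first.
    by apply: leeD => //; rewrite /u /psi le_max lexx orbT.
  apply: leeD; last by rewrite lee_fin /C; lra.
  rewrite invr1 mul1e; set y := cmod _.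
  have [y0|y0] := leP y 0; first by rewrite le0_lneNy ?lee_fin // leNye.
  have yr : y ^+ 2 <= rho p (coord e0 x) by exact: cmod_le_rho.
  rewrite lne_EFin //; apply: le_trans (lne_aff_ge h20 yr).
  by rewrite lne_EFin ?exprn_gt0 // -EFinM lee_fin lnXn // [ln y *+ 2]mulr2n; lra.
move=> x s ex; rewrite lt_min => /andP[/vb vx x1] hx; rewrite phiE //.
have vx' : v (coord e0 x) <= `|v p| + 1 by move: vx; rewrite ler_norml => /andP[].
have tau0 : 0 < tau by apply: lt_trans tau1.
have t0 : 0 < tau^-1 by rewrite invr_gt0.
have main t : 0 <= t -> (forall j, cmod (coord e0 x 0 j - p 0 j) <= expR (- ((if j == i0 then tau else 1) * t))) ->
    (u (coord e0 x) + (v (coord e0 x))%:E <= (C - t)%:E)%E.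
  move=> tp ht; apply: le_trans (_ : (2^-1 * ln n%:R - t)%:E + (v (coord e0 x))%:E <= _)%E; last first.
    by rewrite -EFinD lee_fin /C; lra.
  apply: leeD => //; rewrite /u /psi ge_max; apply/andP; split.
    have := ht i0; rewrite eqxx => h0.
    apply: le_trans (leeB (lne_aff_le t0 h0 (expR_gt0 _)) (lexx _)) _.
    rewrite expRK -EFinB lee_fin mulrN mulKf ?gt_eqF //; lra.
  have rn : rho p (coord e0 x) <= n%:R * expR (- (2 * t)).
    rewrite mulr_natl -[X in _ *+ X](card_ord n) -sumr_const; apply: ler_sum => j _.
    have hj : cmod (coord e0 x 0 j - p 0 j) <= expR (- t).
      apply: le_trans (ht j) _; rewrite ler_expR lerN2; case: ifP => _; last by rewrite mul1r.
      by rewrite ler_peMl // ltW.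
    rewrite (_ : - (2 * t) = 2%:R * - t); last by ring.
    by rewrite expRM_natl lerXn2r ?nnegrE ?cmod_ge0 ?expR_ge0.
  apply: le_trans (lne_aff_le h20 rn _) _; first by rewrite mulr_gt0 ?expR_gt0 // (lt_le_trans ltr01).
  rewrite lee_fin lnM ?posrE ?expR_gt0 ?(lt_le_trans ltr01) // expRK; lra.
(* For [s < 0] the bound at [s = 0] is stronger, and its hypothesis holds because the radius is at
   most 1. *)
have [sp|sn] := leP 0 s; first exact: main.
apply: le_trans (main 0 (lexx _) _) _.
  move=> j; rewrite mulr0 oppr0 expR0; apply: le_trans (ltW x1).
  by have := cmod_le_vnorm (coord e0 x - p) j; rewrite !mxE.
by rewrite lee_fin; lra.
Qed.

End weight.

(** In [2 * b ^ 2 = a ^ 2] the exponent of the prime 2 is odd on the left and even on the right. *)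
Lemma sqrt2_irrational (R : realType) (a b : nat) : (0 < b)%N -> Num.sqrt 2 * b%:R != a%:R :> R.
Proof.
move=> b0; apply/eqP => e.
have e2 : (2 * b ^ 2 = a ^ 2)%N.
  apply/eqP; rewrite -(eqr_nat R) natrM !natrX -e exprMn sqr_sqrtr //.
have a0 : (0 < a)%N.
  rewrite lt0n; apply: contraTneq b0 => az; move/eqP: e2.
  by rewrite az exp0n // muln_eq0 expn_eq0 andbT /= => /eqP ->.
have := congr1 (fun k => odd (logn 2 k)) e2.
by rewrite lognM ?expn_gt0 ?b0 // !lognX oddD !oddM.
Qed.

Theorem theorem1p2 (R : realType) (n : nat) (hn : (2 <= n)%N)
    (M : complexManifold R n) (z0 : M) :
  exists phi : M -> \bar R,
    quasi_psh phi /\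
    forall (V : set M) (phiA : M -> \bar R),
      V z0 -> psh_on V phiA -> log_poles phiA z0 ->
      (\forall z \near z0, (phi z <= phiA z)%E) ->
      (singularity_exponent phi z0 < singularity_exponent phiA z0)%E.
Proof.
pose tau : R := Num.sqrt 2.
have tau1 : 1 < tau by rewrite -{1}(sqrtr1 R) ltr_sqrt // ltr1n.
have tau2 : tau <= 2.
  by rewrite -(@ler_pXn2r _ 2) ?nnegrE ?sqrtr_ge0 // sqr_sqrtr // expr2; lra.
have [e0 ae0 e0z] := cm_cover z0.
(* Dimension at least 2 provides two axes, whose weights [tau] and 1 have an irrational ratio. *)
pose i0 : 'I_n := Ordinal (ltnW hn); pose i1 : 'I_n := Ordinal hn.
have [phi [C [r [qphi r0 hlow hup]]]] := weight_exists i0 ae0 e0z tau1.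
pose wt (j : 'I_n) : R := if j == i0 then tau else 1.
have wt0 : wt i0 = tau by rewrite /wt eqxx.
exists phi; split=> // V phiA Vz pA lA le.
have wt1 j : 1 <= wt j by rewrite /wt; case: ifP => // _; exact: ltW.
have irr (a b : nat) : (0 < b)%N -> wt i0 * b%:R != a%:R by rewrite wt0; exact: sqrt2_irrational.
have [c1 c1w hc1] := exponent_lower ae0 e0z r0 wt1 (erefl : wt i1 = 1) irr
  (fun x j ex xr => hlow x ex xr j) Vz pA lA le.
have S0 : 0 <= \sum_j wt j by apply: sumr_ge0 => j _; apply: le_trans (wt1 j).
apply: le_lt_trans (_ : (\sum_j wt j)%:E < _)%E.
  apply: ge_ereal_sup => _ [c [c0 mc] <-]; rewrite lee_fin.
  apply: (exponent_upper (i0 := i0) (wt := wt) ae0 e0z r0 _ _ _ hup c0 mc); rewrite ?wt0 //.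
    exact: ltW.
  by move=> j /negPf ji; rewrite /wt ji.
(* The midpoint lies strictly above the bound for [phi] and is still an admissible exponent for
   [phiA]. *)
apply: lt_le_trans (_ : (((\sum_j wt j + c1) / 2)%:E <= _)%E); first by rewrite lte_fin; lra.
apply: ereal_sup_ubound; exists ((\sum_j wt j + c1) / 2) => //; split; first by lra.
by apply: hc1; lra.
Qed.
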